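(* The mapping $X\mapsto\mathrm{Glob}(X)$ induces an embedding of categories $\mathbf{Ho}(\mathbf{CW})\hookrightarrow\mathbf{Ho}(\mathbf{glCW})$ (a functor that is faithful and injective on objects) from the category of homotopy types to the category of dihomotopy types, sending the homotopy class of a continuous map $f$ to $Q(\mathrm{Glob}(f))$, where $Q:\mathbf{glCW}\to\mathbf{Ho}(\mathbf{glCW})$ is the localization functor.
   Context: **Globe.** $\mathrm{Glob}(X)$ is the quotient of $X\times[0,1]$ by $(x,0)=(x',0)$ and $(x,1)=(x',1)$ for all $x,x'$; special points $\underline\iota$ (class of $(x,0)$) and $\underline\sigma$ (class of $(x,1)$); partially ordered by the image of $\{((x,t),(x,t')):t\le t'\}$; $\mathrm{Glob}(f)(x,t)=(f(x),t)$. $\vec D^n=\mathrm{Glob}(D^{n-1})$, $\vec S^n=\mathrm{Glob}(S^{n-1})$ for $n\ge1$ ($D^n$ the closed unit disk, $S^{n-1}$ its boundary); $\vec S^0=\{\underline\iota,\underline\sigma\}$ discrete with trivial order; $\vec S^{n-1}\subset\vec D^n$. **Globular CW-complex.** Start with a discrete set $X^0$. Inductively $X^n$ is obtained from $X^{n-1}$ by attaching globular $n$-cells $\vec D^n_\alpha$ along continuous maps $\phi_\alpha:\vec S^{n-1}\to X^{n-1}$ with $\phi_\alpha(\underline\iota),\phi_\alpha(\underline\sigma)\in X^0$ and such that for every continuous non-decreasing $\phi:[0,1]\to\vec S^{n-1}$ with $\phi(0)=\underline\iota$, $\phi(1)=\underline\sigma$, there are $0=t_0<\dots<t_k=1$ with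 $\phi_\alpha\circ\phi(t_i)\in X^0$ such that (a) for each $0\le i\le k-1$, $\phi_\alpha\circ\phi([t_i,t_{i+1}])\subset\psi_i(\vec D^{d_i})$ for some globular cell of dimension $d_i\le n-1$ with characteristic map $\psi_i:\vec D^{d_i}\to X^{n-1}$; (b) $\phi_\alpha\circ\phi$ restricted to $[t_i,t_{i+1}]$ is non-decreasing (of the form $\psi_i\circ\delta$, $\delta$ continuous non-decreasing into $\vec D^{d_i}$); (c) $\phi_\alpha\circ\phi$ is non-constant. $X$ is $X^n$ for some $n$, or $\bigcup_nX^n$ with the weak topology. It is considered with its cellular decomposition and characteristic maps $\phi_\alpha:\vec D^{n_\alpha}\to X$. For a CW-complex $X$, $\mathrm{Glob}(X)$ is a globular CW-complex with $0$-skeleton $\{\underline\iota,\underline\sigma\}$ and one globular $(n+1)$-cell for each $n$-cell of $X$, obtained by applying $\mathrm{Glob}$ to the attaching data. **Execution paths and morphisms.** An execution path of $X$ is a continuous $\gamma:[0,1]\to X$ for which there are $0=t_0<\dots<t_k=1$, $k\ge1$, with $\gamma(t_i)\in X^0$, such that each $\gamma|_{[t_i,t_{i+1}]}$ lies in the image $\phi_{\alpha_i}(\vec D^{n_{\alpha_i}})$ of one globular cell and is non-decreasing there (of the form $\phi_{\alpha_i}\circ\delta$, $\delta$ continuous non-decreasing); constant paths at points of $X^0$ are also execution paths. $\mathbf{glCW}$ is the category of globular CW-complexes with morphisms the continuous maps $f:X\to Y$ such that $f(X^0)\subset Y^0$ and $f\circ\gamma$ is a non-constant execution path of $Y$ for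 every non-constant execution path $\gamma$ of $X$. **Homotopy categories.** $\mathbf{Ho}(\mathbf{CW})$ has CW-complexes as objects and homotopy classes of continuous maps as morphisms. Two morphisms $f,g:X\to Y$ of $\mathbf{glCW}$ are S-homotopic ($f\sim_Sg$) if there is a continuous $H:X\times[0,1]\to Y$ with $H(-,0)=f$, $H(-,1)=g$ and each $H(-,t)$ a morphism of $\mathbf{glCW}$. An S-homotopy equivalence is a morphism $f$ admitting a morphism $g$ with $f\circ g\sim_S\mathrm{Id}$ and $g\circ f\sim_S\mathrm{Id}$. A T-homotopy equivalence is a morphism inducing a homeomorphism on underlying spaces. A dihomotopy equivalence is a composite of S-homotopy equivalences and T-homotopy equivalences. $\mathbf{Ho}(\mathbf{glCW})$ (the category of dihomotopy types) is the localization of $\mathbf{glCW}$ with respect to dihomotopy equivalences, with the same objects as $\mathbf{glCW}$. *)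

(* Defs.v *)
From HB Require Import structures.
From mathcomp Require Import all_boot all_order all_algebra.
From mathcomp Require Import all_classical all_reals all_analysis.

Set Implicit Arguments.
Unset Strict Implicit.
Unset Printing Implicit Defensive.

Import Order.TTheory GRing.Theory Num.Theory numFieldNormedType.Exports.
Local Open Scope classical_set_scope.
Local Open Scope ring_scope.

Lemma sig_inj (T : Type) (P : T -> Prop) : injective (@sval T P).
Proof. by move=> [x p] [y q] /= e; exact: eq_exist. Qed.

Record category := Category {
  ob :> Type;
  homset : ob -> ob -> Type;
  idm : forall X, homset X X;
  cmp : forall X Y Z, homset Y Z -> homset X Y -> homset X Z;
  cmpA : forall W X Y Z (h : homset Y Z) (g : homset X Y) (f : homset W X),
    cmp h (cmp g f) = cmp (cmp h g) f;
  cmp1m : forall X Y (f : homset X Y), cmp (idm Y) f = f;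
  cmpm1 : forall X Y (f : homset X Y), cmp f (idm X) = f }.

Arguments homset {c} _ _.
Arguments idm {c} X.
Arguments cmp {c X Y Z} _ _.

(* A functor with prescribed object map; fixing it in the type keeps
   statements about the action on morphisms free of transports. *)
Record functor_on (C D : category) (F0 : C -> D) := FunctorOn {
  fmor : forall X Y : C, homset X Y -> homset (F0 X) (F0 Y);
  fmor1 : forall X : C, fmor (idm X) = idm (F0 X);
  fmorM : forall (X Y Z : C) (g : homset Y Z) (f : homset X Y),
    fmor (cmp g f) = cmp (fmor g) (fmor f) }.

Arguments fmor {C D F0} _ {X Y} _.

Definition faithful (C D : category) (F0 : C -> D) (F : functor_on F0) : Prop :=
  forall X Y : C, injective (@fmor C D F0 F X Y).

Definition quot (T : Type) (r : T -> T -> Prop) : Type :=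
  {A : set T | exists x, A = r x}.

Definition cls (T : Type) (r : T -> T -> Prop) (x : T) : quot r :=
  exist _ (r x) (ex_intro _ x erefl).

Definition rep (T : Type) (r : T -> T -> Prop) (c : quot r) : T :=
  sval (cid (svalP c)).

Lemma repK (T : Type) (r : T -> T -> Prop) (c : quot r) : cls r (rep c) = c.
Proof.
apply: sig_inj; rewrite /rep; case: (cid _) => x /= e; exact: esym e.
Qed.

Lemma cls_eq (T : Type) (r : T -> T -> Prop)
    (r_sym : forall x y, r x y -> r y x)
    (r_trans : forall x y z, r x y -> r y z -> r x z) (x y : T) :
  r x y -> cls r x = cls r y.
Proof.
move=> rxy; apply: sig_inj; apply/funext => z; apply/propext; split.
  by apply: r_trans; apply: r_sym.
exact: r_trans.
Qed.

Lemma cls_inj (T : Type) (r : T -> T -> Prop)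
    (r_refl : forall x, r x x) (x y : T) : cls r x = cls r y -> r x y.
Proof. by move=> /(congr1 sval) /= ->; exact: r_refl. Qed.

(* Arrows with a composition that is unital and associative up to a
   congruence. *)
Record precategory := Precategory {
  pob : Type;
  parr : pob -> pob -> Type;
  pid : forall X, parr X X;
  pcmp : forall X Y Z, parr Y Z -> parr X Y -> parr X Z;
  prel : forall X Y, parr X Y -> parr X Y -> Prop;
  prel_refl : forall X Y (f : parr X Y), prel f f;
  prel_sym : forall X Y (f g : parr X Y), prel f g -> prel g f;
  prel_trans : forall X Y (f g h : parr X Y),
    prel f g -> prel g h -> prel f h;
  prel_cmp : forall X Y Z (g g' : parr Y Z) (f f' : parr X Y),
    prel g g' -> prel f f' -> prel (pcmp g f) (pcmp g' f');
  prel_cmpA : forall W X Y Z (h : parr Y Z) (g : parr X Y) (f : parr W X),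
    prel (pcmp h (pcmp g f)) (pcmp (pcmp h g) f);
  prel_cmp1m : forall X Y (f : parr X Y), prel (pcmp (pid Y) f) f;
  prel_cmpm1 : forall X Y (f : parr X Y), prel (pcmp f (pid X)) f }.

Section QuotientCategory.
Context (P : precategory).
Implicit Types X Y Z W : pob P.

Definition pcls X Y (f : parr X Y) : quot (@prel P X Y) := cls (@prel P X Y) f.

Lemma pcls_eq X Y (f g : parr X Y) : prel f g -> pcls f = pcls g.
Proof. by apply: cls_eq; [exact: prel_sym | exact: prel_trans]. Qed.

Lemma prel_rep X Y (f : parr X Y) : prel (rep (pcls f)) f.
Proof. by apply: (cls_inj (@prel_refl P X Y)); rewrite repK. Qed.

Definition qcmp X Y Z (g : quot (@prel P Y Z)) (f : quot (@prel P X Y)) :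
  quot (@prel P X Z) := pcls (pcmp (rep g) (rep f)).

Lemma qcmpE X Y Z (g : parr Y Z) (f : parr X Y) :
  qcmp (pcls g) (pcls f) = pcls (pcmp g f).
Proof. by apply: pcls_eq; apply: prel_cmp; exact: prel_rep. Qed.

Lemma qcmpA W X Y Z (h : quot (@prel P Y Z)) (g : quot (@prel P X Y))
    (f : quot (@prel P W X)) : qcmp h (qcmp g f) = qcmp (qcmp h g) f.
Proof.
rewrite -(repK h) -(repK g) -(repK f) -!/(pcls _) !qcmpE.
exact: pcls_eq (prel_cmpA _ _ _).
Qed.

Lemma qcmp1m X Y (f : quot (@prel P X Y)) : qcmp (pcls (pid Y)) f = f.
Proof.
rewrite -(repK f) -!/(pcls _) qcmpE; exact: pcls_eq (prel_cmp1m _).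
Qed.

Lemma qcmpm1 X Y (f : quot (@prel P X Y)) : qcmp f (pcls (pid X)) = f.
Proof.
rewrite -(repK f) -!/(pcls _) qcmpE; exact: pcls_eq (prel_cmpm1 _).
Qed.

Definition quotient_category : category :=
  Category qcmpA qcmp1m qcmpm1.

End QuotientCategory.

(* Gabriel-Zisman construction: same objects; morphisms are formal composites
   of morphisms of C and of formal inverses of morphisms of W, modulo the
   relations making C -> C[W^-1] a functor that inverts W. *)
Section Localization.
Context (C : category) (W : forall X Y : C, homset X Y -> Prop).

Inductive word : C -> C -> Type :=
| Arr (X Y : C) of homset X Y : word X Y
| Inv (X Y : C) (w : homset X Y) of W w : word Y X
| Comp (X Y Z : C) of word Y Z & word X Y : word X Z.

Inductive word_eq : forall X Y : C, word X Y -> word X Y -> Prop :=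
| word_refl X Y (p : word X Y) : word_eq p p
| word_sym X Y (p q : word X Y) : word_eq p q -> word_eq q p
| word_trans X Y (p q r : word X Y) :
    word_eq p q -> word_eq q r -> word_eq p r
| word_cmp X Y Z (q q' : word Y Z) (p p' : word X Y) :
    word_eq q q' -> word_eq p p' -> word_eq (Comp q p) (Comp q' p')
| word_cmpA V X Y Z (r : word Y Z) (q : word X Y) (p : word V X) :
    word_eq (Comp r (Comp q p)) (Comp (Comp r q) p)
| word_cmp1m X Y (p : word X Y) : word_eq (Comp (Arr (idm Y)) p) p
| word_cmpm1 X Y (p : word X Y) : word_eq (Comp p (Arr (idm X))) p
| word_arr X Y Z (g : homset Y Z) (f : homset X Y) :
    word_eq (Comp (Arr g) (Arr f)) (Arr (cmp g f))
| word_invl X Y (w : homset X Y) (Ww : W w) :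
    word_eq (Comp (Inv Ww) (Arr w)) (Arr (idm X))
| word_invr X Y (w : homset X Y) (Ww : W w) :
    word_eq (Comp (Arr w) (Inv Ww)) (Arr (idm Y)).

Definition word_precategory : precategory :=
  @Precategory C word (fun X => Arr (idm X)) Comp word_eq
    word_refl word_sym word_trans word_cmp word_cmpA word_cmp1m word_cmpm1.

Definition localization : category := quotient_category word_precategory.

Definition loc_map (X Y : C) (f : homset X Y) : @homset localization X Y :=
  @pcls word_precategory X Y (Arr f).

Lemma loc_map1 (X : C) : loc_map (idm X) = @idm localization X.
Proof. by []. Qed.

Lemma loc_mapM (X Y Z : C) (g : homset Y Z) (f : homset X Y) :
  loc_map (cmp g f) = @cmp localization X Y Z (loc_map g) (loc_map f).
Proof.
rewrite /loc_map /= (@qcmpE word_precategory).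
exact: (@pcls_eq word_precategory _ _ _ _ (word_sym (word_arr g f))).
Qed.

Definition loc_functor : @functor_on C localization (fun X => X) :=
  FunctorOn loc_map1 loc_mapM.

End Localization.

(* Injectivity on objects refers to equality of underlying sets, whereas type
   constructors cannot be proved injective.  Spaces are therefore carried by
   sets of points taken in one universe, which contains a copy of every
   (small) type and is closed under the pairs needed by the globe:
   [Mid x t] is the class of (x, t) for 0 < t < 1, [Source] and [Target] are
   the classes of the (x, 0) and of the (x, 1). *)
Inductive upoint (R : realType) : Type :=
| Atom (T : Type) of T
| Coords (n : nat) of 'rV[R]_n
| Source
| Target
| Mid of upoint R & R.

Arguments Atom R {T} _.
Arguments Coords {R n} _.
Arguments Source {R}.
Arguments Target {R}.

Record topology_on (T : Type) := TopologyOn {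
  is_open : set (set T);
  is_openT : is_open setT;
  is_openI : setI_closed is_open;
  is_open_bigcup : forall F : set (set T),
    F `<=` is_open -> is_open (\bigcup_(U in F) U) }.

Record pspace (R : realType) := Space {
  pts : set (upoint R);
  topo : topology_on {p : upoint R | pts p} }.

Definition carrier (R : realType) (X : pspace R) : Type := {p | pts X p}.

Coercion carrier : pspace >-> Sortclass.

Section CarrierTopology.
Context (R : realType) (X : pspace R).

HB.instance Definition _ := gen_eqMixin (carrier X).
HB.instance Definition _ := gen_choiceMixin (carrier X).

Let carrier_open_bigU (J : Type) (f : J -> set (carrier X)) :
  (forall i, is_open (topo X) (f i)) -> is_open (topo X) (\bigcup_i f i).
Proof.
move=> fo; have -> : \bigcup_i f i = \bigcup_(U in range f) U.
  by rewrite bigcup_image.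
by apply: is_open_bigcup => _ [i _ <-]; exact: fo.
Qed.

HB.instance Definition _ := isOpenTopological.Build (carrier X)
  (is_openT (topo X)) (@is_openI _ (topo X)) carrier_open_bigU.

End CarrierTopology.

Section FinalTopology.
Context (S : topologicalType) (T : Type) (f : S -> T).

Definition final_open : set (set T) := [set U | open (f @^-1` U)].

Lemma final_openT : final_open setT.
Proof. by rewrite /final_open /= preimage_setT; exact: openT. Qed.

Lemma final_openI : setI_closed final_open.
Proof. by move=> U V oU oV; exact: openI. Qed.

Lemma final_open_bigcup (F : set (set T)) :
  F `<=` final_open -> final_open (\bigcup_(U in F) U).
Proof.
by move=> Fo; rewrite /final_open /= preimage_bigcup; apply: bigcup_open.
Qed.

Definition final_topology : topology_on T :=
  TopologyOn final_openT final_openI final_open_bigcup.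

End FinalTopology.

Section Globe.
Context (R : realType).

Definition I01 : topologicalType := set_type `[0%R : R, 1%R]%classic.

Lemma I01_proof0 : (0 : R) \in `[0%R : R, 1%R]%classic.
Proof. by rewrite inE /= in_itv /= lexx ler01. Qed.

Lemma I01_proof1 : (1 : R) \in `[0%R : R, 1%R]%classic.
Proof. by rewrite inE /= in_itv /= lexx ler01. Qed.

Definition I0 : I01 := exist _ 0 I01_proof0.
Definition I1 : I01 := exist _ 1 I01_proof1.

Definition Ile (s t : I01) : Prop := (sval s : R) <= sval t.
Definition Ilt (s t : I01) : Prop := (sval s : R) < sval t.

Section GlobeSpace.
Context (X : pspace R).

(* The two poles are always there: Glob of the empty space is the discrete
   space {Source, Target}, so that the globe of S^(n-2) is the boundary of the
   globe of D^(n-1) for n = 1 as well. *)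
Definition glob_pts : set (upoint R) :=
  [set p | [\/ p = Source, p = Target |
    exists (x : X) (t : R), 0 < t < 1 /\ p = Mid (sval x) t]].

Definition glob_point (q : X * I01) : upoint R :=
  if (sval q.2 : R) == 0 then Source
  else if (sval q.2 : R) == 1 then Target
  else Mid (sval q.1) (sval q.2).

Lemma glob_pointP (q : X * I01) : glob_pts (glob_point q).
Proof.
case: q => x [t t01]; rewrite /glob_point /=.
case: eqVneq => [_|t0]; first exact: Or31.
case: eqVneq => [_|t1]; first exact: Or32.
apply: Or33; exists x, t; split => //.
move: t01; rewrite inE /= in_itv /= => /andP[ge0 le1].
by rewrite !lt_neqAle ge0 le1 t1 eq_sym t0.
Qed.

Definition glob_class (q : X * I01) : {p | glob_pts p} :=
  exist _ (glob_point q) (glob_pointP q).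

(* The quotient topology of X x [0, 1]. *)
Definition Glob : pspace R := Space (final_topology glob_class).

Definition gsource : Glob := exist _ Source (Or31 _ _ erefl).
Definition gtarget : Glob := exist _ Target (Or32 _ _ erefl).

(* The first disjunct only matters for empty X. *)
Definition glob_le (p q : Glob) : Prop :=
  p = q \/ exists (x : X) (s t : I01),
    [/\ Ile s t, p = glob_class (x, s) & q = glob_class (x, t)].

Definition Glob_sub (A : set X) : set Glob :=
  [set p | [\/ p = gsource, p = gtarget |
    exists x t, A x /\ p = glob_class (x, t)]].

Lemma glob_classP (p : Glob) :
  [\/ p = gsource, p = gtarget | exists q, p = glob_class q].
Proof.
case: p => p; case=> [e|e|[x [t [t01 e]]]].
- by apply: Or31; apply: sig_inj.
- by apply: Or32; apply: sig_inj.
- apply: Or33; have tI : t \in `[0%R : R, 1%R]%classic.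
    by rewrite inE /= in_itv /=; case/andP: t01 => /ltW -> /ltW ->.
  exists (x, exist _ t tI); apply: sig_inj; apply: etrans e _; rewrite /= /glob_point /=.
  by case/andP: t01 => t0 t1; rewrite (gt_eqF t0) (lt_eqF t1).
Qed.

End GlobeSpace.

Definition Glob_map (X Y : pspace R) (f : X -> Y) (p : Glob X) : Glob Y :=
  match pselect (exists q, p = glob_class q) with
  | left ex => let q := sval (cid ex) in glob_class (f q.1, q.2)
  | right _ => if pselect (p = gsource X) then gsource Y else gtarget Y
  end.

Lemma glob_class0 (X : pspace R) (x : X) : glob_class (x, I0) = gsource X.
Proof. by apply: sig_inj; rewrite /= /glob_point /= eqxx. Qed.

Lemma glob_class1 (X : pspace R) (x : X) : glob_class (x, I1) = gtarget X.
Proof. by apply: sig_inj; rewrite /= /glob_point /= oner_eq0 eqxx. Qed.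

Lemma Glob_map_class (X Y : pspace R) (f : X -> Y) (x : X) (t : I01) :
  Glob_map f (glob_class (x, t)) = glob_class (f x, t).
Proof.
rewrite /Glob_map; case: pselect => [ex|[]]; last by exists (x, t).
case: (cid ex) => -[y s] /= /(congr1 sval) /= e; apply: sig_inj.
move: e; rewrite /= /glob_point /=.
case: (eqVneq (sval t) 0) => [t0|t0]; case: (eqVneq (sval s) 0) => [s0|s0] //.
- by case: ifP.
- by case: ifP.
case: (eqVneq (sval t) 1) => [t1|t1]; case: (eqVneq (sval s) 1) => [s1|s1] //.
by case=> /sig_inj -> ->.
Qed.

Lemma Glob_map_source (X Y : pspace R) (f : X -> Y) :
  Glob_map f (gsource X) = gsource Y.
Proof.
have [x|noX] := pselect (exists x : X, True).
  by case: x => x _; rewrite -(glob_class0 x) Glob_map_class glob_class0.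
rewrite /Glob_map; case: pselect => [ex|_]; last by case: pselect.
by exfalso; case: ex => -[x ?] _; apply: noX; exists x.
Qed.

Lemma Glob_map_target (X Y : pspace R) (f : X -> Y) :
  Glob_map f (gtarget X) = gtarget Y.
Proof.
have [x|noX] := pselect (exists x : X, True).
  by case: x => x _; rewrite -(glob_class1 x) Glob_map_class glob_class1.
rewrite /Glob_map; case: pselect => [ex|_]; last by case: pselect => // /(congr1 sval).
by exfalso; case: ex => -[x ?] _; apply: noX; exists x.
Qed.

End Globe.

Arguments I01 R : clear implicits.
Arguments I0 {R}.
Arguments I1 {R}.

Section Disks.
Context (R : realType) (n : nat).

Definition unit_ball : set 'rV[R]_n := [set v | \sum_i v ord0 i ^+ 2 <= 1].

Definition disk_pts : set (upoint R) :=
  [set Coords v | v in unit_ball].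

Definition disk_point (v : set_type unit_ball) : {p | disk_pts p} :=
  exist _ (Coords (sval v)) (imageP Coords (set_mem (svalP v))).

(* [disk_point] is bijective, hence a homeomorphism. *)
Definition disk : pspace R := Space (final_topology disk_point).

(* [sphere] is S^(n-1), the boundary of D^n; it is empty for n = 0. *)
Definition sphere : set disk :=
  [set disk_point v | v in [set v : set_type unit_ball |
    \sum_i (sval v : 'rV[R]_n) ord0 i ^+ 2 = 1]].

End Disks.

Arguments disk R n : clear implicits.
Arguments sphere R n : clear implicits.

(* A cell decomposition is given by the sets of characteristic maps; indexing
   is unnecessary because distinct cells have distinct characteristic maps.
   [E n] with boundary [dE n] is the model of the n-th kind of cell:
   (D^n, S^(n-1)) for CW-complexes, with [X0] empty, and
   (Glob D^n, Glob S^(n-1)), of dimension n + 1, for globular CW-complexes. *)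
Section CellComplexes.
Context (R : realType) (E : nat -> pspace R) (dE : forall n, set (E n)).
Context (X : pspace R) (X0 : set X) (cells : forall n, set (E n -> X)).

Definition skel (n : nat) : set X := X0 `|`
  [set x | exists m phi e, [/\ (m < n)%N, @cells m phi & x = phi e]].

(* [skel n.+1] is the pushout obtained from [skel n] by attaching all the
   cells of kind n along the restrictions of their characteristic maps to
   [@dE n]. *)
Definition attached (n : nat) : Prop :=
  [/\ forall phi, @cells n phi -> phi @` @dE n `<=` skel n,
      forall phi e, @cells n phi -> ~ @dE n e -> ~ skel n (phi e),
      forall phi psi e e', @cells n phi -> @cells n psi ->
        ~ @dE n e -> ~ @dE n e' -> phi e = psi e' -> phi = psi /\ e = e' &
      forall U : set X, open (U : set (subspace (skel n.+1))) <->
        open (U : set (subspace (skel n))) /\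
        forall phi, @cells n phi -> open (phi @^-1` U)].

Definition cell_complex : Prop :=
  [/\ forall U : set X, open (U : set (subspace X0)),
      forall n, attached n,
      \bigcup_n skel n = setT &
      forall U : set X,
        (forall n, open (U : set (subspace (skel n)))) -> open U].

End CellComplexes.

Section CW.
Context (R : realType).

Record CW_data := CWData {
  cw_space :> pspace R;
  cw_cells : forall n, set (disk R n -> cw_space) }.

Definition is_CW (X : CW_data) : Prop :=
  cell_complex (sphere R) set0 (@cw_cells X).

Record CW := MkCW { cw_data :> CW_data; cwP : is_CW cw_data }.

Definition cmap (X Y : CW) : Type := {f : X -> Y | continuous f}.

Definition homotopic (X Y : CW) (f g : cmap X Y) : Prop :=
  exists H : X * I01 R -> Y, [/\ continuous H,
    forall x, H (x, I0) = sval f x & forall x, H (x, I1) = sval g x].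

Lemma homotopic_refl (X Y : CW) (f : cmap X Y) : homotopic f f.
Proof.
exists (fun q => sval f q.1); split => // q.
apply: continuous_comp; [exact: cvg_fst | exact: (svalP f)].
Qed.

Definition Iclamp (r : R) : I01 R :=
  insubd I0 (Num.min 1 (Num.max 0 r)).

Lemma IclampE (r : R) : sval (Iclamp r) = Num.min 1 (Num.max 0 r).
Proof.
rewrite /Iclamp insubdK // inE /= in_itv /= le_min ler01 le_max lexx /=.
by rewrite ge_min lexx.
Qed.

Lemma I01E (t : I01 R) : 0 <= sval t <= 1.
Proof. by case: t => t /=; rewrite inE /= in_itv. Qed.

Lemma Iclamp_id (t : I01 R) : Iclamp (sval t) = t.
Proof.
apply: sig_inj; rewrite IclampE; case/andP: (I01E t) => t0 t1.
by rewrite (max_idPr t0) (min_idPr t1).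
Qed.

Lemma sval_I01_continuous : continuous (fun t : I01 R => sval t : R).
Proof. exact: (@initial_continuous _ R (@set_val R _)). Qed.

Lemma Iclamp_continuous : continuous Iclamp.
Proof.
apply/continuousP => _ [B oB <-].
have -> : Iclamp @^-1` (set_val @^-1` B) =
    (fun r : R => Num.min 1 (Num.max 0 r)) @^-1` B.
  by apply/funext => r /=; rewrite set_valE /= IclampE.
move: B oB; apply/continuousP => r.
apply: continuous_min; first exact: cvg_cst.
by apply: continuous_max; [exact: cvg_cst | exact: cvg_id].
Qed.

Section Reparam.
Context (T U V : topologicalType).

Lemma pair_continuous (f : T -> U) (g : T -> V) :
  continuous f -> continuous g -> continuous (fun x => (f x, g x)).
Proof. by move=> cf cg x; exact: cvg_pair (cf x) (cg x). Qed.

End Reparam.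

Lemma second_continuous (T : topologicalType) :
  continuous (fun q : T * I01 R => sval q.2 : R).
Proof.
move=> q.
apply: (@continuous_comp _ _ _ snd (fun t : I01 R => sval t : R));
  [exact: cvg_snd | exact: sval_I01_continuous].
Qed.

Lemma reparam_continuous (T U : topologicalType) (H : T * I01 R -> U)
    (a : R -> R) :
  continuous H -> continuous a ->
  continuous (fun q : T * I01 R => H (q.1, Iclamp (a (sval q.2)))).
Proof.
move=> cH ca q.
apply: (@continuous_comp _ _ _ (fun q : T * I01 R =>
  (q.1, Iclamp (a (sval q.2)))) H); last exact: cH.
apply: pair_continuous => [{}q|{}q]; first exact: cvg_fst.
apply: (@continuous_comp _ _ _ (fun q : T * I01 R => a (sval q.2)) Iclamp);
  last exact: Iclamp_continuous.
apply: (@continuous_comp _ _ _ (fun q : T * I01 R => sval q.2 : R) a);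
  last exact: ca.
exact: second_continuous.
Qed.

Lemma homotopic_sym (X Y : CW) (f g : cmap X Y) :
  homotopic f g -> homotopic g f.
Proof.
move=> [H [cH H0 H1]].
exists (fun q => H (q.1, Iclamp (1 - sval q.2))); split => [|x|x].
- apply: (@reparam_continuous _ _ H (fun r => 1 - r)) => // r.
  by apply: cvgB; [exact: cvg_cst | exact: cvg_id].
- by rewrite /= subr0 -H1; congr (H (_, _)); exact: (Iclamp_id I1).
- by rewrite /= subrr -H0; congr (H (_, _)); exact: (Iclamp_id I0).
Qed.

Lemma homotopic_trans (X Y : CW) (f g h : cmap X Y) :
  homotopic f g -> homotopic g h -> homotopic f h.
Proof.
move=> [H [cH H0 H1]] [K [cK K0 K1]].
pose L (q : X * I01 R) := H (q.1, Iclamp (2 * sval q.2)).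
pose M (q : X * I01 R) := K (q.1, Iclamp (2 * sval q.2 - 1)).
have cmul : continuous (fun r : R => 2 * r) by move=> r; exact: mulrl_continuous.
have cL : continuous L by exact: (reparam_continuous cH cmul).
have cM : continuous M.
  apply: (@reparam_continuous _ _ K (fun r => 2 * r - 1)) => // r.
  by apply: cvgB; [exact: cmul | exact: cvg_cst].
pose v (q : X * I01 R) : R := sval q.2.
have cv : continuous v by exact: second_continuous.
pose N (q : X * I01 R) := if v q <= 2^-1 then L q else M q.
have clo (A : set R) : closed A -> closed (v @^-1` A).
  exact: (proj1 (continuous_closedP v) cv).
have two : (2 * 2^-1 : R) = 1 by rewrite divff // pnatr_eq0.
have two0 : (0 : R) < 2 by [].
have LM q : v q = 2^-1 -> L q = M q.
  rewrite /L /M /v => ->; rewrite two subrr.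
  by rewrite (Iclamp_id I1) (Iclamp_id I0) H1 K0.
exists N; split => [|x|x].
- apply/continuous_subspace_setT.
  have -> : [set: X * I01 R] =
      [set q | v q <= 2^-1] `|` [set q | 2^-1 <= v q].
    apply/seteqP; split => // q _.
    by case/orP: (le_total (v q) 2^-1); [left|right].
  apply: withinU_continuous.
  + exact: (clo _ (@closed_le R 2^-1)).
  + exact: (clo _ (@closed_ge R 2^-1)).
  + apply: (@subspace_eq_continuous _ [set q | v q <= 2^-1] _ L N);
      last exact: continuous_subspaceT.
    by move=> q; rewrite inE /= /N => ->.
  + apply: (@subspace_eq_continuous _ [set q | 2^-1 <= v q] _ M N);
      last exact: continuous_subspaceT.
    move=> q; rewrite inE /= /N => vq; case: ifP => // qv.
    by rewrite LM //; apply/eqP; rewrite eq_le qv vq.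
- rewrite /N /v /= invr_ge0 ler0n /L /= mulr0.
  by rewrite (Iclamp_id I0).
- rewrite /N /v /= lt_geF ?invf_lt1 ?ltr1n // /M /= mulr1.
  by rewrite (_ : 2 - 1 = 1) ?(Iclamp_id I1) // -[2]/(1 + 1) addrK.
Qed.

Lemma cmap_id_proof (X : CW) : continuous (@id X).
Proof. by move=> x; exact: cvg_id. Qed.

Definition cmap_id (X : CW) : cmap X X :=
  exist (fun f : X -> X => continuous f) id (@cmap_id_proof X).

Lemma cmap_comp_proof (X Y Z : CW) (g : cmap Y Z) (f : cmap X Y) :
  continuous (sval g \o sval f).
Proof.
by move=> x; apply: continuous_comp; [exact: (svalP f) | exact: (svalP g)].
Qed.

Definition cmap_comp (X Y Z : CW) (g : cmap Y Z) (f : cmap X Y) : cmap X Z :=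
  exist (fun h : X -> Z => continuous h) (sval g \o sval f)
    (@cmap_comp_proof X Y Z g f).

Lemma homotopic_comp (X Y Z : CW) (g g' : cmap Y Z) (f f' : cmap X Y) :
  homotopic g g' -> homotopic f f' ->
  homotopic (cmap_comp g f) (cmap_comp g' f').
Proof.
move=> [K [cK K0 K1]] [H [cH H0 H1]].
exists (fun q => K (H q, q.2)); split => [q|x|x] /=.
- apply: (@continuous_comp _ _ _ (fun q => (H q, q.2)) K); last exact: cK.
  by apply: pair_continuous => // {}q; exact: cvg_snd.
- by rewrite H0 K0.
- by rewrite H1 K1.
Qed.

Lemma homotopic_cmpA (V X Y Z : CW) (h : cmap Y Z) (g : cmap X Y)
    (f : cmap V X) :
  homotopic (cmap_comp h (cmap_comp g f)) (cmap_comp (cmap_comp h g) f).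
Proof.
have -> : cmap_comp h (cmap_comp g f) = cmap_comp (cmap_comp h g) f.
  exact: sig_inj.
exact: homotopic_refl.
Qed.

Lemma homotopic_cmp1m (X Y : CW) (f : cmap X Y) :
  homotopic (cmap_comp (cmap_id Y) f) f.
Proof.
have -> : cmap_comp (cmap_id Y) f = f by exact: sig_inj.
exact: homotopic_refl.
Qed.

Lemma homotopic_cmpm1 (X Y : CW) (f : cmap X Y) :
  homotopic (cmap_comp f (cmap_id X)) f.
Proof.
have -> : cmap_comp f (cmap_id X) = f by exact: sig_inj.
exact: homotopic_refl.
Qed.

Definition CW_precategory : precategory :=
  @Precategory CW cmap cmap_id cmap_comp homotopic
    homotopic_refl homotopic_sym homotopic_trans homotopic_comp
    homotopic_cmpA homotopic_cmp1m homotopic_cmpm1.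

Definition HoCW : category := quotient_category CW_precategory.

Definition homotopy_class (X Y : CW) (f : cmap X Y) : @homset HoCW X Y :=
  @pcls CW_precategory X Y f.

End CW.

Arguments HoCW R : clear implicits.

Section GlobularCW.
Context (R : realType).

(* [gl_cells n] are the characteristic maps of the globular cells of dimension
   n + 1, with domain Glob D^n. *)
Record glCW_data := GlCWData {
  gl_space :> pspace R;
  gl_vert : set gl_space;
  gl_cells : forall n, set (Glob (disk R n) -> gl_space) }.

Definition gsphere (n : nat) : set (Glob (disk R n)) :=
  Glob_sub (sphere R n).

Definition nondecreasing_on (n : nat) (A : set (I01 R))
    (delta : I01 R -> Glob (disk R n)) : Prop :=
  forall s t, A s -> A t -> Ile s t -> glob_le (delta s) (delta t).

Definition nonconstant (T : Type) (gamma : I01 R -> T) : Prop :=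
  exists s t, gamma s <> gamma t.

Section Paths.
Context (X : pspace R) (X0 : set X).
Context (cells : forall n, set (Glob (disk R n) -> X)).

Definition monotone_in_cell (A : set (I01 R)) (gamma : I01 R -> X) : Prop :=
  exists n phi (delta : I01 R -> Glob (disk R n)),
    [/\ @cells n phi, {within A, continuous delta}, nondecreasing_on A delta &
        forall s, A s -> gamma s = phi (delta s)].

Definition piecewise_monotone (gamma : I01 R -> X) : Prop :=
  exists (k : nat) (t : nat -> I01 R),
    [/\ (0 < k)%N /\ (forall i, (i < k)%N -> Ilt (t i) (t i.+1)),
        t 0%N = I0 /\ t k = I1,
        forall i, (i <= k)%N -> X0 (gamma (t i)) &
        forall i, (i < k)%N ->
          monotone_in_cell [set s | Ile (t i) s /\ Ile s (t i.+1)] gamma].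

End Paths.

(* The cells of dimension at most N. *)
Definition cells_below (X : glCW_data) (N : nat) (n : nat) :
  set (Glob (disk R n) -> X) := [set phi | (n < N)%N /\ @gl_cells X n phi].

Definition is_glCW (X : glCW_data) : Prop :=
  cell_complex gsphere (@gl_vert X) (@gl_cells X) /\
  forall n (phi : Glob (disk R n) -> X), @gl_cells X n phi ->
    [/\ gl_vert (phi (gsource _)), gl_vert (phi (gtarget _)) &
      forall gamma : I01 R -> Glob (disk R n),
        continuous gamma -> (forall s, gsphere (gamma s)) ->
        nondecreasing_on setT gamma ->
        gamma I0 = gsource _ -> gamma I1 = gtarget _ ->
        piecewise_monotone (@gl_vert X) (@cells_below X n) (phi \o gamma) /\
        nonconstant (phi \o gamma)].

Record glCW := MkGlCW { gl_data :> glCW_data; glCWP : is_glCW gl_data }.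

Definition execution_path (X : glCW_data) (gamma : I01 R -> X) : Prop :=
  continuous gamma /\
  (piecewise_monotone (@gl_vert X) (@gl_cells X) gamma \/
   exists x, gl_vert x /\ forall s, gamma s = x).

Definition is_glCW_morphism (X Y : glCW_data) (f : X -> Y) : Prop :=
  [/\ continuous f,
      forall x, gl_vert x -> gl_vert (f x) &
      forall gamma : I01 R -> X, execution_path gamma -> nonconstant gamma ->
        execution_path (f \o gamma) /\ nonconstant (f \o gamma)].

Definition glmor (X Y : glCW) : Type := {f : X -> Y | is_glCW_morphism f}.

Lemma glmor_id_proof (X : glCW) : is_glCW_morphism (@id X).
Proof. by split => // x; exact: cvg_id. Qed.

Definition glmor_id (X : glCW) : glmor X X := exist _ id (glmor_id_proof X).

Lemma glmor_comp_proof (X Y Z : glCW) (g : glmor Y Z) (f : glmor X Y) :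
  is_glCW_morphism (sval g \o sval f).
Proof.
case: g f => g [cg g0 gp] [f [cf f0 fp]] /=; split.
- by move=> x; apply: continuous_comp; [exact: cf | exact: cg].
- by move=> x /f0 /g0.
- by move=> gamma eg ng; case: (fp _ eg ng) => ef nf; exact: (gp _ ef nf).
Qed.

Definition glmor_comp (X Y Z : glCW) (g : glmor Y Z) (f : glmor X Y) :
  glmor X Z := exist _ (sval g \o sval f) (glmor_comp_proof g f).

Lemma glmor_cmpA (V X Y Z : glCW) (h : glmor Y Z) (g : glmor X Y)
    (f : glmor V X) :
  glmor_comp h (glmor_comp g f) = glmor_comp (glmor_comp h g) f.
Proof. exact: sig_inj. Qed.

Lemma glmor_cmp1m (X Y : glCW) (f : glmor X Y) :
  glmor_comp (glmor_id Y) f = f.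
Proof. exact: sig_inj. Qed.

Lemma glmor_cmpm1 (X Y : glCW) (f : glmor X Y) :
  glmor_comp f (glmor_id X) = f.
Proof. exact: sig_inj. Qed.

Definition glCW_category : category :=
  Category glmor_cmpA glmor_cmp1m glmor_cmpm1.

Definition S_homotopic (X Y : glCW) (f g : glmor X Y) : Prop :=
  exists H : X * I01 R -> Y, [/\ continuous H,
    forall x, H (x, I0) = sval f x, forall x, H (x, I1) = sval g x &
    forall t : I01 R, is_glCW_morphism (fun x : X => H (x, t))].

Definition S_equivalence (X Y : glCW) (f : glmor X Y) : Prop :=
  exists g : glmor Y X,
    S_homotopic (glmor_comp f g) (glmor_id Y) /\
    S_homotopic (glmor_comp g f) (glmor_id X).

Definition T_equivalence (X Y : glCW) (f : glmor X Y) : Prop :=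
  exists g : Y -> X,
    [/\ continuous g, cancel (sval f) g & cancel g (sval f)].

Inductive dihomotopy_equivalence :
  forall X Y : glCW_category, homset X Y -> Prop :=
| dihomotopy_S (X Y : glCW_category) (f : homset X Y) :
    S_equivalence f -> dihomotopy_equivalence f
| dihomotopy_T (X Y : glCW_category) (f : homset X Y) :
    T_equivalence f -> dihomotopy_equivalence f
| dihomotopy_comp (X Y Z : glCW_category) (g : homset Y Z) (f : homset X Y) :
    dihomotopy_equivalence g -> dihomotopy_equivalence f ->
    dihomotopy_equivalence (cmp g f).

Definition HoglCW : category := localization dihomotopy_equivalence.

Definition loc_Q : @functor_on glCW_category HoglCW (fun X => X) :=
  loc_functor dihomotopy_equivalence.

Definition Glob_data (X : CW R) : glCW_data :=
  @GlCWData (Glob X) [set gsource X; gtarget X]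
    (fun n => [set Glob_map phi | phi in @cw_cells R X n]).

End GlobularCW.

Arguments HoglCW R : clear implicits.
Arguments loc_Q {R}.

(* Main.v *)
(* Glob of a homotopy is an S-homotopy, and Glob of the projection from the
   cylinder X x [0, 1] is an S-homotopy equivalence with the globes of both ends
   as sections; so Q identifies the globes of homotopic maps.

   Conversely, the homotopy class of f : X -> Y is recovered from Q(Glob(f)) by
   means of observables with values in Y: continuous functions on the space of
   non-constant execution paths of a globular complex that agree on paths that
   are composable or that meet outside the vertices.  Homotopy classes of
   observables are contravariant.  S-homotopic morphisms act on them in the same
   way, and a T-homotopy equivalence acts bijectively: it only subdivides the
   lines (the fibres of the globular cells), and the pieces of a subdivided line
   are composable.  Hence the action factors through Q.  On Glob(Y) the fibre
   over which a path runs is an observable; its pullback along Glob(f),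
   evaluated at the lines of Glob(X), is f. *)

Require Import Defs.
From mathcomp Require Import all_boot all_order all_algebra.
From mathcomp Require Import all_classical all_reals all_analysis.
From mathcomp Require Import lra ring.
From Stdlib Require Eqdep_dec PeanoNat.

Set Implicit Arguments.
Unset Strict Implicit.
Unset Printing Implicit Defensive.

Import Order.TTheory GRing.Theory Num.Theory numFieldNormedType.Exports.
Local Open Scope classical_set_scope.
Local Open Scope ring_scope.

(** * Weak topologies and products with the unit interval *)

(** Localization inverts equivalences; it does not by definition equate S-homotopic morphisms. This
    is why the cylinder of X has to be made into a CW-complex, each D^n x [0, 1] being turned into a
    round ball. The recurring topological difficulty is that weak and quotient topologies must
    survive a product with [0, 1]; local compactness of [0, 1] settles it.

    For faithfulness, the obstacle is that the continuous inverse of a T-homotopy equivalence need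
    not be a morphism: it may send a vertex into the middle of a line, so paths cannot be carried
    backwards. Values of observables can: a path receives the value of any path of the other complex
    through the image of one of its non-vertices, and the two agreement clauses make this
    independent of the choice. Lines alone would not do as arguments of observables, since a
    morphism may send one line to a path along several lines. On Glob(Y) the clause on composable
    paths costs nothing: a non-constant path runs from one pole to the other, so no two are
    composable. *)

Lemma continuous_comp2 (T U V : topologicalType) (f : T -> U) (g : U -> V) :
  continuous f -> continuous g -> continuous (fun x => g (f x)).
Proof. by move=> cf cg x; apply: continuous_comp; [exact: cf | exact: cg]. Qed.

Lemma continuous_fst (T U : topologicalType) : continuous (@fst T U).
Proof. by move=> q; exact: cvg_fst. Qed.

Lemma continuous_snd (T U : topologicalType) : continuous (@snd T U).
Proof. by move=> q; exact: cvg_snd. Qed.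

Lemma continuous_const (T U : topologicalType) (u : U) :
  continuous (fun _ : T => u).
Proof. by move=> x; exact: cvg_cst. Qed.

Lemma closed_preimage (T U : topologicalType) (f : T -> U) (A : set U) :
  continuous f -> closed A -> closed (f @^-1` A).
Proof. by move=> /continuous_closedP; apply. Qed.

Lemma open_preimage (T U : topologicalType) (f : T -> U) (A : set U) :
  continuous f -> open A -> open (f @^-1` A).
Proof. by move=> /continuousP; apply. Qed.

Lemma open_setCP (T : topologicalType) (A : set T) : open (~` A) <-> closed A.
Proof.
split=> [oA|cA]; first by rewrite -[A]setCK; exact: open_closedC.
exact: closed_openC.
Qed.

Section UnitInterval.
Context (R : realType).
Implicit Types s t : I01 R.

Lemma I01_compact_nbhs t (O : set (I01 R)) : nbhs t O ->
  exists K, [/\ compact K, K `<=` O & nbhs t K].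
Proof.
move=> tO.
have : nbhs (sval t : R) (@Iclamp R @^-1` O).
  by apply: (@Iclamp_continuous R (sval t : R) O); rewrite Iclamp_id.
move=> /nbhs_ballP[e /= e0 eO].
have e20 : 0 < e / 2 by rewrite divr_gt0.
exists (@Iclamp R @` `[sval t - e / 2, sval t + e / 2]); split.
- apply: continuous_compact; last exact: segment_compact.
  by apply: continuous_subspaceT; exact: Iclamp_continuous.
- move=> _ [r rI <-]; apply: eO; rewrite /ball /=.
  move: rI; rewrite /= in_itv /= => /andP[r1 r2].
  by rewrite ltr_distlC; apply/andP; split; lra.
- have : nbhs t ((fun u : I01 R => sval u : R) @^-1` ball (sval t : R) (e / 2)).
    by apply: (@sval_I01_continuous R t); exact: nbhsx_ballx.
  apply: filterS => s /= st; exists (sval s : R); last exact: Iclamp_id.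
  move: st; rewrite /ball /= ltr_distlC in_itv /= => /andP[s1 s2].
  by rewrite !ltW.
Qed.

(* The weak topology of a family of maps survives the product with [0, 1]
   because [0, 1] is locally compact. *)
Lemma closed_prod_weak (X : topologicalType) (A : set X) (J : Type)
    (E : J -> topologicalType) (phi : forall j, E j -> X)
    (C : set (X * I01 R)) :
  (forall B : set X, B `<=` A -> (forall j, closed (@phi j @^-1` B)) ->
    closed B) ->
  (forall q, C q -> A q.1) ->
  (forall j, closed [set q : E j * I01 R | C (phi j q.1, q.2)]) ->
  (forall x, closed [set t | C (x, t)]) ->
  closed C.
Proof.
move=> weak CA phiC secC; rewrite -open_setCP openE => -[x0 t0] /= nC.
have : nbhs t0 [set t | ~ C (x0, t)].
  by apply: open_nbhs_nbhs; split => //; exact: closed_openC (secC x0).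
move=> /I01_compact_nbhs[K [cK KC Kt0]].
(* [B] is the projection of the part of [C] over the compact set [K]. Once [B] is closed, its
   complement times [K] is a neighbourhood of [(x0, t0)] that misses [C]. On each [E j] this is the
   tube lemma. *)
pose B := [set x | exists2 t, K t & C (x, t)].
have cB : closed B.
  apply: weak => [x [t _ /CA]//|j].
  rewrite -open_setCP openE => e /= nB.
  have /compact_near_coveringP nK := cK.
  have : nbhs e [set e' | K `<=` [set t | ~ C (phi j e', t)]].
    apply: (nK _ _ (fun e' t => ~ C (phi j e', t))) => t Kt.
    have : nbhs (e, t) (~` [set q : E j * I01 R | C (phi j q.1, q.2)]).
      apply: open_nbhs_nbhs; split; first exact: closed_openC.
      by move=> /= Cet; apply: nB; exists t.
    case=> -[P Q] /= [eP tQ] PQ; exists (Q, P) => //= -[t' e'] /= [Qt' Pe'].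
    exact: (PQ (e', t')).
  by apply: filterS => e' He' [t Kt]; exact: He'.
have nBx : ~ B x0 by move=> [t /KC].
exists (~` B, K) => /=.
  by split=> //; apply: open_nbhs_nbhs; split=> //; exact: closed_openC.
by move=> [x t] /= [nB Kt] Cxt; apply: nB; exists t.
Qed.

End UnitInterval.

(** * Cell structures *)

Section CellStructure.
Context (R : realType) (E : nat -> pspace R) (dE : forall n, set (E n)).
Context (X : pspace R) (X0 : set X) (cells : forall n, set (E n -> X)).
Local Notation skel := (skel X0 cells).

(* The inductive pushouts, in terms of the final topology for all the
   characteristic maps; [cell_weak_skel] carries closure finiteness. *)
Record cell_structure : Prop := CellStructure {
  cell_bdry : forall n phi, @cells n phi -> phi @` @dE n `<=` skel n;
  cell_int : forall n phi e,
    @cells n phi -> ~ @dE n e -> ~ skel n (phi e);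
  cell_inj : forall n phi psi e e', @cells n phi -> @cells n psi ->
    ~ @dE n e -> ~ @dE n e' -> phi e = psi e' -> phi = psi /\ e = e';
  cell_cover : \bigcup_n skel n = setT;
  cell_cont : forall n phi, @cells n phi -> continuous phi;
  cell_weak : forall C : set X,
    (forall n phi, @cells n phi -> closed (phi @^-1` C)) -> closed C;
  cell_weak_skel : forall n (C : set X), C `<=` skel n ->
    (forall m phi, (m < n)%N -> @cells m phi -> closed (phi @^-1` C)) ->
    closed C }.

Lemma skel_le m n : (m <= n)%N -> skel m `<=` skel n.
Proof.
move=> mn x [?|[k [phi [e [km ? ?]]]]]; [by left | right].
by exists k, phi, e; split => //; exact: leq_trans km mn.
Qed.

Lemma skel_cell m n phi e : (m < n)%N -> @cells m phi -> skel n (phi e).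
Proof. by move=> mn cphi; right; exists m, phi, e. Qed.

Lemma skel0 : skel 0 = X0.
Proof.
by apply/seteqP; split=> [x [//|[m [? [? []]]]]|x]; last by left.
Qed.

Lemma cell_structure_complex :
  cell_structure -> cell_complex dE X0 cells.
Proof.
case=> bdry int inj cover cont weak weak_skel.
have closed_outside n (U V : set X) m (phi : E m -> X) : open V ->
    V `&` skel n = U `&` skel n -> (m < n)%N -> @cells m phi ->
    open (phi @^-1` U).
  move=> oV VU mn cphi; rewrite (_ : phi @^-1` U = phi @^-1` V).
    exact: open_preimage (cont _ _ cphi) oV.
  apply/funext => e /=; have se := skel_cell e mn cphi.
  apply/propext; split=> [Ue|Ve].
    by have [] : (V `&` skel n) (phi e) by rewrite VU.
  by have [] : (U `&` skel n) (phi e) by rewrite -VU.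
have open_skel n (U : set X) :
    (forall m phi, (m < n)%N -> @cells m phi -> open (phi @^-1` U)) ->
    open (U : set (subspace (skel n))).
  (* The part of the skeleton missed by [U] is closed in all of [X] by [cell_weak_skel], so its
     complement is an open set of [X] with the trace of [U]. *)
  move=> oU; apply/open_subspaceP; exists (~` (skel n `\` U)).
    apply: closed_openC; apply: (weak_skel n) => [x []//|m phi mn cphi].
    rewrite (_ : phi @^-1` _ = ~` (phi @^-1` U)).
      exact: open_closedC (oU m phi mn cphi).
    apply/seteqP; split=> [e []//|e /= nU]; split=> //;
      exact: skel_cell mn cphi.
  apply/seteqP; split=> x /= [h1 h2]; split=> //.
  - by apply: contrapT => nU; exact: h1.
  - by case.
split=> // [U|n|U oU].
- by rewrite -{1}skel0; apply: open_skel.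
- split=> //; [exact: bdry | exact: int | exact: inj |].
  move=> U; split=> [/open_subspaceP[V oV VU]|[/open_subspaceP[V oV VU] Un]].
  + split=> [|phi cphi]; last exact: closed_outside VU (ltnSn n) cphi.
    by apply: open_skel => m phi mn; exact: closed_outside VU (ltnW mn).
  + apply: open_skel => m phi; rewrite ltnS leq_eqVlt => /orP[/eqP mn|mn] cphi.
      by subst m; exact: Un.
    exact: closed_outside VU mn cphi.
- rewrite -(setCK U); apply: closed_openC; apply: weak => n phi cphi.
  rewrite preimage_setC; apply: open_closedC.
  have /open_subspaceP[V oV VU] := oU n.+1.
  exact: closed_outside VU (ltnSn n) cphi.
Qed.

(** Closure finiteness is the delicate clause. A set [C] inside [skel n] meets a cell of kind at
    least n only along its boundary, because the interior avoids the skeleton; there its trace is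
    the closed boundary cut by the preimage of a closed set. So [C] stays closed from one skeleton
    to the next. *)
Lemma cell_complex_structure :
  (forall n, closed (@dE n)) ->
  cell_complex dE X0 cells -> cell_structure.
Proof.
move=> cdE [disc att cover final].
have cont n phi : @cells n phi -> continuous phi.
  move=> cphi; apply/continuousP => U oU.
  have [_ _ _ /(_ U)[+ _]] := att n.
  by case=> [|_]; [apply/open_subspaceP; exists U | exact].
have open_skel n (U : set X) :
    (forall m phi, (m < n)%N -> @cells m phi -> open (phi @^-1` U)) ->
    open (U : set (subspace (skel n))).
  elim: n => [|n IHn] oU; first by rewrite skel0; exact: disc.
  have [_ _ _ /(_ U)[_ +]] := att n; apply; split=> [|phi]; last exact: oU.
  by apply: IHn => m phi mn; apply: oU; exact: ltnW.
split=> //.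
- by move=> n phi; have [+ _ _ _] := att n; apply.
- by move=> n phi e; have [_ + _ _] := att n; apply.
- by move=> n phi psi e e'; have [_ _ + _] := att n; apply.
- move=> C clC; rewrite -open_setCP; apply: final => n; apply: open_skel.
  move=> m phi _ /clC; rewrite preimage_setC; exact: closed_openC.
- move=> n C Cn clC; rewrite -open_setCP; apply: final => N.
  (* Skeleta are nested, so those above [n] suffice; the induction on [k] starts from the hypothesis
     on the cells below [n]. *)
  suff open_add k : open (~` C : set (subspace (skel (n + k)))).
    have /open_subspaceP[V oV VC] := open_add N.
    apply/open_subspaceP; exists V => //.
    have sub : skel N `<=` skel (n + N) by apply: skel_le; exact: leq_addl.
    by rewrite -(setIidr sub) !setIA VC.
  elim: k => [|k IHk].
    rewrite addn0; apply: open_skel => m phi mn cphi.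
    by rewrite preimage_setC; apply: closed_openC; exact: clC mn cphi.
  rewrite addnS; have [bdry int _ /(_ (~` C))[_ +]] := att (n + k)%N; apply.
  split=> // phi cphi; have /open_subspaceP[V oV VC] := IHk.
  rewrite preimage_setC; apply: closed_openC.
  change (closed (phi @^-1` C)).
  rewrite (_ : phi @^-1` C = @dE (n + k)%N `&` phi @^-1` (~` V)).
    apply: closedI => //; apply: closed_preimage; first exact: cont cphi.
    exact: open_closedC.
  apply/seteqP; split=> e /=.
    move=> Ce; have se : skel (n + k) (phi e) by apply: skel_le (Cn _ Ce);
      exact: leq_addr.
    split; first by apply: contrapT => nde; exact: (int phi e cphi nde se).
    by move=> Ve; have [] : (~` C `&` skel (n + k)) (phi e) by rewrite -VC.
  move=> [de nV]; have se : skel (n + k) (phi e) by apply: (bdry phi cphi);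
    exists e.
  apply: contrapT => nC; apply: nV.
  by have [] : (V `&` skel (n + k)) (phi e) by rewrite VC.
Qed.

End CellStructure.

(** * The topology of globes *)

Section GlobeTopology.
Context (R : realType).
Implicit Types (X Y : pspace R) (s t : I01 R).

Definition Iinside t : Prop := 0 < (sval t : R) < 1.

Lemma I01_eq0 t : (sval t : R) = 0 -> t = I0.
Proof. by move=> t0; apply: sig_inj. Qed.

Lemma I01_eq1 t : (sval t : R) = 1 -> t = I1.
Proof. by move=> t1; apply: sig_inj. Qed.

Lemma I01_cases t : [\/ t = I0, t = I1 | Iinside t].
Proof.
have /andP[t0 t1] := I01E t.
have [/I01_eq0 ->|tn0] := eqVneq (sval t : R) 0; first exact: Or31.
have [/I01_eq1 ->|tn1] := eqVneq (sval t : R) 1; first exact: Or32.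
by apply: Or33; rewrite /Iinside !lt_neqAle t0 t1 tn1 eq_sym tn0.
Qed.

Lemma Iinside0 : ~ Iinside I0.
Proof. by rewrite /Iinside /= ltxx. Qed.

Lemma Iinside1 : ~ Iinside I1.
Proof. by rewrite /Iinside /= ltxx andbF. Qed.

Definition Ihalf : I01 R := Iclamp (2^-1).

Lemma IhalfE : (sval Ihalf : R) = 2^-1.
Proof. by rewrite IclampE (max_idPr _) ?(min_idPr _) //; lra. Qed.

Lemma Iinside_half : Iinside Ihalf.
Proof. by rewrite /Iinside IhalfE; lra. Qed.

Lemma Ile0 t : Ile I0 t. Proof. by case/andP: (I01E t). Qed.

Lemma Ile1 t : Ile t I1. Proof. by case/andP: (I01E t). Qed.

Lemma Ile_refl t : Ile t t. Proof. exact: lexx. Qed.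

Lemma Ile_trans s t u : Ile s t -> Ile t u -> Ile s u.
Proof. exact: le_trans. Qed.

Lemma Ile_total s t : Ile s t \/ Ile t s.
Proof. by apply/orP; exact: le_total. Qed.

Lemma Ile_anti s t : Ile s t -> Ile t s -> s = t.
Proof. by move=> st ts; apply/sig_inj/eqP; rewrite eq_le; apply/andP. Qed.

Lemma Ilt_le s t : Ilt s t -> Ile s t. Proof. exact: ltW. Qed.

Lemma open_Iinside : open Iinside.
Proof.
rewrite (_ : Iinside = (fun t : I01 R => sval t : R) @^-1` `]0, 1[).
  apply: open_preimage; first exact: sval_I01_continuous.
  exact: interval_open.
by apply/funext => t; rewrite /Iinside /= in_itv.
Qed.

Lemma closed_I_eq t : closed [set t].
Proof.
rewrite (_ : [set t] = (fun u : I01 R => sval u : R) @^-1` [set sval t : R]).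
  by apply: closed_preimage; [exact: sval_I01_continuous | exact: closed_eq].
by apply/seteqP; split=> u /=; [move=> -> | exact: sig_inj].
Qed.

Lemma glob_class_continuous X : continuous (@glob_class R X : X * I01 R -> Glob
  X).
Proof. by apply/continuousP => U. Qed.

Lemma open_GlobP X (U : set (Glob X)) :
  open U <-> open (@glob_class R X @^-1` U).
Proof. by []. Qed.

Lemma closed_GlobP X (U : set (Glob X)) :
  closed U <-> closed (@glob_class R X @^-1` U).
Proof. by rewrite -!open_setCP open_GlobP. Qed.

Lemma continuous_GlobP X (T : topologicalType) (f : Glob X -> T) :
  continuous (fun q : X * I01 R => f (glob_class q)) -> continuous f.
Proof. by move=> /continuousP cf; apply/continuousP => U /cf. Qed.

(** The default branch is the height of [Source]; the other constructors it covers never occur in a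
    globe. *)
Definition gheight X (p : Glob X) : I01 R :=
  match sval p with Target => I1 | Mid _ t => Iclamp t | _ => I0 end.

Lemma gheight_class X (q : X * I01 R) : gheight (glob_class q) = q.2.
Proof.
case: q => x t; rewrite /gheight /= /glob_point /=.
case: eqVneq => [/I01_eq0 ->//|_]; case: eqVneq => [/I01_eq1 ->//|_].
exact: Iclamp_id.
Qed.

Lemma gheight_continuous X : continuous (@gheight X).
Proof.
apply: continuous_GlobP; rewrite (_ : (fun _ => _) = snd).
  exact: continuous_snd.
by apply/funext => q; exact: gheight_class.
Qed.

Lemma glob_cases X (p : Glob X) : [\/ p = gsource X, p = gtarget X |
  exists x t, Iinside t /\ p = glob_class (x, t)].
Proof.
case: (glob_classP p) => [->|->|[[x t] ->]]; [exact: Or31 | exact: Or32 |].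
case: (I01_cases t) => [->|->|t01].
- by rewrite glob_class0; exact: Or31.
- by rewrite glob_class1; exact: Or32.
- by apply: Or33; exists x, t.
Qed.

Lemma gheight0 X (p : Glob X) : gheight p = I0 -> p = gsource X.
Proof.
case: (glob_cases p) => [->//|-> /(congr1 sval)/= /eqP|].
  by rewrite oner_eq0.
by case=> x [t [t01 ->]]; rewrite gheight_class /= => t0; case: Iinside0;
  rewrite -t0.
Qed.

Lemma gheight1 X (p : Glob X) : gheight p = I1 -> p = gtarget X.
Proof.
case: (glob_cases p) => [-> /(congr1 sval)/= /eqP|->//|].
  by rewrite eq_sym oner_eq0.
by case=> x [t [t01 ->]]; rewrite gheight_class /= => t0; case: Iinside1;
  rewrite -t0.
Qed.

Lemma gsource_neq_target X : gsource X <> gtarget X.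
Proof. by move=> /(congr1 sval). Qed.

Lemma gheight_inside X (p : Glob X) : Iinside (gheight p) ->
  exists x, p = glob_class (x, gheight p).
Proof.
case: (glob_cases p) => [->/Iinside0//|->/Iinside1//|[x [t [_ ->]]] _].
by exists x; rewrite gheight_class.
Qed.

Lemma glob_class_inj X (x y : X) s t : Iinside s ->
  glob_class (x, s) = glob_class (y, t) -> x = y /\ s = t.
Proof.
move=> s01 e; have st : s = t by have := congr1 (@gheight X) e;
  rewrite !gheight_class.
split=> //; move: e => /(congr1 sval); rewrite -st /= /glob_point /=.
by case/andP: s01 => s0 s1; rewrite (gt_eqF s0) (lt_eqF s1) => -[/sig_inj].
Qed.

Lemma glob_class_pole X (x y : X) t : ~ Iinside t ->
  glob_class (x, t) = glob_class (y, t).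
Proof. by case: (I01_cases t) => [->|->|//] _;
  rewrite ?glob_class0 ?glob_class1. Qed.

Lemma Glob_map_continuous X Y (f : X -> Y) :
  continuous f -> continuous (Glob_map f).
Proof.
move=> cf; apply: continuous_GlobP.
rewrite (_ : (fun _ => _) = fun q : X * I01 R => glob_class (f q.1,
  q.2) : Glob Y).
  apply: (continuous_comp2 _ (@glob_class_continuous Y)).
  apply: pair_continuous; last exact: continuous_snd.
  exact: (continuous_comp2 (@continuous_fst _ _) cf).
by apply/funext => -[x t]; exact: Glob_map_class.
Qed.

Lemma Glob_map_comp X Y (Z : pspace R) (g : Y -> Z) (f : X -> Y) :
  Glob_map (g \o f) = Glob_map g \o Glob_map f.
Proof.
apply/funext => p /=; case: (glob_classP p) => [->|->|[[x t] ->]].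
- by rewrite !Glob_map_source.
- by rewrite !Glob_map_target.
- by rewrite !Glob_map_class.
Qed.

Lemma Glob_map_id X : Glob_map (@id X) = id.
Proof.
apply/funext => p /=; case: (glob_classP p) => [->|->|[[x t] ->]].
- by rewrite Glob_map_source.
- by rewrite Glob_map_target.
- by rewrite Glob_map_class.
Qed.

Lemma gheight_map X Y (f : X -> Y) p : gheight (Glob_map f p) = gheight p.
Proof.
case: (glob_classP p) => [->|->|[[x t] ->]].
- by rewrite Glob_map_source.
- by rewrite Glob_map_target.
- by rewrite Glob_map_class !gheight_class.
Qed.

(** Away from the poles the globe is the product of [X] with the open interval: nothing is
    identified there, so an open box is saturated and its image is open. Open conditions on the
    fibre coordinate thus become open conditions on the globe. *)
Lemma open_glob_mid X (S : topologicalType) (W : set (X * S)) : open W ->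
  open [set q : Glob X * S | exists x t,
    [/\ Iinside t, q.1 = glob_class (x, t) & W (x, q.2)]].
Proof.
move=> oW; rewrite openE => -[_ s] /= [x [t [t01 -> Wxs]]].
have [[A B] /= [xA sB] AB] : nbhs (x, s) W by exact: open_nbhs_nbhs.
move: xA; rewrite nbhsE => -[A' [oA' A'x] A'A].
exists ([set p | exists x t, [/\ Iinside t, p = glob_class (x, t) & A' x]], B).
  split=> //=; apply: open_nbhs_nbhs; split; last by exists x, t.
  rewrite open_GlobP (_ : _ @^-1` _ = A' `*` Iinside).
    apply: openI; first exact: open_preimage (@continuous_fst _ _) oA'.
    exact: open_preimage (@continuous_snd _ _) open_Iinside.
  apply/seteqP; split=> [[y u] /= [z [v [v01 e A'z]]]|[y u] /= [A'y u01]].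
    by have [<- <-] := glob_class_inj v01 (esym e).
  by exists y, u.
move=> [_ s'] /= [[y [u [u01 -> A'y]]] Bs'].
by exists y, u; split=> //; apply: (AB (y, s')); split=> //; exact: A'A.
Qed.

Lemma glob_le_height X (p q : Glob X) :
  glob_le p q -> Ile (gheight p) (gheight q).
Proof.
case=> [->|[x [s [t [st -> ->]]]]]; first exact: Ile_refl.
by rewrite !gheight_class.
Qed.

Lemma glob_le_class X (x : X) s t :
  Ile s t -> glob_le (glob_class (x, s)) (glob_class (x, t)).
Proof. by move=> st; right; exists x, s, t. Qed.

Lemma glob_le_mid X (x y : X) s t : Iinside s -> Iinside t ->
  glob_le (glob_class (x, s)) (glob_class (y, t)) -> x = y.
Proof.
move=> s01 t01; case=> [/(glob_class_inj s01)[]//|[z [u [v [_ e e']]]]].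
by have [-> _] := glob_class_inj s01 e; have [-> _] := glob_class_inj t01 e'.
Qed.

(** If the middle point is inside, all three share its fibre. If it is a pole, one of the outer
    points is that same pole, which belongs to every fibre and can be relabelled. *)
Lemma glob_le_trans X (p q r : Glob X) :
  glob_le p q -> glob_le q r -> glob_le p r.
Proof.
case=> [->//|[x [s [t [st -> ->]]]]]; case=> [<-|[y [t' [u [tu e ->]]]]].
  exact: glob_le_class.
have tt' : t = t' by have := congr1 (@gheight X) e; rewrite !gheight_class.
subst t'; have su := Ile_trans st tu.
have [t01|t01] := pselect (Iinside t).
  by have [-> _] := glob_class_inj t01 e; exact: glob_le_class.
case: (I01_cases t) => [t0|t1|//].
  have -> : s = I0 by apply: Ile_anti (Ile0 _); rewrite -t0.
  by rewrite (@glob_class_pole _ x y);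
    [exact/glob_le_class/Ile0 | exact: Iinside0].
have -> : u = I1 by apply: Ile_anti (Ile1 _) _; rewrite -t1.
by rewrite (@glob_class_pole _ y x);
  [exact/glob_le_class/Ile1 | exact: Iinside1].
Qed.

(** Comparable inner points lie in the same fibre and the poles lie in all fibres. The point [x0]
    names a fibre for a path that never leaves the poles. *)
Lemma monotone_path_class X (x0 : X) (gamma : I01 R -> Glob X) :
  (forall s t, Ile s t -> glob_le (gamma s) (gamma t)) ->
  exists x, forall s, gamma s = glob_class (x, gheight (gamma s)).
Proof.
move=> mono.
have polar x s : ~ Iinside (gheight (gamma s)) ->
    gamma s = glob_class (x, gheight (gamma s)).
  case: (I01_cases (gheight (gamma s))) => [h0|h1|//] _.
    by rewrite h0 glob_class0; exact: gheight0.
  by rewrite h1 glob_class1; exact: gheight1.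
have [[s h01]|no] := pselect (exists s, Iinside (gheight (gamma s)));
  last first.
  by exists x0 => s; apply: polar => h01; apply: no; exists s.
have [x ex] := gheight_inside h01; exists x => t.
have [k01|k01] := pselect (Iinside (gheight (gamma t))); last exact: polar.
have [y ey] := gheight_inside k01; rewrite {1}ey; congr (glob_class (_, _)).
case: (Ile_total s t) => /mono; rewrite ex ey.
  by move=> /(glob_le_mid h01 k01).
by move=> /(glob_le_mid k01 h01).
Qed.

End GlobeTopology.

(** * The cells of the globe of a CW-complex *)

Section GlobeOfCW.
Context (R : realType).

Lemma continuous_sum_sqr (T : topologicalType) n (f : 'I_n -> T -> R) :
  (forall i, continuous (f i)) -> continuous (fun x => \sum_i f i x ^+ 2).
Proof.
move=> cf; apply: (@continuous_big R _ _ _ _ _ T _ (fun i x => f i x ^+ 2));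
  first exact: add_continuous.
by move=> i _; exact: (continuous_comp2 (g := fun r : R => r ^+ 2) (cf i)
  (@exprn_continuous R 2)).
Qed.

Lemma set_val_continuous (T : topologicalType) (A : set T) :
  continuous (fun v : set_type A => sval v : T).
Proof. exact: (@initial_continuous _ T (@set_val T A)). Qed.

Lemma disk_point_continuous n :
  continuous (@disk_point R n : set_type (@unit_ball R n) -> disk R n).
Proof. by apply/continuousP => U. Qed.

Lemma disk_point_inj n : injective (@disk_point R n).
Proof.
move=> v w /(congr1 sval) /= [] e; apply: sig_inj.
exact: (Eqdep_dec.inj_pair2_eq_dec _ PeanoNat.Nat.eq_dec _ _ _ _ e).
Qed.

Lemma disk_pointP n (e : disk R n) : exists v, e = disk_point v.
Proof.
case: e => p [v v1 e]; have vD : v \in @unit_ball R n by rewrite inE.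
by exists (exist _ v vD); apply: sig_inj.
Qed.

Lemma closed_diskP n (U : set (disk R n)) :
  closed U <-> closed (@disk_point R n @^-1` U).
Proof. by rewrite -!open_setCP. Qed.

Lemma closed_sphere n : closed (sphere R n).
Proof.
rewrite closed_diskP (_ : _ @^-1` _ =
  (fun v : set_type (@unit_ball R n) =>
    \sum_i (sval v : 'rV[R]_n) ord0 i ^+ 2) @^-1` [set 1]).
  apply: closed_preimage; last exact: closed_eq.
  apply: (continuous_sum_sqr
    (f := fun i (v : set_type (@unit_ball R n)) => (sval v : 'rV[R]_n) ord0 i))
      => i.
  exact: (continuous_comp2 (@set_val_continuous _ _) (@coord_continuous _ _ _ _
    _)).
by apply/seteqP; split=> v /=; [case=> w /= w1 /disk_point_inj <- | exists v].
Qed.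

Lemma closed_gsphere n : closed (@gsphere R n).
Proof.
rewrite (_ : @gsphere R n = [set gsource _] `|` [set gtarget _] `|`
   [set p | exists x t, sphere R n x /\ p = glob_class (x, t)]); last first.
  by apply/seteqP; split=> p; [case; [left; left|left; right|right] |
    case=> [[]|]; [exact: Or31|exact: Or32|exact: Or33]].
rewrite closed_GlobP (_ : _ @^-1` _ = (fst @^-1` sphere R n) `|`
    (snd @^-1` [set I0]) `|` (snd @^-1` [set I1])).
  have cI t : closed (snd @^-1` [set t] : set (disk R n * I01 R)).
    by apply: closed_preimage; [exact: continuous_snd | exact: closed_I_eq].
  apply: closedU => //; apply: closedU => //.
  by apply: closed_preimage; [exact: continuous_fst | exact: closed_sphere].
apply/seteqP; split=> -[x t] /=.
- case=> [[]/(congr1 (@gheight R _))|[y [s [Sy e]]]].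
  + by rewrite gheight_class; left; right.
  + by rewrite gheight_class; right.
  + case: (I01_cases t) => [->|->|t01]; [by left; right | by right |].
    by left; left; have [-> _] := glob_class_inj t01 e.
- case=> [[]|].
  + by move=> Sx; right; exists x, t.
  + by move=> ->; left; left; rewrite glob_class0.
  + by move=> ->; left; right; rewrite glob_class1.
Qed.

Section Structure.
Context (X : CW R).
Local Notation cells := (@cw_cells R X).
Local Notation gcells := (@gl_cells R (Glob_data X)).
Local Notation gvert := (@gl_vert R (Glob_data X)).

Lemma CW_structure : cell_structure (sphere R) set0 cells.
Proof. exact: cell_complex_structure (@closed_sphere) (cwP X). Qed.

(** Both poles are vertices, hence in every skeleton, whatever the base point; at inner heights
    [Glob] sees exactly the skeleton of [X]. *)
Lemma skel_glob n (x : X) t :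
  skel gvert gcells n (glob_class (x, t)) <->
  ~ Iinside t \/ skel set0 cells n x.
Proof.
split=> [|[t01|]].
- have [t01|] := pselect (Iinside t); last by left.
  case=> [|[m [_ [e [mn [phi cphi <-] E]]]]].
    case=> /(congr1 (@gheight R _)); rewrite gheight_class /= => E.
      by left; rewrite E; exact: Iinside0.
    by left; rewrite E; exact: Iinside1.
  right; move: E; case: (glob_cases e) => [->|->|[v [s [s01 ->]]]].
  + rewrite Glob_map_source => /(congr1 (@gheight R _));
      rewrite gheight_class /= => E.
    by move: t01; rewrite E => /(@Iinside0 R).
  + rewrite Glob_map_target => /(congr1 (@gheight R _));
      rewrite gheight_class /= => E.
    by move: t01; rewrite E => /(@Iinside1 R).
  + rewrite Glob_map_class => /(glob_class_inj t01)[-> _].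
    by right; exists m, phi, v.
- left; case: (I01_cases t) => [->|->|//].
    by left; rewrite glob_class0.
  by right; rewrite glob_class1.
- case=> [//|[m [phi [v [mn cphi ->]]]]].
  right; exists m, (Glob_map phi), (glob_class (v, t)).
  by split; [| exists phi | rewrite Glob_map_class].
Qed.

Lemma not_gsphere n (e : Glob (disk R n)) : ~ gsphere e ->
  exists v t, [/\ Iinside t, ~ sphere R n v & e = glob_class (v, t)].
Proof.
move=> ne; case: (glob_cases e) => [e0|e1|[v [t [t01 ev]]]].
- by case: ne; rewrite e0; exact: Or31.
- by case: ne; rewrite e1; exact: Or32.
- by exists v, t; split=> // Sv; apply: ne; apply: Or33; exists v, t.
Qed.

Lemma gsphere_class n (v : disk R n) t : Iinside t ->
  gsphere (glob_class (v, t)) -> sphere R n v.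
Proof.
move=> t01 [] => [/(congr1 (@gheight R _))|/(congr1 (@gheight R _))|].
- by rewrite gheight_class /= => E; by move: t01; rewrite E => /(@Iinside0 R).
- by rewrite gheight_class /= => E; by move: t01; rewrite E => /(@Iinside1 R).
- by case=> w [s [Sw /(glob_class_inj t01)[-> _]]].
Qed.

Lemma closed_Glob_mapP n (phi : disk R n -> X) (C : set (Glob X)) :
  closed (Glob_map phi @^-1` C) <->
  closed [set q : disk R n * I01 R | C (glob_class (phi q.1, q.2))].
Proof.
rewrite closed_GlobP (_ : _ @^-1` _ =
  [set q : disk R n * I01 R | C (glob_class (phi q.1, q.2))]) //.
by apply/seteqP; split=> -[v t] /=; rewrite Glob_map_class.
Qed.

Lemma closed_slice (x : X) (C : set (Glob X)) n (phi : disk R n -> X) v :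
  phi v = x -> closed (Glob_map phi @^-1` C) ->
  closed [set t : I01 R | C (glob_class (x, t))].
Proof.
move=> <- /closed_Glob_mapP.
apply: (@closed_preimage _ _ (fun t : I01 R => (v, t))).
apply: pair_continuous; first exact: continuous_const.
by move=> t; exact: cvg_id.
Qed.

Lemma Glob_structure : cell_structure (@gsphere R) gvert gcells.
Proof.
have [bdry int inj cover cont weak weak_skel] := CW_structure.
split.
- move=> n _ [phi cphi <-] _ [e [->|->|[v [t [Sv ->]]]] <-].
  + by left; left; rewrite Glob_map_source.
  + by left; right; rewrite Glob_map_target.
  + rewrite Glob_map_class; apply/skel_glob; right.
    by apply: (bdry n phi cphi); exists v.
- move=> n _ e [phi cphi <-] /not_gsphere[v [t [t01 nv ->]]].
  by rewrite Glob_map_class => /skel_glob[//|]; exact: int.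
- move=> n _ _ e e' [phi cphi <-] [psi cpsi <-].
  move=> /not_gsphere[v [t [t01 nv ->]]] /not_gsphere[w [s [s01 nw ->]]].
  rewrite !Glob_map_class => /(glob_class_inj t01)[vw ->].
  by have [-> ->] := inj _ _ _ _ _ cphi cpsi nv nw vw.
- apply/seteqP; split=> // p _; case: (glob_classP p) => [->|->|[[x t] ->]].
  + by exists 0 => //; left; left.
  + by exists 0 => //; left; right.
  + have [n _ xn] : (\bigcup_n skel set0 cells n) x by rewrite cover.
    by exists n => //; apply/skel_glob; right.
- by move=> n _ [phi cphi <-]; apply: Glob_map_continuous; exact: cont cphi.
- move=> C clC; rewrite closed_GlobP.
  have cC n phi : cells phi -> closed (@Glob_map R (disk R n) X phi @^-1` C).
    by move=> cphi; apply: clC; exists phi.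
  apply: (@closed_prod_weak R X setT {n & {phi | @cw_cells R X n phi}}
    (fun j => disk R (projT1 j)) (fun j => sval (projT2 j))) => //.
  + by move=> B _ clB; apply: weak => n phi cphi;
      exact: (clB (existT _ n (exist _ phi cphi))).
  + by move=> [n [phi cphi]] /=; exact: (closed_Glob_mapP phi C).1 (cC n phi
      cphi).
  + move=> x; have [n _ [//|[m [phi [v [_ cphi xv]]]]]] :
        (\bigcup_n skel set0 cells n) x by rewrite cover.
    exact: (closed_slice (esym xv) (cC m phi cphi)).
- move=> n C Cn clC; rewrite closed_GlobP.
  have cC m phi : (m < n)%N -> cells phi ->
      closed (@Glob_map R (disk R m) X phi @^-1` C).
    by move=> mn cphi; apply: clC mn _; exists phi.
  (* At heights 0 and 1 the base point of a class is arbitrary, so the preimage of [C] may leave the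
     product of the n-skeleton with [0, 1]. Only the part over the skeleton is handled by
     [closed_prod_weak]; the two ends are added back through [clI]. *)
  pose C' := [set q : X * I01 R | C (glob_class q) /\ skel set0 cells n q.1].
  have clC' : closed C'.
    apply: (@closed_prod_weak R X (skel set0 cells n)
      {m & {phi | (m < n)%N /\ @cw_cells R X m phi}}
      (fun j => disk R (projT1 j)) (fun j => sval (projT2 j))) => //.
    + move=> B Bn clB; apply: weak_skel Bn _ => m phi mn cphi.
      exact: (clB (existT _ m (exist _ phi (conj mn cphi)))).
    + by move=> q [].
    + move=> [m [phi [mn cphi]]] /=.
      have /closed_Glob_mapP := cC m phi mn cphi.
      congr closed; apply/seteqP; split=> [q Cq|q []//]; split=> //.
      exact: skel_cell mn cphi.
    + move=> x; have [xn|xn] := pselect (skel set0 cells n x); last first.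
        by rewrite (_ : [set _ | _] = set0); [exact: closed0 | apply/seteqP;
          split=> t //= []].
      case: (xn) => [//|[m [phi [v [mn cphi xv]]]]].
      have := closed_slice (esym xv) (cC m phi mn cphi).
      by congr closed; apply/seteqP; split=> [q Cq|q []//]; split.
  (* All of this end is one point of the globe, so the set is the full slice or empty. *)
  have clI t (U : set (Glob X)) (p : Glob X) :
      (forall x, glob_class (x, t) = p) ->
      closed [set q : X * I01 R | U (glob_class q) /\ q.2 = t].
    move=> tp; have [Up|Up] := pselect (U p).
      rewrite (_ : [set _ | _] = snd @^-1` [set t]).
        by apply: closed_preimage; [exact: continuous_snd | exact: closed_I_eq].
      by apply/seteqP; split=> -[x s] /=; [case | move=> ->; rewrite tp].
    rewrite (_ : [set _ | _] = set0); first exact: closed0.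
    by apply/seteqP; split=> -[x s] //= [+ st]; rewrite st tp.
  rewrite (_ : _ @^-1` C = C' `|` [set q | C (glob_class q) /\ q.2 = I0]
      `|` [set q | C (glob_class q) /\ q.2 = I1]).
    apply: closedU; last by apply: clI => x; exact: glob_class1.
    by apply: closedU => //; apply: clI => x; exact: glob_class0.
  apply/seteqP; split=> [[x t] /= Cxt|q /= [[[]|[]]|[]]//].
  have [t01|nx] := (skel_glob n x t).1 (Cn _ Cxt); last by left; left.
  by case: (I01_cases t) => [t0|t1|//]; [left; right | right].
Qed.

End Structure.
End GlobeOfCW.

(** * Paths in globes *)

Section Paths.
Context (R : realType).
Implicit Types a b s t : I01 R.

Lemma Iclamp_val (r : R) : 0 <= r <= 1 -> (sval (Iclamp r) : R) = r.
Proof.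
by move=> /andP[r0 r1]; rewrite IclampE (max_idPr r0) (min_idPr r1).
Qed.

Definition Isegment a b : set (I01 R) := [set s | Ile a s /\ Ile s b].

Definition Iclip a b s : I01 R :=
  Iclamp (Num.max (sval a) (Num.min (sval b) (sval s))).

Lemma IclipE a b s :
  (sval (Iclip a b s) : R) = Num.max (sval a) (Num.min (sval b) (sval s)).
Proof.
apply: Iclamp_val; have /andP[a0 a1] := I01E a; have /andP[_ b1] := I01E b.
by rewrite le_max a0 ge_max a1 ge_min b1.
Qed.

Lemma Iclip_segment a b s : Ile a b -> Isegment a b (Iclip a b s).
Proof.
move=> ab; rewrite /Isegment /Ile /= IclipE; split;
  first by rewrite le_max lexx.
by rewrite ge_max ab ge_min lexx.
Qed.

Lemma Iclip_id a b s : Isegment a b s -> Iclip a b s = s.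
Proof.
by move=> [as_ sb]; apply: sig_inj; rewrite IclipE (min_idPr sb) (max_idPr as_).
Qed.

Lemma Iclip_le a b s t : Ile s t -> Ile (Iclip a b s) (Iclip a b t).
Proof.
move=> st; rewrite /Ile !IclipE ge_max le_max lexx /= le_max; apply/orP; right.
by rewrite le_min !ge_min lexx /=; apply/orP; right.
Qed.

Lemma Iclip_continuous a b : continuous (Iclip a b).
Proof.
have cm (x y : R) : continuous (fun r : R => Num.max x (Num.min y r)).
  move=> r; apply: continuous_max; first exact: cvg_cst.
  by apply: continuous_min; [exact: cvg_cst | exact: cvg_id].
have cs := continuous_comp2 (@sval_I01_continuous R) (cm (sval a) (sval b)).
exact: (continuous_comp2 cs (@Iclamp_continuous R)).
Qed.

Lemma IVT_I01 (h : I01 R -> I01 R) a b t : continuous h -> Ile a b ->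
  Ile (h a) t -> Ile t (h b) -> exists2 s, Isegment a b s & h s = t.
Proof.
move=> ch ab at_ tb.
pose k (r : R) : R := sval (h (Iclamp r)).
have ck : continuous k.
  apply: (@continuous_comp2 _ _ _ (fun r => h (Iclamp r)));
    last exact: sval_I01_continuous.
  exact: (continuous_comp2 (@Iclamp_continuous R) ch).
have [] := @IVT R k (sval a) (sval b) (sval t) ab.
- exact: continuous_subspaceT.
- by rewrite /k !Iclamp_id ge_min le_max; rewrite /Ile in at_ tb;
    rewrite at_ tb orbT.
move=> r; rewrite in_itv /= => /andP[ar rb] kr.
have /andP[a0 a1] := I01E a; have /andP[b0 b1] := I01E b.
have rE : (sval (Iclamp r : I01 R) : R) = r.
  by apply: Iclamp_val; rewrite (le_trans a0 ar) (le_trans rb b1).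
exists (Iclamp r); first by rewrite /Isegment /= /Ile rE.
exact: sig_inj.
Qed.

Lemma disk0_proof n : (0 : 'rV[R]_n) \in @unit_ball R n.
Proof.
by rewrite inE /unit_ball /= big1 ?ler01 // => i _; rewrite mxE expr0n.
Qed.

Definition disk0 n : disk R n := disk_point (exist _ 0 (disk0_proof n)).

Section InSpace.
Context (X : pspace R) (X0 : set X) (cells : forall n,
  set (Glob (disk R n) -> X)).
Implicit Types gamma : I01 R -> X.

(* A non-decreasing path in the globe of a disk stays in one fibre, so that it
   is given by a point of the disk and a height function. *)
Lemma monotone_in_cellP a b gamma : Ile a b ->
  monotone_in_cell cells (Isegment a b) gamma <->
  exists n phi v (h : I01 R -> I01 R), [/\ @cells n phi, continuous h,
    forall s t, Ile s t -> Ile (h s) (h t) &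
    forall s, Isegment a b s -> gamma s = phi (glob_class (v, h s))].
Proof.
move=> ab; split=> [[n [phi [delta [cphi cd md E]]]]|[n [phi [v [h [cphi ch mh
  E]]]]]].
(* Clipping extends [delta] by constants outside the segment, giving a globally continuous
   non-decreasing path. *)
- pose delta' s := delta (Iclip a b s).
  have cd' : continuous delta'.
    apply/continuousP => U oU.
    have /open_subspaceP[V oV VU] : open (delta @^-1` U : set (subspace
      (Isegment a b))).
      by move/continuousP : cd; exact.
    rewrite (_ : delta' @^-1` U = Iclip a b @^-1` V).
      exact: open_preimage (@Iclip_continuous a b) oV.
    apply/funext => s; apply/propext; have sab := @Iclip_segment a b s ab;
      split=> h.
      by have [] : (V `&` Isegment a b) (Iclip a b s) by rewrite VU.
    by have [] : (delta @^-1` U `&` Isegment a b) (Iclip a b s) by rewrite -VU.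
  have md' s t : Ile s t -> glob_le (delta' s) (delta' t).
    by move=> st; apply: md; [exact: Iclip_segment | exact: Iclip_segment |
      exact: Iclip_le].
  have [v vE] := monotone_path_class (disk0 n) md'.
  exists n, phi, v, (fun s => gheight (delta' s)); split=> //.
  + exact: (continuous_comp2 cd' (@gheight_continuous R _)).
  + by move=> s t /md' /glob_le_height.
  + by move=> s sab; rewrite -vE /delta' Iclip_id // E.
- exists n, phi, (fun s => glob_class (v, h s)); split=> //.
  + apply: continuous_subspaceT.
    apply: (continuous_comp2 (f := fun s => (v,
      h s)) _ (@glob_class_continuous R _)).
    by apply: pair_continuous => //; exact: continuous_const.
  + by move=> s t _ _ st; apply: glob_le_class; exact: mh.
Qed.

Lemma Ilt_sequence_le k (t : nat -> I01 R) :
  (forall i, (i < k)%N -> Ilt (t i) (t i.+1)) ->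
  forall i, (i <= k)%N -> Ile (t 0%N) (t i).
Proof.
move=> lt; elim=> [|i IHi] ik; first exact: Ile_refl.
exact: Ile_trans (IHi (ltnW ik)) (Ilt_le (lt i ik)).
Qed.

Lemma subdivision_ind (P : I01 R -> I01 R -> Prop) k (t : nat -> I01 R) :
  (0 < k)%N -> (forall i, (i < k)%N -> Ilt (t i) (t i.+1)) ->
  (forall i, (i < k)%N -> P (t i) (t i.+1)) ->
  (forall a b c, Ile a b -> Ile b c -> P a b -> P b c -> P a c) ->
  P (t 0%N) (t k).
Proof.
move=> + + + cat; elim: k => [//|[|k] IHk _ lt Pt]; first exact: Pt.
apply: (cat _ (t k.+1)); last exact: Pt.
- by apply: (@Ilt_sequence_le k.+1) => // i ik; apply: lt; exact: ltnW.
- exact/Ilt_le/lt.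
- by apply: IHk => // i ik; [apply: lt | apply: Pt]; exact: ltnW.
Qed.

Lemma piecewise_monotone1 n (phi : Glob (disk R n) -> X) (v : disk R n) :
  cells phi -> X0 (phi (gsource _)) -> X0 (phi (gtarget _)) ->
  piecewise_monotone X0 cells (fun t => phi (glob_class (v, t))).
Proof.
move=> cphi X0s X0t.
exists 1%N, (fun i => if i is 0%N then I0 else I1); split=> //.
- by split=> // -[|//] _; rewrite /Ilt /= ltr01.
- by move=> [|[|//]] _; rewrite ?glob_class0 ?glob_class1.
- move=> [|//] _; apply/monotone_in_cellP; first exact: Ile0.
  by exists n, phi, v, id; split=> // s; exact: cvg_id.
Qed.

End InSpace.

Lemma skel_set0_cell (X : CW R) (x : X) : exists n phi v,
  @cw_cells R X n phi /\ x = phi v.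
Proof.
have [n _ [//|[m [phi [v [_ cphi xv]]]]]] :
    (\bigcup_n skel set0 (@cw_cells R X) n) x by rewrite (cell_cover
      (CW_structure X)).
by exists m, phi, v.
Qed.

(** A non-decreasing path from pole to pole in the boundary runs along one fibre [v]; it crosses
    height 1/2, where the fibre is visible, so [v] is on the sphere. Then [phi v] lies in an earlier
    cell of [X], and the attached path in the globe of that cell: one piece suffices. *)
Lemma Glob_glCW (X : CW R) : is_glCW (Glob_data X).
Proof.
have cs := Glob_structure X; split; first exact: cell_structure_complex cs.
move=> n _ [phi cphi <-]; split.
- by left; rewrite Glob_map_source.
- by right; rewrite Glob_map_target.
move=> gamma cg sg mg g0 g1.
have [v vE] := monotone_path_class (disk0 n) (fun s t => mg s t I I).
have ch : continuous (fun s => gheight (gamma s)).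
  exact: (continuous_comp2 cg (@gheight_continuous R _)).
have [s _ hs] : exists2 s, Isegment I0 I1 s & gheight (gamma s) = Ihalf R.
  by apply: IVT_I01 => //; rewrite ?g0 ?g1;
    [exact: Ile0 | exact: Ile0 | exact: Ile1].
have Sv : sphere R n v.
  apply: (gsphere_class (@Iinside_half R)); rewrite -hs -vE; exact: sg.
have [//|[m [psi [w [mn cpsi e]]]]] : skel set0 (@cw_cells R X) n (phi v).
  by apply: (cell_bdry (CW_structure X) cphi); exists v.
split; last first.
  exists I0, I1; rewrite /= g0 g1 Glob_map_source Glob_map_target.
  exact: gsource_neq_target.
exists 1%N, (fun i => if i is 0%N then I0 else I1); split=> //.
- by split=> // -[|//] _; rewrite /Ilt /= ltr01.
- move=> [|[|//]] _ /=.
    by rewrite g0 Glob_map_source; left.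
  by rewrite g1 Glob_map_target; right.
- move=> [|//] _; apply/monotone_in_cellP; first exact: Ile0.
  exists m, (Glob_map psi), w, (fun s => gheight (gamma s)); split=> //.
  + by split=> //; exists psi.
  + by move=> s1 s2 /(fun st => mg _ _ I I st)/glob_le_height.
  + by move=> s1 _; rewrite /= {1}vE !Glob_map_class e.
Qed.

(** The map [f] is not assumed cellular: a piece of path stays over a single point [phi v], and the
    single point [f (phi v)] lies in some cell of [Y]. Since [Glob_map] keeps heights, it cannot
    make a non-constant path constant. *)
Lemma Glob_morphism (X Y : CW R) (f : X -> Y) : continuous f ->
  @is_glCW_morphism R (Glob_data X) (Glob_data Y) (Glob_map f).
Proof.
move=> cf; have cF := Glob_map_continuous cf; split=> //.
  by move=> x [] ->; [left; rewrite Glob_map_source | right;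
    rewrite Glob_map_target].
move=> gamma [cg [pg|[x [_ xg]]]] [s1 [s2 ng]]; last by case: ng; rewrite !xg.
split; last first.
  apply: contrapT => const; apply: ng.
  have hE s : gheight (gamma s) = gheight (gamma I0).
    rewrite -!(gheight_map f); congr gheight; apply: contrapT => nE.
    by apply: const; exists s, I0.
  (* The common height is attained at the initial point, a pole; so it is 0 or 1, and a single point
     of the globe has that height. *)
  have [k [t [[k0 _] [t0 _] vt _]]] := pg.
  suff gE s : gamma s = gamma I0 by rewrite !gE.
  have := vt 0%N (leq0n _); rewrite t0 => -[] e; rewrite e.
    by apply: gheight0; rewrite hE e.
  by apply: gheight1; rewrite hE e.
split; first exact: (continuous_comp2 cg cF).
left; have [k [t [[k0 lt] t01 vt pt]]] := pg; exists k, t; split=> //.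
  move=> i ik; case: (vt i ik) => /= ->.
    by left; rewrite Glob_map_source.
  by right; rewrite Glob_map_target.
move=> i ik.
have /monotone_in_cellP[|n [_ [v [h [[phi cphi <-] ch mh E]]]]] := pt i ik.
  exact/Ilt_le/lt.
have [m [psi [w [cpsi e]]]] := skel_set0_cell (f (phi v)).
apply/monotone_in_cellP; first exact/Ilt_le/lt.
exists m, (Glob_map psi), w, h; split=> //; first by exists psi.
by move=> s /E /= ->; rewrite !Glob_map_class e.
Qed.

End Paths.

(** * Homotopies of globes *)

Section GlobeHomotopy.
Context (R : realType).

Definition GlobO (X : CW R) : glCW R := MkGlCW (Glob_glCW X).

Definition Glob_mor (X Y : CW R) (f : cmap X Y) : glmor (GlobO X) (GlobO Y) :=
  exist _ (Glob_map (sval f)) (Glob_morphism (svalP f)).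

(** Continuity on the product of a quotient with [0, 1] is checked on representatives by
    [closed_prod_weak], for the one-element family consisting of [glob_class]. *)
Lemma Glob_homotopy_continuous (X Y : pspace R) (H : X * I01 R -> Y) :
  continuous H -> continuous (fun q : Glob X * I01 R =>
    Glob_map (fun x => H (x, q.2)) q.1).
Proof.
move=> cH; apply/continuous_closedP => C clC.
have cG : continuous (fun q : X * I01 R * I01 R =>
    glob_class (H (q.1.1, q.2), q.1.2) : Glob Y).
  have c1 : continuous (fun q : X * I01 R * I01 R => (q.1.1, q.2)).
    apply: pair_continuous; last exact: continuous_snd.
    exact: (continuous_comp2 (@continuous_fst _ _) (@continuous_fst _ _)).
  have c2 := continuous_comp2 c1 cH.
  have c3 : continuous (fun q : X * I01 R * I01 R => q.1.2).
    exact: (continuous_comp2 (@continuous_fst _ _) (@continuous_snd _ _)).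
  exact: (continuous_comp2 (pair_continuous c2 c3) (@glob_class_continuous R
    Y)).
apply: (@closed_prod_weak R (Glob X) setT unit
  (fun=> (X * I01 R)%type) (fun=> @glob_class R X)) => //.
- by move=> B _ /(_ tt); rewrite closed_GlobP.
- move=> _; have := closed_preimage cG clC; congr closed.
  by apply/seteqP; split=> -[[x s] t] /=; rewrite Glob_map_class.
- move=> p; case: (glob_classP p) => [->|->|[[x s] ->]].
  + have [Cs|Cs] := pselect (C (gsource Y)).
      rewrite (_ : [set _ | _] = setT); first exact: closedT.
      by apply/seteqP; split=> // t _ /=; rewrite Glob_map_source.
    rewrite (_ : [set _ | _] = set0); first exact: closed0.
    by apply/seteqP; split=> // t /=; rewrite Glob_map_source.
  + have [Cs|Cs] := pselect (C (gtarget Y)).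
      rewrite (_ : [set _ | _] = setT); first exact: closedT.
      by apply/seteqP; split=> // t _ /=; rewrite Glob_map_target.
    rewrite (_ : [set _ | _] = set0); first exact: closed0.
    by apply/seteqP; split=> // t /=; rewrite Glob_map_target.
  + have c : continuous (fun t : I01 R => ((x, s), t)).
      apply: pair_continuous; first exact: continuous_const.
      by move=> t; exact: cvg_id.
    have := closed_preimage c (closed_preimage cG clC); congr closed.
    by apply/seteqP; split=> t /=; rewrite Glob_map_class.
Qed.

Lemma Glob_S_homotopic (X Y : CW R) (f g : cmap X Y) :
  homotopic f g -> S_homotopic (Glob_mor f) (Glob_mor g).
Proof.
move=> [H [cH H0 H1]].
exists (fun q => Glob_map (fun x => H (x, q.2)) q.1); split.
- exact: Glob_homotopy_continuous.
- by move=> p /=; congr (Glob_map _ p); apply/funext => x; exact: H0.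
- by move=> p /=; congr (Glob_map _ p); apply/funext => x; exact: H1.
- move=> t /=; apply: Glob_morphism.
  apply: (@continuous_comp2 _ _ _ (fun x => (x, t)) H) => //.
  by apply: pair_continuous; [move=> x;
    exact: cvg_id | exact: continuous_const].
Qed.

Lemma Glob_mor_comp (X Y Z : CW R) (g : cmap Y Z) (f : cmap X Y) :
  Glob_mor (cmap_comp g f) = glmor_comp (Glob_mor g) (Glob_mor f).
Proof. by apply: sig_inj; exact: Glob_map_comp. Qed.

Lemma Glob_mor_id (X : CW R) : Glob_mor (cmap_id X) = glmor_id (GlobO X).
Proof. by apply: sig_inj; exact: Glob_map_id. Qed.

Definition loc_Glob (X Y : CW R) (f : cmap X Y) :
  @homset (HoglCW R) (GlobO X) (GlobO Y) :=
  @loc_map (glCW_category R) (@dihomotopy_equivalence R) (GlobO X) (GlobO Y)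
    (Glob_mor f).

Lemma loc_Glob_comp (X Y Z : CW R) (g : cmap Y Z) (f : cmap X Y) :
  loc_Glob (cmap_comp g f) = cmp (loc_Glob g) (loc_Glob f).
Proof. by rewrite /loc_Glob Glob_mor_comp; exact: loc_mapM. Qed.

(** Left cancellation of an inverted arrow. It will be applied to the two ends of a cylinder, which
    have the same composite with the projection. *)
Lemma loc_map_equiv (C : category) (W : forall X Y : C, homset X Y -> Prop)
    (X Y Z : C) (w : homset X Y) (f g : @homset (localization W) Z X) :
  W _ _ w ->
  @cmp (localization W) Z X Y (loc_map W w) f =
  @cmp (localization W) Z X Y (loc_map W w) g -> f = g.
Proof.
move=> Ww e.
pose v : @homset (localization W) Y X := @pcls (word_precategory W) Y X
  (Defs.Inv Ww).
have vw : @cmp (localization W) X Y X v (loc_map W w) = @idm (localization W) X.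
  rewrite /= /v /loc_map (@qcmpE (word_precategory W)).
  exact: (@pcls_eq (word_precategory W) _ _ _ _ (word_invl Ww)).
by rewrite -[f]cmp1m -[g]cmp1m -vw -!cmpA e.
Qed.

End GlobeHomotopy.

(** * The ball and the cylinder *)

Section CylinderCell.
Context (R : realType).

Definition vnorm n (v : 'rV[R]_n) : R := Num.sqrt (\sum_i v ord0 i ^+ 2).

Lemma sum_sqr_ge0 n (v : 'rV[R]_n) : 0 <= \sum_i v ord0 i ^+ 2.
Proof. by apply: sumr_ge0 => i _; exact: sqr_ge0. Qed.

Lemma vnorm_ge0 n (v : 'rV[R]_n) : 0 <= vnorm v.
Proof. exact: sqrtr_ge0. Qed.

Lemma sqr_vnorm n (v : 'rV[R]_n) : vnorm v ^+ 2 = \sum_i v ord0 i ^+ 2.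
Proof. by rewrite sqr_sqrtr // sum_sqr_ge0. Qed.

Lemma vnorm_le1 n (v : 'rV[R]_n) : (vnorm v <= 1) = (\sum_i v ord0 i ^+ 2 <= 1).
Proof. by rewrite -sqr_vnorm expr_le1 // vnorm_ge0. Qed.

Lemma vnorm_eq1 n (v : 'rV[R]_n) : vnorm v = 1 <-> \sum_i v ord0 i ^+ 2 = 1.
Proof.
rewrite -sqr_vnorm; split=> [->|/eqP]; first by rewrite expr1n.
by rewrite sqrp_eq1 ?vnorm_ge0 // => /eqP.
Qed.

Lemma vnormZ n (a : R) (v : 'rV[R]_n) : 0 <= a -> vnorm (a *: v) = a * vnorm v.
Proof.
move=> a0; rewrite /vnorm (eq_bigr (fun i => a ^+ 2 * v ord0 i ^+ 2)).
  by rewrite -mulr_sumr sqrtrM ?sqr_ge0 // sqrtr_sqr ger0_norm.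
by move=> i _; rewrite mxE exprMn.
Qed.

Lemma vnorm_eq0 n (v : 'rV[R]_n) : vnorm v = 0 -> v = 0.
Proof.
move=> v0; have /eqP : \sum_i v ord0 i ^+ 2 = 0 by rewrite -sqr_vnorm v0 expr0n.
rewrite psumr_eq0 => [/allP v2|i _]; last exact: sqr_ge0.
apply/rowP => i; rewrite mxE; apply/eqP; rewrite -sqrf_eq0.
by apply: v2; rewrite mem_index_enum.
Qed.

Lemma vnorm_continuous n : continuous (@vnorm n).
Proof.
have c := @continuous_sum_sqr R 'rV[R]_n n (fun i v => v ord0 i)
  (fun i => @coord_continuous _ _ _ ord0 i).
exact: (continuous_comp2 c (@sqrt_continuous R)).
Qed.

Definition vtail n (w : 'rV[R]_n.+1) : 'rV[R]_n := \row_i w ord0 (lift ord0 i).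

Definition vcons n (s : R) (v : 'rV[R]_n) : 'rV[R]_n.+1 :=
  \row_i (if unlift ord0 i is Some j then v ord0 j else s).

Lemma vcons_head n s (v : 'rV[R]_n) : (vcons s v) ord0 ord0 = s.
Proof. by rewrite mxE unlift_none. Qed.

Lemma vcons_tail n s (v : 'rV[R]_n) : vtail (vcons s v) = v.
Proof. by apply/rowP => i; rewrite !mxE liftK. Qed.

Lemma vcons_eta n (w : 'rV[R]_n.+1) : vcons (w ord0 ord0) (vtail w) = w.
Proof.
apply/rowP => i; rewrite mxE.
by case: unliftP => [j|] ->; rewrite ?mxE.
Qed.

Lemma row_continuous (T : topologicalType) n (f : T -> 'rV[R]_n) :
  (forall i, continuous (fun x => f x ord0 i)) -> continuous f.
Proof.
move=> cf x; apply/cvg_ballP => e e0; near=> y => /=.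
split=> //.
move=> i j; rewrite ord1.
have : forall i, ball (f x ord0 i) e (f y ord0 i).
  by near: y; apply: filter_forall => k; apply: (cf k x); exact: nbhsx_ballx.
exact.
Unshelve. all: by end_near. Qed.

Lemma vtail_continuous n : continuous (@vtail n).
Proof.
apply: row_continuous => i.
rewrite (_ : (fun x => _) = fun w : 'rV[R]_n.+1 => w ord0 (lift ord0 i)).
  exact: coord_continuous.
by apply/funext => w; rewrite mxE.
Qed.

Lemma vcons_continuous n : continuous (fun q : R * 'rV[R]_n => vcons q.1 q.2).
Proof.
apply: row_continuous => i; case: (unliftP ord0 i) => [j|] ->.
  rewrite (_ : (fun x => _) = fun q : R * 'rV[R]_n => q.2 ord0 j).
    exact: (continuous_comp2 (@continuous_snd _ _) (@coord_continuous _ _ _ _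
      _)).
  by apply/funext => q; rewrite mxE liftK.
rewrite (_ : (fun x => _) = fst); first exact: continuous_fst.
by apply/funext => q; rewrite mxE unlift_none.
Qed.

(** The norm whose unit ball is the cylinder over D^n with axis [-1, 1], the head of [w] being the
    axis coordinate. *)
Definition cnorm n (w : 'rV[R]_n.+1) : R := Num.max (vnorm (vtail w)) `|w ord0
  ord0|.

Lemma cnorm_ge0 n (w : 'rV[R]_n.+1) : 0 <= cnorm w.
Proof. by rewrite le_max vnorm_ge0. Qed.

Lemma cnormZ n (a : R) (w : 'rV[R]_n.+1) : 0 <= a -> cnorm (a *: w) = a * cnorm
  w.
Proof.
move=> a0; rewrite /cnorm (_ : vtail (a *: w) = a *: vtail w); last first.
  by apply/rowP => i; rewrite !mxE.
by rewrite vnormZ // mxE normrM (ger0_norm a0) maxr_pMr.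
Qed.

Lemma vnorm_cnorm n (w : 'rV[R]_n.+1) :
  vnorm w ^+ 2 = vnorm (vtail w) ^+ 2 + `|w ord0 ord0| ^+ 2.
Proof.
rewrite !sqr_vnorm big_ord_recl real_normK ?num_real // addrC; congr (_ + _).
by apply: eq_bigr => i _; rewrite mxE.
Qed.

Lemma cnorm_le_vnorm n (w : 'rV[R]_n.+1) : cnorm w <= vnorm w.
Proof.
have e := vnorm_cnorm w; rewrite ge_max -!(@ler_sqr R _ (vnorm w)) ?nnegrE
  ?vnorm_ge0 //.
by rewrite e lerDl lerDr !sqr_ge0.
Qed.

(** A factor sqrt 2 would do; 2 avoids the root, and any bound serves for continuity at the
    origin. *)
Lemma vnorm_le_cnorm n (w : 'rV[R]_n.+1) : vnorm w <= 2 * cnorm w.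
Proof.
have e := vnorm_cnorm w.
have h1 : vnorm (vtail w) <= cnorm w by rewrite le_max lexx.
have h2 : `|w ord0 ord0| <= cnorm w by rewrite le_max lexx orbT.
have c0 := cnorm_ge0 w; have v0 := vnorm_ge0 (vtail w).
rewrite -(@ler_sqr R) ?nnegrE ?vnorm_ge0 ?mulr_ge0 // e.
have : vnorm (vtail w) ^+ 2 <= cnorm w ^+ 2 by rewrite ler_sqr ?nnegrE.
have : `|w ord0 ord0| ^+ 2 <= cnorm w ^+ 2 by rewrite ler_sqr ?nnegrE.
rewrite exprMn; have : 0 <= cnorm w ^+ 2 by exact: sqr_ge0.
by move: (cnorm w ^+ 2) (_ ^+ 2) (_ ^+ 2) => a b c; lra.
Qed.

Lemma cnorm_continuous n : continuous (@cnorm n).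
Proof.
move=> w; apply: (@continuous_max R _ (fun w : 'rV[R]_n.+1 => vnorm (vtail w))
  (fun w : 'rV[R]_n.+1 => `|w ord0 ord0|)).
  exact: (continuous_comp2 (@vtail_continuous n) (@vnorm_continuous n)).
apply: (@continuous_comp _ _ _ (fun w : 'rV[R]_n.+1 => w ord0 ord0) (fun r : R
  => `|r|)).
  exact: coord_continuous.
exact: norm_continuous.
Qed.

Definition rescale n (p q : 'rV[R]_n -> R) (w : 'rV[R]_n) := (p w / q w) *: w.

Lemma rescale_continuous n (p q : 'rV[R]_n -> R) :
  continuous p -> continuous q -> (forall w, q w = 0 -> w = 0) ->
  (forall w, 0 <= p w <= 2 * q w) -> continuous (rescale p q).
Proof.
move=> cp cq q0 pq w.
have [qw|qw] := eqVneq (q w) 0; last first.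
  have cpq : p v / q v @[v --> w] --> p w / q w.
    exact: (cvgM (cp w) (cvgV qw (cq w))).
  exact: (cvgZ cpq (@cvg_id _ (nbhs w))).
have r0 : rescale p q 0 = 0 by rewrite /rescale scaler0.
rewrite (q0 _ qw) /continuous_at r0.
move=> A /nbhs_ballP[e /= e0 eA].
have e20 : 0 < e / 2 by rewrite divr_gt0.
have : nbhs (0 : 'rV[R]_n) (ball (0 : 'rV[R]_n) (e / 2)) by exact: nbhsx_ballx.
apply: filterS => v [_ ve]; apply: eA; split=> // i j.
have := ve i j; rewrite /ball /= !mxE !sub0r !normrN normrM => vije.
have pv : `|p v / q v| <= 2.
  have /andP[p0 p2] := pq v.
  have qv : 0 <= q v by move: p2 => /(le_trans p0); rewrite pmulr_rge0.
  rewrite ger0_norm ?divr_ge0 //.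
  have [->|qn] := eqVneq (q v) 0; first by rewrite invr0 mulr0.
  by rewrite ler_pdivrMr // lt_neqAle eq_sym qn.
by apply: le_lt_trans (ler_wpM2r (normr_ge0 _) pv) _;
  rewrite mulrC -ltr_pdivlMr.
Qed.

End CylinderCell.

(** * The homeomorphism between the ball and the product of a ball with the interval *)

Section CylinderMap.
Context (R : realType).

Definition disk_val n (e : disk R n) : 'rV[R]_n :=
  sval (sval (cid (disk_pointP e))).

Lemma disk_val_point n (v : set_type (@unit_ball R n)) :
  disk_val (disk_point v) = sval v.
Proof. by rewrite /disk_val; case: cid => w /= /disk_point_inj <-. Qed.

Lemma disk_val_continuous n : continuous (@disk_val n).
Proof.
apply/continuousP => U oU.
suff : open ((fun v : set_type (@unit_ball R n) => disk_val (disk_point v))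
  @^-1` U) by [].
rewrite (_ : (fun v => _) = fun v : set_type (@unit_ball R n) => sval v).
  exact: open_preimage (@set_val_continuous _ _) oU.
by apply/funext => v; exact: disk_val_point.
Qed.

Lemma disk_val_le1 n (e : disk R n) : vnorm (disk_val e) <= 1.
Proof.
have [[v v1] ->] := disk_pointP e; rewrite disk_val_point /= vnorm_le1.
by move: v1; rewrite inE.
Qed.

(** Vectors outside the unit ball are sent to the centre; the arguments in the cylinder maps all
    have norm at most 1. *)
Definition disk_of n (v : 'rV[R]_n) : disk R n :=
  disk_point (insubd (exist _ 0 (disk0_proof R n) : set_type (@unit_ball R n))
    v).

Lemma disk_ofK n (v : 'rV[R]_n) : vnorm v <= 1 -> disk_val (disk_of v) = v.
Proof.
by move=> v1; rewrite disk_val_point insubdK // inE /unit_ball /= -vnorm_le1.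
Qed.

Lemma disk_val_inj n : injective (@disk_val n).
Proof.
move=> e e'; have [v ->] := disk_pointP e; have [w ->] := disk_pointP e'.
by rewrite !disk_val_point => /sig_inj ->.
Qed.

Lemma disk_valK n (e : disk R n) : disk_of (disk_val e) = e.
Proof. by apply: disk_val_inj; rewrite disk_ofK // disk_val_le1. Qed.

Lemma disk_of_continuous (T : topologicalType) n (f : T -> 'rV[R]_n) :
  continuous f -> (forall x, vnorm (f x) <= 1) ->
  continuous (fun x => disk_of (f x)).
Proof.
move=> cf f1.
pose ins x : set_type (@unit_ball R n) := insubd (exist _ 0 (disk0_proof R n) :
  set_type (@unit_ball R n)) (f x).
have ci : continuous ins.
  apply/continuousP => _ [B oB <-].
  rewrite (_ : _ @^-1` _ = f @^-1` B); first exact: open_preimage cf oB.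
  apply/funext => x; rewrite /preimage /= set_valE /ins insubdK //.
  by rewrite inE /unit_ball /= -vnorm_le1.
exact: (continuous_comp2 ci (@disk_point_continuous R n)).
Qed.

Lemma sphereP n (e : disk R n) : sphere R n e <-> vnorm (disk_val e) = 1.
Proof.
have [v ->] := disk_pointP e; rewrite disk_val_point vnorm_eq1.
by split=> [[w w1 /disk_point_inj <-]|v1]; last exists v.
Qed.

Lemma vnorm0 n : vnorm (0 : 'rV[R]_n) = 0.
Proof. by rewrite -(scale0r 0) vnormZ // mul0r. Qed.

Lemma cnorm0 n : cnorm (0 : 'rV[R]_n.+1) = 0.
Proof. by rewrite -(scale0r 0) cnormZ // mul0r. Qed.

Lemma cnorm_eq0 n (w : 'rV[R]_n.+1) : cnorm w = 0 -> w = 0.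
Proof.
move=> w0; apply: vnorm_eq0; apply/eqP; rewrite eq_le vnorm_ge0 andbT.
by have := vnorm_le_cnorm w; rewrite w0 mulr0.
Qed.

(* With the junk value 0 / 0 = 0 at the origin, these are mutually inverse
   homeomorphisms between the ball and the cylinder. *)
Definition stretch n : 'rV[R]_n.+1 -> 'rV[R]_n.+1 := rescale (@vnorm R _)
  (@cnorm R n).
Definition shrink n : 'rV[R]_n.+1 -> 'rV[R]_n.+1 := rescale (@cnorm R n)
  (@vnorm R _).

Lemma stretch_continuous n : continuous (@stretch n).
Proof.
apply: rescale_continuous; [exact: vnorm_continuous | exact: cnorm_continuous |
  exact: cnorm_eq0 |].
by move=> w; rewrite vnorm_ge0 vnorm_le_cnorm.
Qed.

Lemma shrink_continuous n : continuous (@shrink n).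
Proof.
apply: rescale_continuous; [exact: cnorm_continuous | exact: vnorm_continuous |
  exact: vnorm_eq0 |].
move=> w; rewrite cnorm_ge0 (le_trans (cnorm_le_vnorm w)) // ler_peMl
  ?vnorm_ge0 //.
by rewrite ler1n.
Qed.

Lemma cnorm_stretch n (w : 'rV[R]_n.+1) : cnorm (stretch w) = vnorm w.
Proof.
rewrite /stretch /rescale cnormZ ?divr_ge0 ?vnorm_ge0 ?cnorm_ge0 //.
have [w0|w0] := eqVneq (cnorm w) 0; last by rewrite divfK.
by rewrite (cnorm_eq0 w0) vnorm0 !mul0r.
Qed.

Lemma vnorm_shrink n (w : 'rV[R]_n.+1) : vnorm (shrink w) = cnorm w.
Proof.
rewrite /shrink /rescale vnormZ ?divr_ge0 ?vnorm_ge0 ?cnorm_ge0 //.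
have [w0|w0] := eqVneq (vnorm w) 0; last by rewrite divfK.
by rewrite (vnorm_eq0 w0) cnorm0 !mul0r.
Qed.

Lemma stretchK n : cancel (@stretch n) (@shrink n).
Proof.
move=> w; rewrite {1}/shrink /rescale cnorm_stretch.
rewrite /stretch /rescale vnormZ ?divr_ge0 ?vnorm_ge0 ?cnorm_ge0 // scalerA.
have [w0|w0] := eqVneq (cnorm w) 0; first by rewrite (cnorm_eq0 w0) scaler0.
have w1 : vnorm w != 0.
  by apply: contra_neq w0 => /vnorm_eq0 ->; exact: cnorm0.
rewrite (_ : _ * _ = 1) ?scale1r //.
by field; rewrite w0 w1.
Qed.

Lemma shrinkK n : cancel (@shrink n) (@stretch n).
Proof.
move=> w; rewrite {1}/stretch /rescale vnorm_shrink.
rewrite /shrink /rescale cnormZ ?divr_ge0 ?vnorm_ge0 ?cnorm_ge0 // scalerA.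
have [w0|w0] := eqVneq (cnorm w) 0; first by rewrite (cnorm_eq0 w0) scaler0.
have w1 : vnorm w != 0.
  by apply: contra_neq w0 => /vnorm_eq0 ->; exact: cnorm0.
rewrite (_ : _ * _ = 1) ?scale1r //.
by field; rewrite w0 w1.
Qed.

(** The affine map [(1 + r) / 2] takes the axis [-1, 1] of the cylinder to [0, 1]; [cyl_join] undoes
    it by [2 * r - 1]. *)
Definition cyl_split n (e : disk R n.+1) : disk R n * I01 R :=
  let w := stretch (disk_val e) in
  (disk_of (vtail w), Iclamp ((1 + w ord0 ord0) / 2)).

Definition cyl_join n (q : disk R n * I01 R) : disk R n.+1 :=
  disk_of (shrink (vcons (2 * sval q.2 - 1) (disk_val q.1))).

Lemma cnorm_vcons_le1 n (q : disk R n * I01 R) :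
  cnorm (vcons (2 * sval q.2 - 1) (disk_val q.1)) <= 1.
Proof.
rewrite /cnorm vcons_tail vcons_head ge_max disk_val_le1 /= ler_norml.
have /andP[q0 q1] := I01E q.2; apply/andP; split; lra.
Qed.

Lemma stretch_le1 n (e : disk R n.+1) :
  vnorm (vtail (stretch (disk_val e))) <= 1 /\
  -1 <= stretch (disk_val e) ord0 ord0 <= 1.
Proof.
have := disk_val_le1 e; rewrite -cnorm_stretch /cnorm ge_max => /andP[-> h].
by rewrite -ler_norml.
Qed.

Lemma cyl_splitK n : cancel (@cyl_split n) (@cyl_join n).
Proof.
move=> e; have [e1 /andP[h1 h2]] := stretch_le1 e.
rewrite /cyl_join /cyl_split /= disk_ofK // Iclamp_val; last by apply/andP;
  split; lra.
rewrite (_ : 2 * _ - 1 = stretch (disk_val e) ord0 ord0); last by field.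
by rewrite vcons_eta stretchK disk_valK.
Qed.

Lemma cyl_joinK n : cancel (@cyl_join n) (@cyl_split n).
Proof.
move=> [v t]; have c1 := cnorm_vcons_le1 (v, t).
rewrite /cyl_join /cyl_split /= disk_ofK ?vnorm_shrink // shrinkK.
rewrite vcons_tail vcons_head disk_valK (_ : _ / 2 = sval t) ?Iclamp_id //.
by field.
Qed.

Lemma cyl_split_continuous n : continuous (@cyl_split n).
Proof.
have cw := continuous_comp2 (@disk_val_continuous n.+1) (@stretch_continuous n).
apply: pair_continuous.
  apply: disk_of_continuous; last by move=> e; have [] := stretch_le1 e.
  exact: (continuous_comp2 cw (@vtail_continuous R n)).
have ch := continuous_comp2 cw (@coord_continuous R _ _ ord0 ord0).
apply: (continuous_comp2 (f := fun e : disk R n.+1 =>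
  (1 + stretch (disk_val e) ord0 ord0) / 2) _ (@Iclamp_continuous R)).
have ca : continuous (fun r : R => (1 + r) / 2).
  move=> r; apply: cvgM; last exact: cvg_cst.
  by apply: cvgD; [exact: cvg_cst | exact: cvg_id].
exact: (continuous_comp2 ch ca).
Qed.

Lemma cyl_join_continuous n : continuous (@cyl_join n).
Proof.
apply: disk_of_continuous; last by move=> q;
  rewrite vnorm_shrink cnorm_vcons_le1.
have cs : continuous (fun q : disk R n * I01 R => 2 * (sval q.2 : R) - 1).
  have ca : continuous (fun r : R => 2 * r - 1).
    move=> r; apply: cvgB; last exact: cvg_cst.
    by apply: cvgM; [exact: cvg_cst | exact: cvg_id].
  exact: (continuous_comp2 (@second_continuous R _) ca).
have cv := continuous_comp2 (@continuous_fst (disk R n) (I01 R))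
  (@disk_val_continuous n).
have c := continuous_comp2 (pair_continuous cs cv) (@vcons_continuous R n).
exact: (continuous_comp2 c (@shrink_continuous n)).
Qed.

(** A maximum of two numbers at most 1 equals 1 exactly when one of them does: the sphere becomes
    the side wall together with the two end disks. *)
Lemma cyl_split_sphere n (e : disk R n.+1) : sphere R n.+1 e <->
  sphere R n (cyl_split e).1 \/ ~ Iinside (cyl_split e).2.
Proof.
have [e1 /andP[h1 h2]] := stretch_le1 e.
rewrite !sphereP /= disk_ofK // /Iinside Iclamp_val; last by apply/andP; split;
  lra.
rewrite -cnorm_stretch /cnorm; move: e1 h1 h2.
set w := stretch _; move: (vnorm _) (w _ _) => a s a1 s1 s2; split.
  have [as_|as_] := leP a `|s|; last by move=> ->; left.
  move=> s3; right => /andP[s4 s5]; move: s3; have [s0|s0] := leP 0 s.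
    by rewrite ger0_norm // => ?; lra.
  by rewrite ltr0_norm // => ?; lra.
case=> [->|]; first by apply: max_idPl; rewrite ler_norml s1 s2.
move=> ns; have s3 : `|s| = 1.
  have [s0|s0] := leP 0 s; [rewrite ger0_norm // | rewrite ltr0_norm //].
    apply/eqP; rewrite eq_le s2 leNgt; apply/negP => s3; apply: ns; apply/andP;
      split; lra.
  apply/eqP; rewrite eq_le; apply/andP; split; first lra.
  by rewrite leNgt; apply/negP => s3; apply: ns; apply/andP; split; lra.
by rewrite s3; exact: max_idPr.
Qed.

End CylinderMap.

(** * Cylinders of CW-complexes *)

Section Cylinder.
Context (R : realType).

Section CylinderSpace.
Context (X : pspace R).

(** Here [Mid] is a plain pairing, the values 0 and 1 included, so no points are collapsed. *)
Definition cyl_pts : set (upoint R) :=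
  [set p | exists (x : X) (t : I01 R), p = Mid (sval x) (sval t)].

Definition cyl_point (q : X * I01 R) : {p | cyl_pts p} :=
  exist _ (Mid (sval q.1) (sval q.2))
    (ex_intro _ q.1 (ex_intro _ q.2 erefl)).

Definition Cyl : pspace R := Defs.Space (final_topology cyl_point).

Lemma cyl_point_inj : injective cyl_point.
Proof. by move=> [x s] [y t] /(congr1 sval) /= [/sig_inj -> /sig_inj ->]. Qed.

Lemma cyl_pointP (p : Cyl) : exists q, p = cyl_point q.
Proof. by case: p => p [x [t e]]; exists (x, t); apply: sig_inj. Qed.

Definition cyl_coords (p : Cyl) : X * I01 R := sval (cid (cyl_pointP p)).

Lemma cyl_pointK : cancel (cyl_point : _ -> Cyl) cyl_coords.
Proof. by move=> q; rewrite /cyl_coords; case: cid => q' /= /cyl_point_inj. Qed.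

Lemma cyl_coordsK : cancel cyl_coords (cyl_point : _ -> Cyl).
Proof. by move=> p; rewrite /cyl_coords; case: cid => q'. Qed.

Lemma cyl_point_continuous : continuous (cyl_point : X * I01 R -> Cyl).
Proof. by apply/continuousP => U. Qed.

Lemma cyl_coords_continuous : continuous cyl_coords.
Proof.
apply/continuousP => U oU.
suff : open ((fun q => cyl_coords (cyl_point q)) @^-1` U) by [].
by rewrite (_ : (fun q => _) = id) //; apply/funext => q; exact: cyl_pointK.
Qed.

Lemma closed_CylP (C : set Cyl) :
  closed C <-> closed ((cyl_point : _ -> Cyl) @^-1` C).
Proof. by rewrite -!open_setCP. Qed.

End CylinderSpace.

Section CylinderCW.
Context (X : CW R).
Local Notation cells := (@cw_cells R X).

Definition cyl_end t n (phi : disk R n -> X) (v : disk R n) : Cyl X :=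
  cyl_point (phi v, t).

Definition cyl_side n (phi : disk R n -> X) (e : disk R n.+1) : Cyl X :=
  cyl_point (phi (cyl_split e).1, (cyl_split e).2).

(** The side over an n-cell has dimension n + 1; the match performs this shift. *)
Definition cyl_sides n : set (disk R n -> Cyl X) :=
  if n is m.+1 then [set cyl_side phi | phi in @cells m] else set0.

Definition cyl_cells n : set (disk R n -> Cyl X) :=
  [set psi | [\/ exists2 phi, @cells n phi & psi = cyl_end I0 phi,
    exists2 phi, @cells n phi & psi = cyl_end I1 phi | cyl_sides psi]].

(** Sides of dimension below [n] stand over cells of dimension below [n.-1], ends over cells below
    [n]. For [n = 0] both skeleta of [X] are empty, so the truncated predecessor does no harm. *)
Lemma skel_cyl n (x : X) t : skel set0 cyl_cells n (cyl_point (x, t)) <->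
  skel set0 cells n.-1 x \/ (skel set0 cells n x /\ ~ Iinside t).
Proof.
split.
- case=> [//|[m [psi [e [mn cpsi E]]]]]; case: cpsi E.
  + move=> [phi cphi ->] /cyl_point_inj[-> ->]; right.
    by split; [exact: skel_cell mn cphi | exact: Iinside0].
  + move=> [phi cphi ->] /cyl_point_inj[-> ->]; right.
    by split; [exact: skel_cell mn cphi | exact: Iinside1].
  + case: m psi e mn => [//|m] psi e mn [phi cphi <-] /cyl_point_inj[-> _].
    by left; apply: skel_cell cphi; rewrite ltn_predRL.
- case=> [[//|[m [phi [v [mn cphi ->]]]]]|[[//|[m [phi [v [mn cphi ->]]]]]
    t01]].
  + right; exists m.+1, (cyl_side phi), (cyl_join (v, t)).
    rewrite /cyl_side cyl_joinK; split=> //; first by rewrite -ltn_predRL.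
    by apply: Or33; exists phi.
  + right; case: (I01_cases t) => [->|->|//].
      by exists m, (cyl_end I0 phi), v; split=> //; apply: Or31; exists phi.
    by exists m, (cyl_end I1 phi), v; split=> //; apply: Or32; exists phi.
Qed.

Lemma closed_cyl_side n (phi : disk R n -> X) (C : set (Cyl X)) :
  closed (cyl_side phi @^-1` C) ->
  closed [set q : disk R n * I01 R | C (cyl_point (phi q.1, q.2))].
Proof.
move=> /(closed_preimage (@cyl_join_continuous R n)); congr closed.
by apply/seteqP; split=> q /=; rewrite /cyl_side cyl_joinK.
Qed.

Lemma closed_cyl_slice (C : set (X * I01 R)) (x : X) n (phi : disk R n -> X) v :
  x = phi v -> closed [set q : disk R n * I01 R | C (phi q.1, q.2)] ->
  closed [set t | C (x, t)].
Proof.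
move=> ->; apply: (@closed_preimage _ _ (fun t : I01 R => (v, t))).
apply: pair_continuous; first exact: continuous_const.
by move=> t; exact: cvg_id.
Qed.

Lemma Cyl_structure : cell_structure (sphere R) set0 cyl_cells.
Proof.
have [bdry int inj cover cont weak weak_skel] := CW_structure X.
have skel_pred n : skel set0 cells n.-1 `<=` skel set0 cells n.
  by apply: skel_le; exact: leq_pred.
split.
- move=> n psi [[phi cphi ->]|[phi cphi ->]|sides] _ [e Se <-].
  + apply/skel_cyl; right; split; last exact: Iinside0.
    by apply: (bdry n phi cphi); exists e.
  + apply/skel_cyl; right; split; last exact: Iinside1.
    by apply: (bdry n phi cphi); exists e.
  + case: n psi sides e Se => [//|n] psi [phi cphi <-] e /cyl_split_sphere Se.
    apply/skel_cyl; case: Se => [Sv|t01]; [left | right].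
      by apply: (bdry n phi cphi); exists (cyl_split e).1.
    by split=> //; exact: skel_cell cphi.
- move=> n psi e [[phi cphi ->]|[phi cphi ->]|sides] Se.
  + by move=> /skel_cyl h; apply: (int n phi e cphi Se);
      case: h => [/skel_pred|[]].
  + by move=> /skel_cyl h; apply: (int n phi e cphi Se);
      case: h => [/skel_pred|[]].
  + case: n psi sides e Se => [//|n] psi [phi cphi <-] e Se /skel_cyl[|[]] h.
      by apply: (int n phi _ cphi _ h) => Sv; apply: Se; apply/cyl_split_sphere;
        left.
    by apply; apply: contrapT => t01; apply: Se; apply/cyl_split_sphere; right.
- move=> n psi psi' e e'.
  have mixed (phi phi' : disk R n -> X) (s s' : I01 R) : cells phi -> cells
    phi' ->
      ~ sphere R n e -> ~ sphere R n e' ->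
      cyl_end s phi e = cyl_end s' phi' e' ->
      cyl_end s phi = cyl_end s' phi' /\ e = e'.
    move=> cphi cphi' Se Se' /cyl_point_inj[E ->].
    by have [-> ->] := inj _ _ _ _ _ cphi cphi' Se Se' E.
  (* Inner points of a side have inner height, so the open sides are disjoint from both ends. *)
  have side_inside m (phi : disk R m -> X) (d : disk R m.+1) x s :
      ~ sphere R m.+1 d -> cyl_side phi d = cyl_point (x, s) -> Iinside s.
    move=> Sd /cyl_point_inj[_ <-]; apply: contrapT => t01; apply: Sd.
    by apply/cyl_split_sphere; right.
  case=> [[phi cphi ->]|[phi cphi ->]|sides].
  + case=> [[phi' cphi' ->]|[phi' cphi' ->]|]; [exact: mixed | exact: mixed |].
    case: n phi cphi psi psi' e e' mixed => [//|n] phi cphi psi psi' e e' _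
      [phi' cphi' <-].
    by move=> Se Se' /esym /(side_inside _ _ _ _ _ Se')/Iinside0.
  + case=> [[phi' cphi' ->]|[phi' cphi' ->]|]; [exact: mixed | exact: mixed |].
    case: n phi cphi psi psi' e e' mixed => [//|n] phi cphi psi psi' e e' _
      [phi' cphi' <-].
    by move=> Se Se' /esym /(side_inside _ _ _ _ _ Se')/Iinside1.
  + case: n psi psi' e e' sides mixed => [//|n] psi psi' e e' [phi cphi <-] _.
    case=> [[phi' cphi' ->]|[phi' cphi' ->]|[phi' cphi' <-]] Se Se'.
    * by move=> /(side_inside _ _ _ _ _ Se)/Iinside0.
    * by move=> /(side_inside _ _ _ _ _ Se)/Iinside1.
    * move=> /cyl_point_inj[E1 E2].
      have Sv : ~ sphere R n (cyl_split e).1.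
        by move=> Sv; apply: Se; apply/cyl_split_sphere; left.
      have Sv' : ~ sphere R n (cyl_split e').1.
        by move=> Sv'; apply: Se'; apply/cyl_split_sphere; left.
      have [-> E] := inj _ _ _ _ _ cphi cphi' Sv Sv' E1; split=> //.
      apply: (can_inj (@cyl_splitK R n)).
      exact: injective_projections.
- apply/seteqP; split=> // p _; have [[x t] ->] := cyl_pointP p.
  have [n _ xn] : (\bigcup_n skel set0 cells n) x by rewrite cover.
  by exists n.+1 => //; apply/skel_cyl; left.
- have cend t n (phi : disk R n -> X) : cells phi -> continuous (cyl_end t phi).
    move=> cphi.
    have cp : continuous phi by exact: cont cphi.
    have c := pair_continuous cp (@continuous_const (disk R n) (I01 R) t).
    exact: (continuous_comp2 c (@cyl_point_continuous X)).
  move=> n psi [[phi cphi ->]|[phi cphi ->]|]; [exact: cend | exact: cend |].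
  case: n psi => [//|n] psi [phi cphi <-].
  have c1 := continuous_comp2 (@cyl_split_continuous R n) (@continuous_fst _ _).
  have c2 := continuous_comp2 (@cyl_split_continuous R n) (@continuous_snd _ _).
  have c3 := pair_continuous (continuous_comp2 c1 (cont _ _ cphi)) c2.
  exact: (continuous_comp2 c3 (@cyl_point_continuous X)).
- move=> C clC; rewrite closed_CylP.
  have cC n (phi : disk R n -> X) : cells phi ->
      closed [set q : disk R n * I01 R | C (cyl_point (phi q.1, q.2))].
    move=> cphi; apply: (@closed_cyl_side n phi C).
    by apply: (clC n.+1); apply: Or33; exists phi.
  apply: (@closed_prod_weak R X setT {n & {phi | @cw_cells R X n phi}}
    (fun j => disk R (projT1 j)) (fun j => sval (projT2 j))) => //.
  + by move=> B _ clB; apply: weak => n phi cphi;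
      exact: (clB (existT _ n (exist _ phi cphi))).
  + by move=> [n [phi cphi]] /=; exact: cC.
  + move=> x; have [n [phi [v [cphi xv]]]] := skel_set0_cell x.
    exact: (closed_cyl_slice xv (cC n phi cphi)).
- move=> n C Cn clC; rewrite closed_CylP.
  have cC m (phi : disk R m -> X) : (m < n.-1)%N -> cells phi ->
      closed [set q : disk R m * I01 R | C (cyl_point (phi q.1, q.2))].
    move=> mn cphi; apply: (@closed_cyl_side m phi C); apply: (clC m.+1).
      by rewrite -ltn_predRL.
    by apply: Or33; exists phi.
  (* Over [skel n.-1] the whole interval belongs to the n-skeleton of the cylinder; over the rest of
     [skel n] only the two ends do, and [clE] treats them. *)
  pose C' := [set q : X * I01 R | C (cyl_point q) /\ skel set0 cells n.-1 q.1].
  have clC' : closed C'.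
    apply: (@closed_prod_weak R X (skel set0 cells n.-1)
      {m & {phi | (m < n.-1)%N /\ @cw_cells R X m phi}}
      (fun j => disk R (projT1 j)) (fun j => sval (projT2 j))) => //.
    + move=> B Bn clB; apply: weak_skel Bn _ => m phi mn cphi.
      exact: (clB (existT _ m (exist _ phi (conj mn cphi)))).
    + by move=> q [].
    + move=> [m [phi [mn cphi]]] /=.
      have := cC m phi mn cphi; congr closed.
      apply/seteqP; split=> [q Cq|q []//]; split=> //.
      exact: skel_cell mn cphi.
    + move=> x; have [xn|xn] := pselect (skel set0 cells n.-1 x); last first.
        by rewrite (_ : [set _ | _] = set0); [exact: closed0 | apply/seteqP;
          split=> t //= []].
      case: (xn) => [//|[m [phi [v [mn cphi xv]]]]].
      have := closed_cyl_slice (C := (@cyl_point X : _ -> Cyl X) @^-1` C) xv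
        (cC m phi mn cphi).
      by congr closed; apply/seteqP; split=> [q Cq|q []//]; split.
  have clE t : (forall m phi, (m < n)%N -> @cells m phi -> @cyl_cells m
    (cyl_end t phi)) ->
      closed [set q : X * I01 R | (C (cyl_point (q.1,
        t)) /\ skel set0 cells n q.1) /\ q.2 = t].
    move=> endt.
    have clB : closed [set x | C (cyl_point (x, t)) /\ skel set0 cells n x].
      apply: (weak_skel n) => [x []//|m phi mn cphi].
      have := clC m _ mn (endt m phi mn cphi); congr closed.
      by apply/seteqP; split=> [v Cv|v []//]; split=> //;
        exact: skel_cell mn cphi.
    exact: (closedI (closed_preimage (@continuous_fst _ _) clB)
      (closed_preimage (@continuous_snd _ _) (@closed_I_eq R t))).
  have clE0 := clE I0 (fun m phi _ cphi => Or31 _ _ (ex_intro2 _ _ phi cphi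
    erefl)).
  have clE1 := clE I1 (fun m phi _ cphi => Or32 _ _ (ex_intro2 _ _ phi cphi
    erefl)).
  have := closedU (closedU clC' clE0) clE1; congr closed.
  apply/seteqP; split=> [[x t] /= [[[]//|[[Cx xn] ->]//]|[[Cx xn] ->]//]|[x t]
    /= Cxt].
  have [nx|[nx t01]] := (skel_cyl n x t).1 (Cn _ Cxt); first by left; left.
  case: (I01_cases t) => [t0|t0|//]; [left; right | right]; split=> //;
    by rewrite -t0.
Qed.

Definition Cyl_CW : CW R :=
  MkCW (cw_data := CWData cyl_cells) (cell_structure_complex Cyl_structure).

Lemma cyl_end_cmap_proof t : continuous (fun x : X => cyl_point (x,
  t) : Cyl_CW).
Proof.
have cid : continuous (@id X) by move=> x; exact: cvg_id.
have c := pair_continuous cid (@continuous_const X (I01 R) t).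
exact: (continuous_comp2 c (@cyl_point_continuous X)).
Qed.

Definition cyl_end_cmap t : cmap X Cyl_CW :=
  exist (fun f : X -> Cyl_CW => continuous f) _ (@cyl_end_cmap_proof t).

Lemma cyl_proj_proof : continuous (fun p : Cyl_CW => (cyl_coords p).1).
Proof. exact: (continuous_comp2 (@cyl_coords_continuous X) (@continuous_fst _
  _)). Qed.

Definition cyl_proj : cmap Cyl_CW X :=
  exist (fun f : Cyl_CW -> X => continuous f) _ cyl_proj_proof.

Lemma cyl_proj_end t : cmap_comp cyl_proj (cyl_end_cmap t) = cmap_id X.
Proof. by apply: sig_inj; apply/funext => x /=; rewrite cyl_pointK. Qed.

Lemma cyl_end_proj : homotopic (cmap_comp (cyl_end_cmap I1) cyl_proj) (cmap_id
  Cyl_CW).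
Proof.
(* At time 0 every height is raised to 1, at time 1 heights are unchanged. *)
pose m (r s : R) : R := Num.max r (1 - s).
exists (fun q => cyl_point ((cyl_coords q.1).1,
  Iclamp (m (sval (cyl_coords q.1).2) (sval q.2)))); split.
- have cx : continuous (fun q : Cyl X * I01 R => (cyl_coords q.1).1).
    exact: (continuous_comp2 (@continuous_fst _ _) cyl_proj_proof).
  have ct : continuous (fun q : Cyl X * I01 R => sval (cyl_coords q.1).2 : R).
    apply: (continuous_comp2 (f := fun q : Cyl X * I01 R => cyl_coords q.1)
      _ (@second_continuous R X)).
    exact: (continuous_comp2 (@continuous_fst _ _) (@cyl_coords_continuous X)).
  have cs : continuous (fun q : Cyl X * I01 R => 1 - (sval q.2 : R)).
    by move=> q; exact: (cvgB (cvg_cst (1 : R)) (@second_continuous R _ q)).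
  have cm : continuous (fun q : Cyl X * I01 R =>
      m (sval (cyl_coords q.1).2) (sval q.2)).
    by move=> q; exact: (continuous_max (ct q) (cs q)).
  exact: (continuous_comp2 (pair_continuous cx (continuous_comp2 cm
    (@Iclamp_continuous R)))
    (@cyl_point_continuous X)).
- move=> p /=; congr cyl_point; congr pair; rewrite -(Iclamp_id I1);
    congr Iclamp.
  by rewrite /m subr0; apply/max_idPr; case/andP: (I01E (cyl_coords p).2).
- move=> p /=; rewrite /m subrr (max_idPl _);
    last by case/andP: (I01E (cyl_coords p).2).
  by rewrite Iclamp_id -surjective_pairing cyl_coordsK.
Qed.

End CylinderCW.

Lemma loc_Glob_homotopic (X Y : CW R) (f g : cmap X Y) :
  homotopic f g -> loc_Glob f = loc_Glob g.
Proof.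
move=> [H [cH H0 H1]].
have ch : continuous (fun p : Cyl_CW X => H (cyl_coords p)).
  exact: (continuous_comp2 (@cyl_coords_continuous X) cH).
pose h : cmap (Cyl_CW X) Y := exist (fun k : Cyl_CW X -> Y => continuous k) _
  ch.
have -> : f = cmap_comp h (cyl_end_cmap X I0).
  by apply: sig_inj; apply/funext => x /=; rewrite cyl_pointK H0.
have -> : g = cmap_comp h (cyl_end_cmap X I1).
  by apply: sig_inj; apply/funext => x /=; rewrite cyl_pointK H1.
rewrite !loc_Glob_comp; congr cmp.
apply: (@loc_map_equiv (glCW_category R) _ (GlobO (Cyl_CW X)) (GlobO X) (GlobO
  X)
  (Glob_mor (cyl_proj X))); last first.
  have := loc_Glob_comp (cyl_proj X) (cyl_end_cmap X I0).
  by rewrite cyl_proj_end -(cyl_proj_end X I1) loc_Glob_comp => ->.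
apply: dihomotopy_S; exists (Glob_mor (cyl_end_cmap X I1)); split.
  rewrite -Glob_mor_comp cyl_proj_end -Glob_mor_id.
  exact/Glob_S_homotopic/homotopic_refl.
by rewrite -Glob_mor_comp -Glob_mor_id; apply/Glob_S_homotopic/cyl_end_proj.
Qed.

End Cylinder.

(** * Lines of a globular CW-complex *)

Section Lines.
Context (R : realType) (Z : glCW R).
Local Notation vert := (@gl_vert R Z).
Local Notation cells := (@gl_cells R Z).
Implicit Types (L gamma : I01 R -> Z) (a b c s t : I01 R).

Lemma glCW_structure : cell_structure (@gsphere R) vert cells.
Proof. exact: cell_complex_structure (@closed_gsphere R) (glCWP Z).1. Qed.

Lemma vert_skel n x : vert x -> skel vert cells n x.
Proof. by left. Qed.

Lemma closed_vert : closed vert.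
Proof. by apply: (cell_weak_skel glCW_structure (n := 0)) => //;
  rewrite skel0. Qed.

(** Only fibres over the open disk count: one over a boundary point runs inside lower cells and may
    be subdivided there. With this restriction every non-vertex lies on exactly one line. *)
Definition full_line L : Prop := exists n phi v,
  [/\ @cells n phi, ~ sphere R n v & L = fun t => phi (glob_class (v, t))].

Lemma full_line_end0 L : full_line L -> vert (L I0).
Proof.
by case=> n [phi [v [cphi _ ->]]]; rewrite glob_class0;
  have [] := (glCWP Z).2 n phi cphi.
Qed.

Lemma full_line_end1 L : full_line L -> vert (L I1).
Proof.
by case=> n [phi [v [cphi _ ->]]]; rewrite glob_class1;
  have [] := (glCWP Z).2 n phi cphi.
Qed.

Lemma full_line_inside L t : full_line L -> ~ vert (L t) <-> Iinside t.
Proof.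
move=> lL; split=> [|t01].
  by case: (I01_cases t) => [->|->|//] [];
    [exact: full_line_end0 | exact: full_line_end1].
case: lL => n [phi [v [cphi nv ->]]] /(@vert_skel n).
by apply: (cell_int glCW_structure cphi) => /(gsphere_class t01).
Qed.

(** Descent through the skeleta: a point on the boundary of a cell already lies in a lower
    skeleton. *)
Lemma full_line_ex p : ~ vert p -> exists L t, [/\ full_line L,
  Iinside t & p = L t].
Proof.
move=> np.
have [N _ pN] : (\bigcup_n skel vert cells n) p by rewrite (cell_cover
  glCW_structure).
elim: N pN => [|N IHN]; first by rewrite skel0.
case=> [//|[n [phi [e [nN cphi pe]]]]].
have [Se|/not_gsphere[v [t [t01 nv E]]]] := pselect (gsphere e).
  apply: IHN; apply: (@skel_le _ _ _ _ _ n N nN).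
  by rewrite pe; apply: (cell_bdry glCW_structure cphi); exists e.
exists (fun t => phi (glob_class (v, t))), t; split=> //; last by rewrite pe E.
by exists n, phi, v.
Qed.

Lemma full_line_unique L L' s t : full_line L -> full_line L' ->
  Iinside s -> Iinside t -> L s = L' t -> L = L'.
Proof.
case=> n [phi [v [cphi nv ->]]] [m [psi [w [cpsi nw ->]]]] s01 t01 E.
have ne : ~ gsphere (glob_class (v, s)) by move=> /(gsphere_class s01).
have nf : ~ gsphere (glob_class (w, t)) by move=> /(gsphere_class t01).
case: (ltngtP n m) => nm; last 1 first.
- subst m; have [-> /(glob_class_inj s01)[-> _]//] :=
    cell_inj glCW_structure cphi cpsi ne nf E.
- case: (cell_int glCW_structure cpsi nf); rewrite -E.
  exact: skel_cell nm cphi.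
- case: (cell_int glCW_structure cphi ne); rewrite E.
  exact: skel_cell nm cpsi.
Qed.

Lemma cell_line_continuous n (phi : Glob (disk R n) -> Z) : cells phi ->
  continuous (fun q : disk R n * I01 R => phi (glob_class (q.1, q.2))).
Proof.
move=> cphi; rewrite (_ : (fun q => _) = fun q => phi (glob_class q)).
  exact: (continuous_comp2 (@glob_class_continuous R (disk R n)) (cell_cont
    glCW_structure cphi)).
by apply/funext => -[].
Qed.

(** Boundary fibres are included, so that these paths form a continuous family over the closed disk.
    For those, non-constancy comes from the attaching condition; for the others, from a vertex at
    the start and a non-vertex at height 1/2. *)
Lemma cell_line_path n (phi : Glob (disk R n) -> Z) v : cells phi ->
  execution_path (fun t => phi (glob_class (v, t))) /\
  nonconstant (fun t => phi (glob_class (v, t))).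
Proof.
move=> cphi; have [v0 v1 bdry] := (glCWP Z).2 n phi cphi.
have cv : continuous (fun t : I01 R => (v, t)).
  by apply: pair_continuous; [exact: continuous_const | move=> t;
    exact: cvg_id].
split; first split.
- exact: (continuous_comp2 cv (cell_line_continuous cphi)).
- by left; exact: piecewise_monotone1.
have [Sv|nv] := pselect (sphere R n v).
  have [] := bdry (fun t => glob_class (v, t)) => //.
  - exact: (continuous_comp2 cv (@glob_class_continuous R (disk R n))).
  - by move=> t; apply: Or33; exists v, t.
  - by move=> s t _ _; exact: glob_le_class.
  - exact: glob_class0.
  - exact: glob_class1.
have lL : full_line (fun t => phi (glob_class (v, t))) by exists n, phi, v.
exists I0, (Ihalf R) => E.
by apply: (full_line_inside (Ihalf R) lL).2 (@Iinside_half R) _;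
  rewrite -E glob_class0.
Qed.

Lemma full_line_path L : full_line L -> execution_path L /\ nonconstant L.
Proof. by case=> n [phi [v [cphi _ ->]]]; exact: cell_line_path. Qed.

(** A normal form for execution paths: rests at vertices and complete traversals of lines. The
    pieces in the definition of execution paths are coarser, since they may run over a boundary
    point of a cell. *)
Inductive chain gamma : I01 R -> I01 R -> Prop :=
| chain_const a b of Ile a b & vert (gamma a) &
    (forall s, Isegment a b s -> gamma s = gamma a) : chain gamma a b
| chain_line a b L h of Ilt a b & full_line L & continuous h &
    h a = I0 & h b = I1 &
    (forall s, Isegment a b s -> gamma s = L (h s)) : chain gamma a b
| chain_cat a b c of Ile a b & Ile b c & chain gamma a b & chain gamma b c :
    chain gamma a c.

(** Induction on the dimension of the cell. Over an inner point, vertices occur only at heights 0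
    and 1, so the piece is a rest or a full line. Over a boundary point, the attaching condition
    cuts the fibre at vertices [tau j] into pieces in smaller cells, and this cutting is pulled back
    along [h]. *)
Lemma chain_piece gamma n (phi : Glob (disk R n) -> Z) v h a b :
  cells phi -> continuous h -> (forall s t, Ile s t -> Ile (h s) (h t)) ->
  Ile a b -> (forall s, Isegment a b s -> gamma s = phi (glob_class (v,
    h s))) ->
  vert (gamma a) -> vert (gamma b) -> chain gamma a b.
Proof.
elim/ltn_ind: n phi v h a b => n IHn phi v h a b cphi ch mh ab E va vb.
have still c : Ile a c -> Ile c b -> h a = h c -> chain gamma a c.
  move=> ac cb hac; apply: chain_const => // s [as_ sc].
  have -> : gamma s = phi (glob_class (v, h s)) by apply: E; split=> //;
    exact: Ile_trans sc cb.
  have -> : gamma a = phi (glob_class (v, h a)) by apply: E; split=> //;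
    exact: Ile_refl.
  congr (phi (glob_class (v, _))); apply: Ile_anti; last exact: mh.
  by rewrite hac; exact: mh.
have Ea : gamma a = phi (glob_class (v, h a)) by apply: E; split=> //;
  exact: Ile_refl.
have Eb : gamma b = phi (glob_class (v, h b)) by apply: E; split=> //;
  exact: Ile_refl.
have [hab|hab] := pselect (h a = h b); first exact: (still b ab (Ile_refl b)).
have [Sv|nv] := pselect (sphere R n v); last first.
  have lL : full_line (fun t => phi (glob_class (v, t))) by exists n, phi, v.
  have na : ~ Iinside (h a) by move=> /(full_line_inside _ lL)[]; rewrite -Ea.
  have nb : ~ Iinside (h b) by move=> /(full_line_inside _ lL)[]; rewrite -Eb.
  have ltab : Ilt a b.
    rewrite /Ilt lt_neqAle; apply/andP; split=> //.
    by apply/eqP => /sig_inj ab'; apply: hab; rewrite ab'.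
  have := mh _ _ ab; move: hab.
  case: (I01_cases (h a)) => [ha|ha|//]; case: (I01_cases (h b)) => [hb|hb|//].
  + by rewrite ha hb.
  + by move=> _ _; apply: (chain_line ltab lL ch ha hb E).
  + by rewrite ha hb => _ /(Ile_anti (Ile0 _)) /(congr1 sval)/= /eqP;
      rewrite eq_sym oner_eq0.
  + by rewrite ha hb.
pose L t := phi (glob_class (v, t)).
have [k [tau [[k0 lt] [tau0 tauk] vt pt]]] :
    piecewise_monotone vert (@cells_below R Z n) L.
  have [v0 v1 bdry] := (glCWP Z).2 n phi cphi.
  have [] := bdry (fun t => glob_class (v, t)) => //.
  - apply: (continuous_comp2 (f := fun t => (v,
      t)) _ (@glob_class_continuous R (disk R n))).
    by apply: pair_continuous; [exact: continuous_const | move=> t;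
      exact: cvg_id].
  - by move=> t; apply: Or33; exists v, t.
  - by move=> s t _ _; exact: glob_le_class.
  - exact: glob_class0.
  - exact: glob_class1.
have step j c d : (j < k)%N -> Ile a c -> Ile c d -> Ile d b ->
    Ile (tau j) (h c) -> Ile (h d) (tau j.+1) ->
    vert (gamma c) -> vert (gamma d) -> chain gamma c d.
  move=> jk ac cd db tc td vc vd.
  have /monotone_in_cellP[|m [psi [w [g [[mn cpsi] cg mg G]]]]] := pt j jk.
    exact: Ilt_le (lt j jk).
  apply: (IHn m mn psi w (g \o h)) => //.
  - exact: (continuous_comp2 ch cg).
  - by move=> s t /mh /mg.
  - move=> s [cs sd]; rewrite E; last first.
      by split; [exact: Ile_trans ac cs | exact: Ile_trans sd db].
    apply: G; split; first exact: Ile_trans tc (mh _ _ cs).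
    exact: Ile_trans (mh _ _ sd) td.
(* The induction follows how far along the subdivision [tau] the height has risen at the end point
   [c]. *)
suff claim j : (j <= k)%N -> forall c,
  Ile a c -> Ile c b -> Ile (h c) (tau j) ->
    vert (gamma c) -> chain gamma a c.
  by apply: (claim k (leqnn k) b ab (Ile_refl b)) => //; rewrite tauk;
    exact: Ile1.
elim: j => [|j IHj] jk c ac cb hc vc.
  apply: still => //; apply: Ile_anti; first exact: mh.
  by rewrite tau0 in hc; exact: Ile_trans hc (Ile0 _).
have [hcj|jhc] := Ile_total (h c) (tau j); first by apply: IHj => //;
  exact: ltnW.
have [haj|jha] := Ile_total (h a) (tau j); last first.
  by apply: (step j) => //; exact: Ile_refl.
(* At [d] the height crosses [tau j], so [gamma d] is a vertex: up to [d] the induction hypothesis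
   applies, and from [d] on the path stays in one smaller cell. *)
have [d [ad dc] hd] := IVT_I01 ch ac haj jhc.
have vd : vert (gamma d).
  by rewrite E ?hd; [exact: (vt j (ltnW jk)) | split=> //;
    exact: Ile_trans dc cb].
apply: (chain_cat ad dc).
- apply: IHj => //; [exact: ltnW | exact: Ile_trans dc cb |].
  by rewrite hd; exact: Ile_refl.
- by apply: (step j) => //; rewrite hd; exact: Ile_refl.
Qed.

Lemma execution_chain gamma : execution_path gamma -> chain gamma I0 I1.
Proof.
case=> _ [[k [t [[k0 lt] [t0 tk] vt pt]]]|[x [vx gx]]]; last first.
  by apply: chain_const; [exact: Ile0 | rewrite gx | move=> s _; rewrite !gx].
rewrite -t0 -tk; apply: (@subdivision_ind R (chain gamma) k t) => //;
  last exact: chain_cat.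
move=> i ik; have [|n [phi [v [h [cphi ch mh E]]]]] := (monotone_in_cellP _ _
  _).1 (pt i ik).
  exact/Ilt_le/lt.
apply: (chain_piece cphi ch mh _ E);
  [exact/Ilt_le/lt | exact/vt/ltnW | exact: vt].
Qed.

(** The link of the chain containing an inner point of [L] must be a traversal of [L] itself, by
    uniqueness of the line, and the intermediate value theorem gives all its points. The strict
    inequality records the direction of travel, which [chain_lift] needs. *)
Lemma chain_full_line gamma a b L s t : chain gamma a b -> full_line L ->
  Iinside t -> Isegment a b s -> gamma s = L t ->
  exists a1 b1, [/\ Ilt a1 b1, gamma a1 = L I0, gamma b1 = L I1 &
    forall u, exists s', gamma s' = L u].
Proof.
move=> cg lL t01; elim: cg => [{}a {}b ab va E|{}a {}b L' h ab lL' ch ha hb E|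
    {}a {}b c ab bc _ IH1 _ IH2].
- by move=> /E -> e; case: ((full_line_inside t lL).2 t01); rewrite -e.
- move=> sab; rewrite E // => e.
  have hs : Iinside (h s).
    by apply/(full_line_inside _ lL'); rewrite e; apply/full_line_inside.
  have E' := full_line_unique lL' lL hs t01 e; subst L'.
  have Ea : gamma a = L I0 by rewrite E ?ha //; split;
    [exact: Ile_refl | exact: Ilt_le].
  have Eb : gamma b = L I1 by rewrite E ?hb //; split;
    [exact: Ilt_le | exact: Ile_refl].
  exists a, b; split=> // u.
  have [||s' sab' hs'] := @IVT_I01 R h a b u ch (Ilt_le ab).
  + by rewrite ha; exact: Ile0.
  + by rewrite hb; exact: Ile1.
  + by exists s'; rewrite E // hs'.
- move=> [as_ sc] e; have [sb|bs] := Ile_total s b.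
    by apply: IH1.
  by apply: IH2.
Qed.

Lemma chain_not_vert gamma a b : chain gamma a b ->
  (forall s, Isegment a b s -> gamma s = gamma a) \/ exists s, ~ vert (gamma s).
Proof.
elim=> [{}a {}b ab va E|{}a {}b L' h ab lL' ch ha hb E|
    {}a {}b c ab bc _ IH1 _ IH2]; first by left.
- right; have [||s sab hs] := @IVT_I01 R h a b (Ihalf R) ch (Ilt_le ab).
  + by rewrite ha; exact: Ile0.
  + by rewrite hb; exact: Ile1.
  + by exists s; rewrite E // hs; apply/full_line_inside => //;
      exact: Iinside_half.
- case: IH1 => [E1|]; last by right.
  case: IH2 => [E2|]; last by right.
  left=> s [as_ sc]; have [sb|bs] := Ile_total s b; first exact: E1.
  by rewrite E2 // E1 //; split=> //; exact: Ile_refl.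
Qed.

Lemma nonconstant_not_vert gamma : execution_path gamma -> nonconstant gamma ->
  exists s, ~ vert (gamma s).
Proof.
move=> /execution_chain/chain_not_vert[E|//] [s [t]]; case.
by rewrite !E //; split; [exact: Ile0 | exact: Ile1 | exact: Ile0 |
  exact: Ile1].
Qed.

End Lines.

(** * Observables of execution paths *)

Section Observables.
Context (R : realType) (Y : pspace R).

Definition epath (Z : glCW R) : Type :=
  {gamma : I01 R -> Z | execution_path gamma /\ nonconstant gamma}.

(* The first two clauses make the value insensitive to the subdivision of
   execution paths; the parameter in [0, 1] accounts for homotopies. *)
Definition admissible (Z : glCW R) (eta : epath Z -> I01 R -> Y) : Prop :=
  [/\ forall (g g' : epath Z) s s', sval g s = sval g' s' ->
        ~ gl_vert (sval g s) -> eta g = eta g',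
      forall g g' : epath Z, sval g I1 = sval g' I0 -> eta g = eta g' &
      forall (T : topologicalType) (u : T -> epath Z),
        continuous (fun q : T * I01 R => sval (u q.1) q.2) ->
        continuous (fun q : T * I01 R => eta (u q.1) q.2)].

Definition epath_map (Z Z' : glCW R) (f : glmor Z Z') (g : epath Z) : epath Z'
  :=
  exist _ (sval f \o sval g)
    (let: And3 _ _ fp := svalP f in fp _ (svalP g).1 (svalP g).2).

Lemma epath_not_vert (Z : glCW R) (g : epath Z) : exists s,
  ~ gl_vert (sval g s).
Proof. by have [eg ng] := svalP g; exact: nonconstant_not_vert. Qed.

Lemma epath_full_line (Z : glCW R) (g : epath Z) L s t : full_line L ->
  Iinside t -> sval g s = L t -> exists a1 b1, [/\ Ilt a1 b1,
    sval g a1 = L I0, sval g b1 = L I1 & forall u, exists s', sval g s' = L u].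
Proof.
move=> lL t01 e; have [eg _] := svalP g.
by apply: (chain_full_line (execution_chain eg) lL t01 _ e); split;
  [exact: Ile0 | exact: Ile1].
Qed.

Definition epath_line (Z : glCW R) (L : I01 R -> Z) (lL : full_line L) : epath
  Z :=
  exist _ L (full_line_path lL).

(** A common non-vertex of two paths may be sent by [f] to a vertex. But both paths contain the
    whole line through that point; its image is non-constant, so it has a non-vertex, which the two
    image paths share. *)
Lemma admissible_map (Z Z' : glCW R) (f : glmor Z Z') (eta : epath Z' -> I01 R
  -> Y) :
  admissible eta -> admissible (fun g => eta (epath_map f g)).
Proof.
move=> [share junction cont]; have [cf f0 fp] := svalP f; split.
- move=> g g' s s' e nv; have [L [t [lL t01 gs]]] := full_line_ex nv.
  have [_ [_ [_ _ _ gL]]] := epath_full_line lL t01 gs.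
  have [_ [_ [_ _ _ gL']]] := epath_full_line lL t01 (etrans (esym e) gs).
  have [u nu] := epath_not_vert (epath_map f (epath_line lL)).
  have [r er] := gL u; have [r' er'] := gL' u.
  by apply: (share _ _ r r'); rewrite /= er // er'.
- by move=> g g' e; apply: junction; rewrite /= e.
- move=> T u cu; apply: (cont T (fun x => epath_map f (u x))).
  exact: (continuous_comp2 cu cf).
Qed.

Lemma admissible_continuous (Z : glCW R) (eta : epath Z -> I01 R -> Y) g :
  admissible eta -> continuous (eta g).
Proof.
move=> [_ _ cont]; have [[cg _] _] := svalP g.
have := cont (I01 R) (fun=> g) (continuous_comp2 (@continuous_snd _ _) cg).
move=> c; apply: (continuous_comp2 (f := fun s : I01 R => (I0 : I01 R, s)) _ c).
by apply: pair_continuous; [exact: continuous_const | move=> s; exact: cvg_id].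
Qed.

(** By the first clause of admissibility an observable amounts to a function on the non-vertices;
    this is the continuity of that function, jointly with the parameter. *)
Lemma admissible_open (Z : glCW R) (eta : epath Z -> I01 R -> Y) (V : set Y) :
  admissible eta -> open V -> open [set q : Z * I01 R | ~ gl_vert q.1 /\
    exists g t, sval g t = q.1 /\ V (eta g q.2)].
Proof.
move=> adm oV; have [share junction cont] := adm.
rewrite -[X in open X]setCK; apply: closed_openC.
apply: (@closed_prod_weak R Z setT {n & {phi | @gl_cells R Z n phi}}
  (fun j => Glob (disk R (projT1 j))) (fun j => sval (projT2 j))) => //.
- move=> B _ clB; apply: (cell_weak (glCW_structure Z)) => n phi cphi.
  exact: (clB (existT _ n (exist _ phi cphi))).
- move=> [n [phi cphi]] /=.
  rewrite -[X in closed X]setCK; apply: open_closedC.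
  (* On a cell, the value at an inner point of the fibre over [v] is [eta (u v)], and [u] is a
     continuous family to which the third clause applies. *)
  pose u v : epath Z := exist _ _ (cell_line_path v cphi).
  pose W := [set q : disk R n * I01 R | V (eta (u q.1) q.2)].
  have oW : open W := open_preimage (cont (disk R n) u (cell_line_continuous
    cphi)) oV.
  have oN : open [set q : Glob (disk R n) * I01 R | ~ gl_vert (phi q.1)].
    have cp := continuous_comp2 (@continuous_fst _ (I01 R)) (cell_cont
      (glCW_structure Z) cphi).
    exact: open_preimage cp (closed_openC (@closed_vert R Z)).
  have := openI oN (open_glob_mid oW); congr open.
  apply/seteqP; split=> -[e s] /=.
    move=> [nv [v [t [t01 ev Wvs]]]]; apply; split=> //; exists (u v), t.
    by rewrite ev.
  move=> /contrapT[nv [g [r [gr Vg]]]]; split=> //.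
  have [v0 v1 _] := (glCWP Z).2 n phi cphi.
  case: (glob_cases e) => [e0|e1|[v [t [t01 ev]]]].
  + by case: nv; rewrite e0.
  + by case: nv; rewrite e1.
  + exists v, t; split=> //; rewrite /W /= -(share g (u v) r t) //.
      by rewrite gr /= ev.
    by rewrite gr.
- move=> p; have [vp|np] := pselect (gl_vert p).
    rewrite (_ : [set _ | _] = setT); first exact: closedT.
    by apply/seteqP; split=> // t _ [].
  have [L [t [lL t01 pL]]] := full_line_ex np.
  rewrite (_ : [set _ | _] = eta (epath_line lL) @^-1` (~` V)).
    by apply: closed_preimage; [exact: admissible_continuous |
      exact: open_closedC].
  apply/seteqP; split=> s /= h.
    by move=> Vs; apply: h; split=> //; exists (epath_line lL), t.
  move=> [_ [g [r [gr Vg]]]]; apply: h.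
  by rewrite -(share g (epath_line lL) r t) //= ?gr ?pL // -pL.
Qed.

(** * Lifting observables along a T-homotopy equivalence *)

Section Subdivision.
Context (Z Z' : glCW R) (f : glmor Z Z') (g : Z' -> Z).
Context (cg : continuous g) (fK : cancel (sval f) g) (gK : cancel g (sval f)).

Lemma glmor_vert x : gl_vert x -> gl_vert (sval f x).
Proof. by have [_ + _] := svalP f; apply. Qed.

(** The converse may fail: [g] can send a vertex to an inner point of a line, which is then
    subdivided in [Z']. *)
Lemma inv_not_vert p : ~ gl_vert p -> ~ gl_vert (g p).
Proof. by move=> np /glmor_vert; rewrite gK. Qed.

Lemma lift_ex (c : epath Z') : exists d : epath Z,
  exists s t, ~ gl_vert (sval c s) /\ sval d t = g (sval c s).
Proof.
have [s ns] := epath_not_vert c.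
have [L [t [lL _ e]]] := full_line_ex (inv_not_vert ns).
by exists (epath_line lL), s, t.
Qed.

(** The composite of [c] with [g] need not be an execution path, its ends possibly not being
    vertices. An arbitrary path meeting it at the image of a non-vertex is chosen instead;
    [lift_pathE] shows that observables ignore the choice. *)
Definition lift_path (c : epath Z') : epath Z := sval (cid (lift_ex c)).

Section Lift.
Context (eta : epath Z -> I01 R -> Y) (adm : admissible eta).

(* Along a chain of lines of Z', the lines of Z containing them are equal or
   composable. *)
Lemma chain_lift (c : I01 R -> Z') a b : chain c a b ->
  (forall s, Isegment a b s -> c s = c a) \/
  exists da db : epath Z, [/\ eta da = eta db,
    forall s d u, Isegment a b s -> ~ gl_vert (c s) -> sval d u = g (c s) ->
      eta d = eta da,
    exists u, sval da u = g (c a) /\ (gl_vert (g (c a)) -> u = I0) &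
    exists u, sval db u = g (c b) /\ (gl_vert (g (c b)) -> u = I1)].
Proof.
have [share junction _] := adm.
elim=> [{}a {}b ab va E|{}a {}b L' h ab lL' ch ha hb E|{}a {}b e ab be _ IH1 _
  IH2].
- by left.
- right; have nL' : ~ gl_vert (L' (Ihalf R)).
    by apply/(full_line_inside _ lL'); exact: Iinside_half.
  have [L [t [lL t01 gL]]] := full_line_ex (inv_not_vert nL').
  pose d := epath_line lL.
  (* The image of [L] meets [L'] at an inner point, hence contains all of [L']; [a1] and [b1] are
     parameters of [L] at which [L'] starts and ends. *)
  have fL : sval (epath_map f d) t = L' (Ihalf R) by rewrite /= -gL gK.
  have [a1 [b1 [ab1 fa fb fu]]] := epath_full_line lL' (@Iinside_half R) fL.
  have Ea : g (c a) = L a1 by rewrite E ?ha -?fa /= ?fK //; split;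
    [exact: Ile_refl | exact: Ilt_le].
  have Eb : g (c b) = L b1 by rewrite E ?hb -?fb /= ?fK //; split;
    [exact: Ilt_le | exact: Ile_refl].
  exists d, d; split=> //.
  + move=> s d' u sab ns e; have [s' es'] := fu (h s).
    have Es : g (c s) = L s' by rewrite E // -es' /= fK.
    apply: (share _ _ u s'); first by rewrite e Es.
    by rewrite e; exact: inv_not_vert.
  (* If the starting point is a vertex of [Z], then [a1] is 0 or 1, and [a1 < b1] excludes 1. The
     other end is symmetric. *)
  + exists a1; split=> // va; case: (I01_cases a1) => [//|a11|a01].
      by have := Ile1 b1; rewrite -a11 /Ile leNgt => /negP[].
    by case: ((full_line_inside a1 lL).2 a01); rewrite -Ea.
  + exists b1; split=> // vb; case: (I01_cases b1) => [b10|//|b01].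
      by have := Ile0 a1; rewrite -b10 /Ile leNgt => /negP[].
    by case: ((full_line_inside b1 lL).2 b01); rewrite -Eb.
- have split_seg s : Isegment a e s -> Isegment a b s \/ Isegment b e s.
    by move=> [as_ se]; have [sb|bs] := Ile_total s b; [left|right].
  have sb : Isegment a b b by split=> //; exact: Ile_refl.
  have sb' : Isegment b e b by split=> //; exact: Ile_refl.
  case: IH1 => [E1|[da [db [dab pab [ua ea] [ub eb]]]]].
    have cab := E1 b sb.
    case: IH2 => [E2|[da [db [dab pab ea eb]]]].
      by left=> s /split_seg[/E1//|/E2 ->].
    right; exists da, db; split=> //; last by rewrite -cab.
    move=> s d u /split_seg[sab|sbe]; last exact: (pab s).
    by rewrite (E1 s sab) -cab; exact: (pab b).
  case: IH2 => [E2|[da' [db' [dab' pab' [ua' ea'] eb']]]].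
    right; exists da, db; split=> //; first 1 last.
    + by exists ua.
    + by exists ub; rewrite E2 //; split=> //; exact: Ile_refl.
    move=> s d u /split_seg[sab|sbe]; first exact: (pab s).
    by rewrite (E2 s sbe); exact: (pab b).
  (* Over a vertex of [Z], the path [db] ends where [da'] starts, so they are composable; otherwise
     they share a non-vertex. *)
  have mid : eta db = eta da'.
    have [vb|nb] := pselect (gl_vert (g (c b))).
      apply: junction; rewrite -(eb.2 vb) -(ea'.2 vb).
      by rewrite eb.1 ea'.1.
    by apply: (share _ _ ub ua'); rewrite eb.1 // ea'.1.
  right; exists da, db'; split=> //; [by rewrite dab mid | | by exists ua].
  move=> s d u /split_seg[sab|sbe]; first exact: (pab s).
  by rewrite dab mid; exact: (pab' s).
Qed.

Lemma lift_pathE (c : epath Z') s d u : ~ gl_vert (sval c s) ->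
  sval d u = g (sval c s) -> eta (lift_path c) = eta d.
Proof.
move=> ns e; have [ec [s1 [s2 nc]]] := svalP c.
have seg (r : I01 R) : Isegment I0 I1 r by split; [exact: Ile0 | exact: Ile1].
case: (chain_lift (execution_chain ec)) => [E|[da [_ [_ pab _ _]]]].
  by case: nc; rewrite !E.
rewrite (pab s d u (seg s) ns e) /lift_path;
  case: cid => d' /= [s' [t [ns' e']]].
exact: (pab s' d' t (seg s') ns' e').
Qed.

Lemma admissible_lift : admissible (fun c => eta (lift_path c)).
Proof.
have [share junction cont] := adm; split.
- move=> c c' s s' e ns.
  have [L [t [lL _ eL]]] := full_line_ex (inv_not_vert ns).
  rewrite (lift_pathE ns (d := epath_line lL) (esym eL)).
  by rewrite e in ns eL; rewrite (lift_pathE ns (d := epath_line lL) (esym eL)).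
- move=> c c' e.
  have seg (r : I01 R) : Isegment I0 I1 r by split; [exact: Ile0 | exact: Ile1].
  have ends (k : epath Z') : exists da db : epath Z,
    [/\ eta da = eta (lift_path k),
      eta db = eta (lift_path k),
      exists u, sval da u = g (sval k I0) /\ (gl_vert (g (sval k I0)) -> u =
        I0) &
      exists u, sval db u = g (sval k I1) /\ (gl_vert (g (sval k I1)) -> u =
        I1)].
    have [ek [s1 [s2 nk]]] := svalP k.
    case: (chain_lift (execution_chain ek)) => [E|[da [db [dab pab ea eb]]]].
      by case: nk; rewrite !E.
    have [s ns] := epath_not_vert k.
    have [L [t [lL _ eL]]] := full_line_ex (inv_not_vert ns).
    have Ek := lift_pathE ns (d := epath_line lL) (esym eL).
    have Ea := pab s (epath_line lL) t (seg s) ns (esym eL).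
    by exists da, db; split=> //; [rewrite Ek Ea | rewrite Ek Ea].
  have [_ [db [_ <- _ [u [eu vu]]]]] := ends c.
  have [da [_ [<- _ [u' [eu' vu']] _]]] := ends c'.
  (* The point where [c] and [c'] are composed may cease to be a vertex in [Z]: then the two end
     paths meet at a non-vertex instead of being composable. *)
  have [v1|n1] := pselect (gl_vert (g (sval c I1))).
    by apply: junction; rewrite -(vu v1) eu -(vu' _) ?eu' ?e // -e.
  by apply: (share _ _ u u'); rewrite eu // eu' e.
- move=> T u cu; apply/continuousP => V oV; rewrite openE => -[x0 s0] /= Vx.
  (* Vertices form a closed set, so the same [t0] gives a non-vertex on all nearby paths, and
     [lift_pathE] allows the value to be read there. *)
  have [t0 nt0] := epath_not_vert (u x0).
  have ct : continuous (fun q : T * I01 R => sval (u q.1) t0).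
    apply: (continuous_comp2 (f := fun q : T * I01 R => (q.1, t0)) _ cu).
    by apply: pair_continuous; [exact: continuous_fst |
      exact: continuous_const].
  have cgt : continuous (fun q : T * I01 R => (g (sval (u q.1) t0), q.2)).
    by apply: pair_continuous; [exact: (continuous_comp2 ct cg) |
      exact: continuous_snd].
  have oN := open_preimage ct (closed_openC (@closed_vert R Z')).
  have oV' := open_preimage cgt (admissible_open adm oV).
  have : nbhs (x0, s0) (_ `&` _) := open_nbhs_nbhs (conj (openI oN oV') _).
  case.
    split=> //=; split; first exact: inv_not_vert.
    have [L [t [lL _ eL]]] := full_line_ex (inv_not_vert nt0).
    by exists (epath_line lL), t; rewrite -(lift_pathE nt0 (d := epath_line lL)
      (esym eL)).
  move=> N Nx sub; exists N => // -[x s] /sub[/= nv [_ [d [t [et Vd]]]]].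
  by rewrite /preimage /= (lift_pathE nv et).
Qed.

Lemma lift_map (k : epath Z) : eta (lift_path (epath_map f k)) = eta k.
Proof.
have [s ns] := epath_not_vert (epath_map f k).
by rewrite (lift_pathE ns (d := k) (u := s)) //= fK.
Qed.

End Lift.

Lemma map_lift (eta : epath Z' -> I01 R -> Y) (c : epath Z') : admissible eta ->
  eta (epath_map f (lift_path c)) = eta c.
Proof.
move=> adm; have [share _ _] := adm.
have admf := admissible_map f adm.
have [s ns] := epath_not_vert c.
have [L [t [lL _ eL]]] := full_line_ex (inv_not_vert ns).
rewrite (lift_pathE admf ns (d := epath_line lL) (esym eL)).
by apply: (share _ _ t s); rewrite /= -eL gK.
Qed.

End Subdivision.
End Observables.

(** * Faithfulness *)

Section WordSemantics.
Context (C : category) (W : forall X Y : C, homset X Y -> Prop).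
Context (G : C -> Type) (eqv : forall X, G X -> G X -> Prop).
Context (pull : forall X Y, homset X Y -> G Y -> G X).
Context (eqv_refl : forall X (x : G X), eqv x x)
  (eqv_sym : forall X (x y : G X), eqv x y -> eqv y x)
  (eqv_trans : forall X (x y z : G X), eqv x y -> eqv y z -> eqv x z)
  (pull_eqv : forall X Y (f : homset X Y) y y', eqv y y' ->
    eqv (pull f y) (pull f y'))
  (pull1 : forall X (x : G X), eqv (pull (idm X) x) x)
  (pullM : forall X Y Z (g : homset Y Z) (f : homset X Y) z,
    eqv (pull (cmp g f) z) (pull f (pull g z)))
  (W_surj : forall X Y (w : homset X Y), W w ->
    forall x, exists y, eqv (pull w y) x)
  (W_inj : forall X Y (w : homset X Y), W w ->
    forall y y', eqv (pull w y) (pull w y') -> eqv y y').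

(* A contravariant functor up to [eqv] that inverts [W] interprets words as
   relations, whence no choice of inverses is needed. *)
Fixpoint word_sem X Y (p : word W X Y) : G Y -> G X -> Prop :=
  match p with
  | Arr _ _ f => fun y x => eqv (pull f y) x
  | Defs.Inv _ _ w _ => fun x y => eqv (pull w y) x
  | Comp _ _ _ q p => fun z x => exists2 y, word_sem q z y & word_sem p y x
  end.

Lemma word_sem_eqv X Y (p : word W X Y) y y' x x' :
  eqv y y' -> eqv x x' -> word_sem p y x -> word_sem p y' x'.
Proof.
elim: p y y' x x' => [{}X {}Y f|{}X {}Y w Ww|{}X {}Y Z q IHq p IHp] y y' x x'
  yy xx /=.
- by move=> h; apply: eqv_trans xx; apply: eqv_trans h; apply: pull_eqv;
    exact: eqv_sym.
- by move=> h; apply: eqv_trans yy; apply: eqv_trans h; apply: pull_eqv;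
    exact: eqv_sym.
- by case=> z qz pz; exists z; [exact: IHq qz | exact: IHp pz].
Qed.

(** The two relations for a formal inverse correspond to the two halves of bijectivity: [W_surj]
    gives the left inverse law and [W_inj] the right one. *)
Lemma word_eq_sem X Y (p q : word W X Y) : word_eq p q ->
  forall y x, word_sem p y x <-> word_sem q y x.
Proof.
elim=> {X Y p q} [X Y p|X Y p q _ IH|X Y p q r _ IH1 _ IH2|X Y Z q q' p p' _
  IHq _ IHp
  |V X Y Z r q p|X Y p|X Y p|X Y Z g f|X Y w Ww|X Y w Ww] y x /=.
- by [].
- by rewrite IH.
- by rewrite IH1 IH2.
- by split=> -[z /IHq qz /IHp pz]; exists z.
- split=> [[z rz [w qw pw]]|[w [z rz qw] pw]]; first by exists w => //;
    exists z.
  by exists z => //; exists w.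
- split=> [[z yz]|pyx].
    by apply: word_sem_eqv => //; apply: eqv_sym; apply: eqv_trans yz;
      apply: eqv_sym.
  by exists y.
- split=> [[z yz zx]|pyx].
    by apply: word_sem_eqv yz => //; apply: eqv_trans zx; apply: eqv_sym.
  by exists x.
- split=> [[z yz zx]|yx].
    by apply: eqv_trans (pullM _ _ _) _; apply: eqv_trans zx; exact: pull_eqv.
  by exists (pull g y) => //; apply: eqv_trans yx; exact: eqv_sym.
- split=> [[z yz zx]|yx].
    by apply: eqv_trans (pull1 _) _; apply: eqv_trans zx; exact: eqv_sym.
  have [z zy] := W_surj Ww y; exists z => //.
  by apply: eqv_trans zy _; apply: eqv_trans yx; exact: eqv_sym.
- split=> [[z yz zx]|yx].
    apply: eqv_trans (pull1 _) _; apply: (W_inj Ww).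
    by apply: eqv_trans yz _; exact: eqv_sym.
  exists (pull w y) => //; apply: pull_eqv; apply: eqv_sym.
  by apply: eqv_trans yx; exact: eqv_sym.
Qed.

Lemma loc_map_pull X Y (f g : homset X Y) : loc_map W f = loc_map W g ->
  forall y, eqv (pull f y) (pull g y).
Proof.
move=> e y.
have fg : word_eq (Arr W f) (Arr W g) :=
  @cls_inj _ (@word_eq C W X Y) (@word_refl C W X Y) _ _ e.
by apply: eqv_sym; apply: ((word_eq_sem fg y (pull f y)).1 _).
Qed.

End WordSemantics.

Section Faithful.
Context (R : realType).

(** * Homotopy classes of observables *)

Section Homotopy.
Context (Y : pspace R).

(** A dummy parameter lets observables and their homotopies share the lemmas on admissibility;
    evaluating at [I0] removes it. *)
Definition observable (Z : glCW R) : Type :=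
  {y : epath Z -> Y | admissible (fun g _ => y g)}.

Definition obs_homotopic (Z : glCW R) (a b : observable Z) : Prop :=
  exists eta : epath Z -> I01 R -> Y, [/\ admissible eta,
    forall g, eta g I0 = sval a g & forall g, eta g I1 = sval b g].

(** Taking the closure avoids concatenating homotopies of observables; after evaluation on lines,
    [homotopic] is already an equivalence relation. *)
Definition obs_eqv (Z : glCW R) : observable Z -> observable Z -> Prop :=
  Relation_Operators.clos_refl_sym_trans _ (@obs_homotopic Z).

Definition obs_map (Z Z' : glCW R) (f : glmor Z Z') (y : observable Z') :
  observable Z :=
  exist (fun y : epath Z -> Y => admissible (fun g _ => y g))
    (fun g => sval y (epath_map f g)) (admissible_map f (svalP y)).

Lemma obs_map_eqv (Z Z' : glCW R) (f : glmor Z Z') y y' :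
  obs_eqv y y' -> obs_eqv (obs_map f y) (obs_map f y').
Proof.
elim=> [a b [eta [adm e0 e1]]|a|a b _ IH|a b c _ IH1 _ IH2].
- apply: Relation_Operators.rst_step; exists (fun g => eta (epath_map f g)).
  by split=> [|g|g]; [exact: admissible_map | exact: e0 | exact: e1].
- exact: Relation_Operators.rst_refl.
- exact: Relation_Operators.rst_sym.
- exact: Relation_Operators.rst_trans IH1 IH2.
Qed.

Lemma epath_map_id (Z : glCW R) (g : epath Z) : epath_map (glmor_id Z) g = g.
Proof. exact: sig_inj. Qed.

Lemma epath_map_comp (Z Z' Z'' : glCW R) (h : glmor Z' Z'') (f : glmor Z Z') g :
  epath_map (glmor_comp h f) g = epath_map h (epath_map f g).
Proof. exact: sig_inj. Qed.

Lemma obs_map_id (Z : glCW R) (y : observable Z) : obs_map (glmor_id Z) y = y.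
Proof. by apply: sig_inj; apply/funext => g /=; rewrite epath_map_id. Qed.

Lemma obs_map_comp (Z Z' Z'' : glCW R) (h : glmor Z' Z'') (f : glmor Z Z') y :
  obs_map (glmor_comp h f) y = obs_map f (obs_map h y).
Proof. by apply: sig_inj; apply/funext => g /=; rewrite epath_map_comp. Qed.

Lemma S_homotopic_obs (Z Z' : glCW R) (f g : glmor Z Z') (y : observable Z') :
  S_homotopic f g -> obs_eqv (obs_map f y) (obs_map g y).
Proof.
move=> [H [cH H0 H1 Hm]]; apply: Relation_Operators.rst_step.
pose h t : glmor Z Z' := exist _ _ (Hm t).
have adm t := admissible_map (h t) (svalP y).
exists (fun c t => sval y (epath_map (h t) c)); split; last 2 first.
- by move=> c; congr (sval y _); apply: sig_inj; apply/funext => s /=;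
    rewrite H0.
- by move=> c; congr (sval y _); apply: sig_inj; apply/funext => s /=;
    rewrite H1.
split.
- move=> c c' s s' e ns; apply/funext => t; have [share _ _] := adm t.
  exact: (congr1 (@^~ I0) (share c c' s s' e ns)).
- move=> c c' e; apply/funext => t; have [_ junction _] := adm t.
  exact: (congr1 (@^~ I0) (junction c c' e)).
- move=> T u cu; have [_ _ cont] := svalP y.
  have c1 : continuous (fun q : T * I01 R * I01 R => (q.1.1, q.2)).
    apply: pair_continuous; last exact: continuous_snd.
    exact: (continuous_comp2 (@continuous_fst _ _) (@continuous_fst _ _)).
  have c2 : continuous (fun q : T * I01 R * I01 R => q.1.2).
    exact: (continuous_comp2 (@continuous_fst _ _) (@continuous_snd _ _)).
  have c3 := continuous_comp2 (pair_continuous (continuous_comp2 c1 cu) c2) cH.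
  (* The time of the homotopy becomes part of the test space, and the dummy parameter of [y] is then
     set to [I0]. *)
  have := cont _ (fun q : T * I01 R => epath_map (h q.2) (u q.1)) c3.
  move=> c4; apply: (continuous_comp2 (f := fun q : T * I01 R => (q, I0)) _ c4).
  by apply: pair_continuous; [move=> q;
    exact: cvg_id | exact: continuous_const].
Qed.

Lemma dihomotopy_obs (Z Z' : glCW_category R) (f : homset Z Z') :
  dihomotopy_equivalence f ->
  (forall x, exists y, obs_eqv (obs_map f y) x) /\
  (forall y y', obs_eqv (obs_map f y) (obs_map f y') -> obs_eqv y y').
Proof.
elim=> {Z Z' f} [Z Z' f [g [fg gf]]|Z Z' f [g [cg fK gK]]|
    Z Z' Z'' g f _ [surj_g inj_g] _ [surj_f inj_f]].
- have gfK x : obs_eqv (obs_map f (obs_map g x)) x.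
    by rewrite -obs_map_comp -[X in obs_eqv _ X]obs_map_id;
      exact: S_homotopic_obs.
  have fgK y : obs_eqv (obs_map g (obs_map f y)) y.
    by rewrite -obs_map_comp -[X in obs_eqv _ X]obs_map_id;
      exact: S_homotopic_obs.
  split=> [x|y y' /(obs_map_eqv g) e]; first by exists (obs_map g x).
  apply: Relation_Operators.rst_trans (fgK y').
  by apply: Relation_Operators.rst_trans e;
    exact/Relation_Operators.rst_sym/fgK.
- have admL (eta : epath Z -> I01 R -> Y) := @admissible_lift R Y Z Z' f g cg
    fK gK eta.
  pose lift (x : observable Z) : observable Z' := exist
    (fun y : epath Z' -> Y => admissible (fun g _ => y g)) _ (admL _ (svalP x)).
  split=> [x|y y' e].
    exists (lift x); rewrite (_ : obs_map f _ = x);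
      first exact: Relation_Operators.rst_refl.
    apply: sig_inj; apply/funext => k.
    exact: (congr1 (@^~ I0) (lift_map fK gK (svalP x) k)).
  have liftK z : lift (obs_map f z) = z.
    apply: sig_inj; apply/funext => k.
    exact: (congr1 (@^~ I0) (map_lift fK gK k (svalP z))).
  (* Lifting carries each elementary homotopy in [e] to one between the lifts, which are [y] and
     [y'] again. *)
  rewrite -(liftK y) -(liftK y').
  elim: e => [a b [eta [adm e0 e1]]|a|a b _ IH|a b c _ IH1 _ IH2].
  + apply: Relation_Operators.rst_step; exists (fun c => eta (lift_path gK c)).
    by split=> [|k|k]; [exact: (admL _ adm) | exact: e0 | exact: e1].
  + exact: Relation_Operators.rst_refl.
  + exact: Relation_Operators.rst_sym.
  + exact: Relation_Operators.rst_trans IH1 IH2.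
- split=> [x|y y'].
    have [y yx] := surj_f x; have [z zy] := surj_g y.
    exists z; rewrite obs_map_comp.
    by apply: Relation_Operators.rst_trans yx; exact: obs_map_eqv.
  by rewrite !obs_map_comp => /inj_f/inj_g.
Qed.

Lemma loc_map_obs (Z Z' : glCW_category R) (f g : homset Z Z') :
  loc_map (@dihomotopy_equivalence R) f = loc_map (@dihomotopy_equivalence R) g
    ->
  forall y, obs_eqv (obs_map f y) (obs_map g y).
Proof.
move=> e; apply: (@loc_map_pull (glCW_category R) (@dihomotopy_equivalence R)
  observable (@obs_eqv) (@obs_map)) e.
- by move=> X x; exact: Relation_Operators.rst_refl.
- by move=> X x y; exact: Relation_Operators.rst_sym.
- by move=> X x y z; exact: Relation_Operators.rst_trans.
- exact: obs_map_eqv.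
- by move=> X x; rewrite obs_map_id; exact: Relation_Operators.rst_refl.
- by move=> X X' X'' h k z; rewrite obs_map_comp;
    exact: Relation_Operators.rst_refl.
- by move=> X X' w /dihomotopy_obs[].
- by move=> X X' w /dihomotopy_obs[].
Qed.

End Homotopy.

(** * The fibre observable on the globe of a CW-complex *)

Section Fibre.
Context (Y : CW R).

(** Each piece is non-decreasing for the order of the whole globe, which is transitive, so the path
    is non-decreasing and keeps to one fibre. Being non-constant with both ends at poles, it goes
    from source to target. *)
Lemma glob_epath (c : epath (GlobO Y)) : exists y : Y, [/\
  forall s, sval c s = glob_class (y, gheight (sval c s) : I01 R),
  gheight (sval c I0) = I0 & gheight (sval c I1) = I1].
Proof.
case: c => c /= [[cc [pc|[x [_ cx]]]] [s1 [s2 nc]]]; last by case: nc;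
  rewrite !cx.
have [k [t [[k0 lt] [t0 tk] vt pt]]] := pc.
have mono s r : Ile s r -> glob_le (c s) (c r).
  move=> sr.
  suff: forall s r, Isegment I0 I1 s -> Isegment I0 I1 r -> Ile s r -> glob_le
    (c s) (c r).
    by apply=> //; split; [exact: Ile0 | exact: Ile1 | exact: Ile0 |
      exact: Ile1].
  rewrite -t0 -tk.
  apply: (@subdivision_ind R (fun a b => forall s r,
    Isegment a b s -> Isegment a b r ->
    Ile s r -> glob_le (c s) (c r)) k t) => // [i ik|a b d ab bd ha hb].
    have [|n [_ [v [h [[phi _ <-] _ mh E]]]]] := (monotone_in_cellP _ _ _).1
      (pt i ik).
      exact/Ilt_le/lt.
    move=> {sr} {}s {}r si ri /mh hsr; rewrite E // E // !Glob_map_class.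
    exact: glob_le_class.
  move=> {sr} {}s {}r [as_ sd] [ar rd] sr.
  have [sb|bs] := Ile_total s b; have [rb|br] := Ile_total r b.
  - exact: ha.
  - apply: (@glob_le_trans _ _ _ (c b)).
      by apply: ha => //; split=> //; exact: Ile_refl.
    by apply: hb => //; split=> //; exact: Ile_refl.
  - have <- : s = r by apply: Ile_anti => //; exact: Ile_trans rb bs.
    by left.
  - exact: hb.
(* The first piece only provides some point of [Y], as required by [monotone_path_class]. *)
have [|n [_ [v [h [[phi _ _] _ _ _]]]]] := (monotone_in_cellP _ _ _).1 (pt 0%N
  k0).
  exact/Ilt_le/lt.
have [y yE] := monotone_path_class (phi v) mono.
have pole s : gl_vert (g := Glob_data Y) (c s) -> gheight (c s) = I0 \/ gheight
  (c s) = I1.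
  by case=> ->; [left | right].
have const p : (forall s, gheight (c s) = p) -> False.
  by move=> hp; apply: nc; rewrite (yE s1) (yE s2) !hp.
exists y; split=> //.
- have := vt 0%N (leq0n _); rewrite t0 => /pole[//|h1].
  case: (const I1) => s; apply: Ile_anti; first exact: Ile1.
  by rewrite -h1; apply: glob_le_height; apply: mono; exact: Ile0.
- have := vt k (leqnn _); rewrite tk => /pole[h0|//].
  case: (const I0) => s; apply: Ile_anti; last exact: Ile0.
  by rewrite -h0; apply: glob_le_height; apply: mono; exact: Ile1.
Qed.

Definition fibre (c : epath (GlobO Y)) : Y := sval (cid (glob_epath c)).

Lemma fibreE (c : epath (GlobO Y)) s :
  sval c s = glob_class (fibre c, gheight (sval c s) : I01 R).
Proof. by rewrite /fibre; case: cid => y [/= E _ _]; exact: E. Qed.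

Lemma glob_not_vert (p : Glob Y) :
  ~ gl_vert (g := Glob_data Y) p -> Iinside (gheight p : I01 R).
Proof.
move=> np; case: (I01_cases (gheight p)) => [/gheight0 h|/gheight1 h|//].
  by case: np; left.
by case: np; right.
Qed.

Lemma fibre_admissible : admissible (fun c _ => fibre c).
Proof.
split.
- move=> c c' s s' e /glob_not_vert h; apply/funext => _.
  by move: (e); rewrite fibreE [RHS]fibreE => /(glob_class_inj h)[].
(* Vacuous: [c] ends at the target and [c'] starts at the source. *)
- move=> c c' e; exfalso; have [_ [_ _ h1]] := glob_epath c.
  have [_ [_ h0 _]] := glob_epath c'.
  by move: h0; rewrite -e h1 => /(congr1 sval)/= /eqP; rewrite oner_eq0.
- move=> T u cu; apply/continuousP => V oV; rewrite openE => -[x0 s0] /= Vx.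
  have [t0 nt0] := epath_not_vert (u x0).
  have ct : continuous (fun q : T * I01 R => (sval (u q.1) t0, q.2)).
    apply: pair_continuous; last exact: continuous_snd.
    apply: (continuous_comp2 (f := fun q : T * I01 R => (q.1, t0)) _ cu).
    by apply: pair_continuous; [exact: continuous_fst |
      exact: continuous_const].
  have oW := open_preimage (@continuous_fst Y (I01 R)) oV.
  have oM := open_preimage ct (open_glob_mid oW).
  have : nbhs (x0, s0) _ := open_nbhs_nbhs (conj oM _).
  case.
    exists (fibre (u x0)), (gheight (sval (u x0) t0)); split=> //;
      last exact: fibreE.
    exact: glob_not_vert.
  move=> N Nx sub; exists N => // -[x s] /sub[y [t [/= t01 e Vy]]].
  rewrite /preimage /=; have := fibreE (u x) t0; rewrite {1}e.
  by move=> /(glob_class_inj t01)[<-].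
Qed.

Definition fibre_obs : observable Y (GlobO Y) :=
  exist (fun y : epath (GlobO Y) -> Y => admissible (fun g _ => y g)) _
    fibre_admissible.

End Fibre.

(** * Evaluation of observables on the lines of a globe *)

Section Evaluation.
Context (X Y : CW R).

Lemma glob_line_path (x : X) :
  @execution_path R (Glob_data X) (fun t => glob_class (x, t)) /\
  nonconstant (fun t : I01 R => glob_class (x, t)).
Proof.
have [n [phi [v [cphi ->]]]] := skel_set0_cell x.
have cG : @gl_cells R (GlobO X) n (Glob_map phi) by exists phi.
have := cell_line_path v cG.
by rewrite (_ : (fun t => _) = fun t => glob_class (phi v, t)) //;
  apply/funext => t; exact: Glob_map_class.
Qed.

Definition glob_line (x : X) : epath (GlobO X) := exist _ _ (glob_line_path x).

Lemma glob_line_continuous :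
  continuous (fun q : X * I01 R => sval (glob_line q.1) q.2).
Proof.
rewrite (_ : (fun q => _) = @glob_class R X);
  first exact: glob_class_continuous.
by apply/funext => -[].
Qed.

Lemma obs_eval_proof (a : observable Y (GlobO X)) :
  continuous (fun x => sval a (glob_line x)).
Proof.
have [_ _ /(_ X glob_line glob_line_continuous) c] := svalP a.
apply: (continuous_comp2 (f := fun x : X => (x, I0 : I01 R)) _ c).
by apply: pair_continuous; [move=> x; exact: cvg_id | exact: continuous_const].
Qed.

Definition obs_eval (a : observable Y (GlobO X)) : cmap X Y :=
  exist (fun f : X -> Y => continuous f) _ (@obs_eval_proof a).

Lemma obs_eval_homotopic (a b : observable Y (GlobO X)) :
  obs_eqv a b -> homotopic (obs_eval a) (obs_eval b).
Proof.
elim=> [{}a {}b [eta [[_ _ cont] e0 e1]]|{}a|{}a {}b _ IH|{}a {}b c _ IH1 _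
  IH2].
- exists (fun q => eta (glob_line q.1) q.2); split=> [|x|x].
  + exact: (cont X glob_line glob_line_continuous).
  + exact: e0.
  + exact: e1.
- exact: homotopic_refl.
- exact: homotopic_sym.
- exact: homotopic_trans IH1 IH2.
Qed.

Lemma obs_eval_fibre (f : cmap X Y) :
  obs_eval (obs_map (Glob_mor f) (fibre_obs Y)) = f.
Proof.
apply: sig_inj; apply/funext => x /=.
have := fibreE (epath_map (Glob_mor f) (glob_line x)) (Ihalf R).
by rewrite /= !Glob_map_class => /(glob_class_inj (@Iinside_half R))[].
Qed.

Lemma loc_Glob_inj (f g : cmap X Y) :
  loc_Glob f = loc_Glob g -> homotopic f g.
Proof.
move=> /loc_map_obs /(_ (fibre_obs Y))/obs_eval_homotopic.
by rewrite !obs_eval_fibre.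
Qed.

End Evaluation.
End Faithful.

(** * Injectivity on objects *)

Section ObjectInjectivity.
Context (R : realType).

Lemma topology_on_eq (T : Type) (s t : topology_on T) :
  is_open s = is_open t -> s = t.
Proof.
case: s t => [P PT PI PU] [P' PT' PI' PU'] /= E; subst P'.
by congr TopologyOn; exact: Prop_irrelevance.
Qed.

(** Like [map_graph] below, this lives in a type that does not depend on the space, so it can be
    compared before two spaces are identified. *)
Definition open_trace (X : pspace R) (V : set (upoint R)) : Prop :=
  open [set x : X | V (sval x)].

Definition map_graph (E X : pspace R) (f : E -> X) (p q : upoint R) : Prop :=
  exists e, p = sval e /\ q = sval (f e).

Lemma map_graph_inj (E X : pspace R) : injective (@map_graph E X).
Proof.
move=> f g fg; apply/funext => e; apply: sig_inj.
have : map_graph f (sval e) (sval (f e)) by exists e.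
by rewrite fg => -[e' [/sig_inj <-]].
Qed.

Lemma CW_data_eq (X Y : CW_data R) : pts X = pts Y ->
  open_trace X = open_trace Y ->
  (forall n, [set map_graph phi | phi in @cw_cells R X n] =
    [set map_graph phi | phi in @cw_cells R Y n]) -> X = Y.
Proof.
case: X => -[P s] c; case: Y => -[P' t] c' /= E; subst P' => ot gr.
have E : s = t.
  apply: topology_on_eq; apply/funext => U.
  have UE : U = [set x | (sval @` U) (sval x)].
    by apply/seteqP; split=> x /=; [exists x | case=> y Uy /sig_inj <-].
  by rewrite UE; exact: (congr1 (@^~ (sval @` U)) ot).
subst t; congr CWData.
apply: functional_extensionality_dep => n; apply/seteqP; split=> phi cphi.
  have : [set map_graph phi | phi in c n] (map_graph phi) by exists phi.
  by rewrite gr => -[psi cpsi /map_graph_inj <-].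
have : [set map_graph phi | phi in c' n] (map_graph phi) by exists phi.
by rewrite -gr => -[psi cpsi /map_graph_inj <-].
Qed.

(* Equality of globes cannot be eliminated directly, because the types of the
   topology and of the cells depend on the points; these invariants of a
   globular complex do not, and they determine the level 1/2 of a globe. *)
Definition mid_level (p : upoint R) : upoint R := Mid p (2^-1).

Definition mid_trace (D : glCW_data R) (V : set (upoint R)) : Prop :=
  open [set p : D | exists x t, sval p = Mid x t /\ V x].

Definition mid_graphs (D : glCW_data R) n : set (upoint R -> upoint R -> Prop)
  :=
  [set (fun p q => map_graph phi (mid_level p) (mid_level q)) |
    phi in @gl_cells R D n].

Lemma glob_pts_mid (X : pspace R) : [set p |
  pts (Glob X) (mid_level p)] = pts X.
Proof.
apply/seteqP; split=> p /=.
  by case=> // -[x [t [_ [-> _]]]]; exact: svalP.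
by move=> Xp; apply: Or33; exists (exist _ p Xp), 2^-1; split=> //; apply/andP;
  split; lra.
Qed.

Lemma mid_classE (X : pspace R) (x : X) (t : I01 R) : Iinside t ->
  sval (glob_class (x, t)) = Mid (sval x) (sval t).
Proof.
by case/andP=> t0 t1; rewrite /= /glob_point /= (gt_eqF t0) (lt_eqF t1).
Qed.

Lemma mid_level_class (X : pspace R) (x : X) :
  mid_level (sval x) = sval (glob_class (x, Ihalf R)).
Proof. by rewrite mid_classE ?IhalfE //; exact: Iinside_half. Qed.

(** The trace of [V] times the open interval is open exactly when the trace of [V] is: restrict to
    height 1/2 in one direction, take a product in the other. *)
Lemma mid_trace_Glob (X : CW R) : mid_trace (Glob_data X) = open_trace X.
Proof.
apply/funext => V; apply/propext; rewrite /mid_trace /open_trace.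
have E : (@glob_class R X : X * I01 R -> Glob X) @^-1`
    [set p : Glob X | exists x t, sval p = Mid x t /\ V x] =
    (fst @^-1` [set x : X | V (sval x)]) `&` (snd @^-1` @Iinside R).
  apply/seteqP; split=> -[x t] /=.
    rewrite -[glob_point _]/(sval (glob_class (x, t))) => -[y [r [e Vy]]].
    have t01 : Iinside t.
      by case: (I01_cases t) e => [->|->|//]; rewrite ?glob_class0 ?glob_class1.
    by move: e; rewrite mid_classE // => -[-> _].
  move=> [Vx t01]; exists (sval x), (sval t); split=> //.
  exact: mid_classE.
split=> [/open_GlobP|oV].
  rewrite E => oE.
  have c : continuous (fun x : X => (x, Ihalf R)).
    by apply: pair_continuous; [move=> x;
      exact: cvg_id | exact: continuous_const].
  have := open_preimage c oE; congr open.
  by apply/seteqP; split=> x /=; [case | split=> //; exact: Iinside_half].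
apply/open_GlobP; rewrite E; apply: openI.
  exact: open_preimage (@continuous_fst _ _) oV.
exact: open_preimage (@continuous_snd _ _) (@open_Iinside R).
Qed.

(** Since [Glob_map phi] preserves heights, its restriction to height 1/2 is a copy of [phi]. *)
Lemma mid_graphs_Glob (X : CW R) n : mid_graphs (Glob_data X) n =
  [set map_graph phi | phi in @cw_cells R X n].
Proof.
have E (phi : disk R n -> X) : (fun p q =>
    map_graph (Glob_map phi) (mid_level p) (mid_level q)) = map_graph phi.
  apply/funext => p; apply/funext => q; apply/propext; split.
    case=> e [pe qe]; have eh : sval e = Mid p (sval (Ihalf R)) by rewrite
      IhalfE.
    case: (glob_cases e) => [e0|e1|[v [t [t01 ev]]]].
    + by move: eh; rewrite e0.
    + by move: eh; rewrite e1.
    + move: pe qe; rewrite /mid_level ev Glob_map_class !mid_classE // => -[pv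
        _] [qv _].
      by exists v.
  case=> v [-> ->]; exists (glob_class (v, Ihalf R)).
  by rewrite Glob_map_class !mid_level_class.
apply/seteqP; split=> P.
  by case=> _ [phi cphi <-] <-; exists phi.
by case=> phi cphi <-; exists (Glob_map phi) => //; exists phi.
Qed.

Lemma GlobO_inj : injective (@GlobO R).
Proof.
move=> X Y /(congr1 (@gl_data R)) /= e.
suff : cw_data X = cw_data Y.
  case: X Y {e} => [D DP] [D' DP'] /= E; subst D'.
  by congr MkCW; exact: Prop_irrelevance.
apply: CW_data_eq => [||n].
- by rewrite -(glob_pts_mid X) -(glob_pts_mid Y) (congr1 (fun D => pts
    (@gl_space R D)) e).
- by rewrite -!mid_trace_Glob e.
- by rewrite -!mid_graphs_Glob e.
Qed.

End ObjectInjectivity.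

(** The functor is defined on chosen representatives of homotopy classes; this makes the choice
    immaterial. *)
Lemma loc_Glob_rep (R : realType) (X Y : CW R) (f : cmap X Y) :
  loc_Glob (rep (homotopy_class f)) = loc_Glob f.
Proof. exact/loc_Glob_homotopic/(@prel_rep (CW_precategory R)). Qed.

Lemma homotopy_classK (R : realType) (X Y : CW R) (c : @homset (HoCW R) X Y) :
  homotopy_class (rep c) = c.
Proof. exact: repK. Qed.

Lemma Ho_Glob1 (R : realType) (X : HoCW R) :
  loc_Glob (rep (@idm (HoCW R) X)) = @idm (HoglCW R) (GlobO X).
Proof.
rewrite -[idm X]/(homotopy_class (cmap_id X)) loc_Glob_rep.
by rewrite /loc_Glob Glob_mor_id; exact: loc_map1.
Qed.

Lemma Ho_GlobM (R : realType) (X Y Z : HoCW R) (g : homset Y Z) (f : homset X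
  Y) :
  loc_Glob (rep (cmp g f)) = cmp (loc_Glob (rep g)) (loc_Glob (rep f)).
Proof.
rewrite -[cmp g f]/(homotopy_class (cmap_comp (rep g) (rep f))) loc_Glob_rep.
exact: loc_Glob_comp.
Qed.

Definition Ho_Glob (R : realType) : @functor_on (HoCW R) (HoglCW R) (@GlobO R)
  :=
  FunctorOn (@Ho_Glob1 R) (@Ho_GlobM R).

Theorem theorem5p9 (R : realType) :
  exists hG : forall X : CW R, is_glCW (Glob_data X),
  let GlobO := fun X : CW R => MkGlCW (hG X) in
  exists hM : forall (X Y : CW R) (f : cmap X Y),
    is_glCW_morphism (X := GlobO X) (Y := GlobO Y) (Glob_map (sval f)),
  exists F : @functor_on (HoCW R) (HoglCW R) GlobO,
    [/\ forall (X Y : CW R) (f : cmap X Y),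
          fmor F (homotopy_class f) =
          fmor loc_Q (exist _ (Glob_map (sval f)) (hM X Y f) :
                    @homset (glCW_category R) (GlobO X) (GlobO Y)),
        faithful F &
        injective GlobO].
Proof.
exists (@Glob_glCW R) => GlobO.
exists (fun X Y f => Glob_morphism (svalP f)); exists (Ho_Glob R); split.
- by move=> X Y f; exact: loc_Glob_rep.
- move=> X Y c d /= /loc_Glob_inj h.
  rewrite -(homotopy_classK c) -(homotopy_classK d).
  exact: (@pcls_eq (CW_precategory R)).
- exact: GlobO_inj.
Qed.
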